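(* Let $n\geqslant 1$, $\tau>0$, $\delta>0$, $s\in[0,\infty)$ and $(\psi_0,\psi_1,\psi_2)\in\mathcal{A}_s$. Let $\psi=\psi(t,x)$ be the solution to the Cauchy problem $$\begin{cases}\tau\psi_{ttt}+\psi_{tt}-\Delta\psi-(\delta+\tau)\Delta\psi_t=0, & x\in\mathbb{R}^n,\ t>0,\\ \psi(0,x)=\psi_0(x),\ \psi_t(0,x)=\psi_1(x),\ \psi_{tt}(0,x)=\psi_2(x), & x\in\mathbb{R}^n,\end{cases}$$ and put $\Psi_{1,2}:=\psi_1+\tau\psi_2$ and $\Psi_{0,2}:=\psi_0-\tau^2\psi_2$. Then, for $\ell=0,1,2$ and $0\leqslant k\leqslant s+2-\ell$, the following estimate holds for large time $t\gg1$: $$\left\|\partial_t^{\ell}\psi(t,\cdot)-\left(\frac{1}{|D|}\mathrm{e}^{\frac{\delta}{2}\Delta t}\partial_t^{\ell}\sin(|D|t)+\mathcal{N}_{\ell}(t,|D|)\right)\Psi_{1,2}(\cdot)-\mathrm{e}^{\frac{\delta}{2}\Delta t}\partial_t^{\ell}\cos(|D|t)\,\Psi_{0,2}(\cdot)\right\|_{\dot{H}^k}\lesssim (1+t)^{-\frac{n}{4}-\frac{k+1+\ell}{2}}\,\|(\psi_0,\psi_1,\psi_2)\|_{\mathcal{A}_{(k-2+\ell)^+}}.$$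
   Context: For $s\geqslant 0$, $\mathcal{A}_s:=(H^{s+2}\cap L^1)\times(H^{s+1}\cap L^1)\times(H^s\cap L^1)$ on $\mathbb{R}^n$, with its natural norm (sum of the Sobolev norms and of the $L^1$ norms of the components). $(a)^+:=\max\{a,0\}$. $\|f\|_{\dot H^k}=\||D|^kf\|_{L^2}$, where $|D|^k$ is the Fourier multiplier with symbol $|\xi|^k$. The operators $\frac{1}{|D|}\mathrm{e}^{\frac{\delta}{2}\Delta t}\partial_t^\ell\sin(|D|t)$ and $\mathrm{e}^{\frac{\delta}{2}\Delta t}\partial_t^\ell\cos(|D|t)$ are the Fourier multipliers with symbols $|\xi|^{-1}\mathrm{e}^{-\frac{\delta}{2}|\xi|^2t}\partial_t^\ell(\sin(|\xi|t))$ and $\mathrm{e}^{-\frac{\delta}{2}|\xi|^2t}\partial_t^\ell(\cos(|\xi|t))$ (the derivative acts only on the trigonometric function). With $$\widehat{\mathcal{J}}_0(t,|\xi|):=\frac{\sin(|\xi|t)}{|\xi|}\mathrm{e}^{-\frac{\delta}{2}|\xi|^2t},\qquad \widehat{\mathcal{J}}_1(t,|\xi|):=\cos(|\xi|t)\,\mathrm{e}^{-\frac{\delta}{2}|\xi|^2t},$$ $\mathcal{N}_\ell(t,|D|)$ is the Fourier multiplier with symbol $\widehat{\mathcal{N}}_\ell(t,|\xi|)$, where $$\widehat{\mathcal{N}}_0:=\frac{\delta(4\tau-\delta)}{8}\,t\,|\xi|^2\,\widehat{\mathcal{J}}_1,\quad \widehat{\mathcal{N}}_1:=-\delta\Big(\frac{4\tau-\delta}{8}|\xi|^2t+\frac12\Big)|\xi|^2\,\widehat{\mathcal{J}}_0,\quad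 \widehat{\mathcal{N}}_2:=-\delta\Big(\frac{4\tau-\delta}{8}|\xi|^2t+1\Big)|\xi|^2\,\widehat{\mathcal{J}}_1.$$ ''$f\lesssim g$ for $t\gg1$'' means there are constants $C>0$, $T\geqslant 1$, independent of $t$ and of the data (they may depend on $n,\tau,\delta,s,k,\ell$), such that $f\leqslant Cg$ for all $t\geqslant T$. *)

(* Defs.v *)
From HB Require Import structures.
From mathcomp Require Import all_boot all_order all_algebra.
From mathcomp Require Import complex.
From mathcomp Require Import all_classical all_reals all_analysis.

Set Implicit Arguments.
Unset Strict Implicit.
Unset Printing Implicit Defensive.

Import Order.TTheory GRing.Theory Num.Theory.
Import numFieldNormedType.Exports.

Local Open Scope classical_set_scope.
Local Open Scope ring_scope.
Local Open Scope complex_scope.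

Notation Rn R n := (n.-tuple (measurableTypeR R)).

Section lebesgue_measure_n.
Variable R : realType.

Definition Rn_cons n (xy : measurableTypeR R * Rn R n) : Rn R n.+1 :=
  [tuple of xy.1 :: xy.2].

Lemma measurable_Rn_cons n : measurable_fun [set: _] (@Rn_cons n).
Proof. exact: measurable_cons. Qed.

Section step.
Variables (n : nat) (mu : {sigma_finite_measure set (Rn R n) -> \bar R}).

Definition lebesgue_step : set (Rn R n.+1) -> \bar R :=
  pushforward (lebesgue_measure \x mu)%E (@Rn_cons n).

Let ls0 : lebesgue_step set0 = 0%E.
Proof. by rewrite /lebesgue_step /pushforward preimage_set0 measure0. Qed.

Let ls_ge0 A : (0 <= lebesgue_step A)%E.
Proof. by rewrite /lebesgue_step /pushforward measure_ge0. Qed.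

Let ls_additive : semi_sigma_additive lebesgue_step.
Proof.
move=> F mF tF mUF; rewrite /lebesgue_step /pushforward preimage_bigcup.
apply: measure_semi_sigma_additive.
- by move=> m; rewrite -[X in measurable X]setTI; exact: measurable_Rn_cons.
- apply/trivIsetP => /= i j _ _ ij; rewrite -preimage_setI.
  by move/trivIsetP : tF => /(_ _ _ _ _ ij) ->//; rewrite preimage_set0.
- by rewrite -preimage_bigcup -[X in measurable X]setTI;
    exact: measurable_Rn_cons.
Qed.

HB.instance Definition _ :=
  isMeasure.Build _ _ _ lebesgue_step ls0 ls_ge0 ls_additive.

Let ls_sigma_finite : sigma_finite setT lebesgue_step.
Proof.
have /sigma_finiteP[F [FT ndF Foo]] := @sigma_finiteT _ _ _ (@lebesgue_measure R).
have /sigma_finiteP[G [GT ndG Goo]] := sigma_finiteT mu.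
pose uncons (x : Rn R n.+1) : measurableTypeR R * Rn R n :=
  (tnth x ord0, [tuple of behead x]).
have consK : cancel (@Rn_cons n) uncons.
  move=> [x y]; rewrite /uncons /Rn_cons/=; congr pair.
  exact: val_inj.
have muncons : measurable_fun [set: Rn R n.+1] uncons.
  apply: measurable_fun_pair; first exact: measurable_tnth.
  exact: measurable_behead.
exists (fun k => uncons @^-1` (F k `*` G k)) => [|k].
  rewrite -preimage_bigcup (_ : \bigcup_k _ = setT) ?preimage_setT//.
  rewrite -subTset => -[x y] _.
  have [i _ Fx] : (\bigcup_k F k) x by rewrite -FT.
  have [j _ Gy] : (\bigcup_k G k) y by rewrite -GT.
  exists (maxn i j) => //; split.
  - by move: x Fx; exact/subsetPset/ndF/leq_maxl.
  - by move: y Gy; exact/subsetPset/ndG/leq_maxr.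
have [mF Fk] := Foo k; have [mG Gk] := Goo k; split.
  rewrite -[X in measurable X]setTI; apply: muncons => //.
  exact: measurableX.
rewrite /lebesgue_step /pushforward -comp_preimage.
rewrite (_ : uncons \o _ = id) ?preimage_id; last first.
  by apply/funext => x /=; rewrite consK.
by rewrite product_measure1E// lte_mul_pinfty// ge0_fin_numE.
Qed.

HB.instance Definition _ :=
  Measure_isSigmaFinite.Build _ _ _ lebesgue_step ls_sigma_finite.

End step.

(* Lebesgue measure on the Borel sets of R^n, as an n-fold product. *)
Fixpoint leb (n : nat) : {sigma_finite_measure set (Rn R n) -> \bar R} :=
  match n with
  | 0 => [the {sigma_finite_measure set (Rn R 0) -> \bar R} of
            dirac ([tuple] : Rn R 0)]
  | n'.+1 => [the {sigma_finite_measure set (Rn R n'.+1) -> \bar R} of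
            lebesgue_step (leb n')]
  end.

End lebesgue_measure_n.

Section fourier.
Variables (R : realType) (n : nat).
Implicit Types (f g : Rn R n -> R[i]) (x xi : Rn R n).

Local Notation mu := (leb R n).

Definition dotp x xi : R := \sum_(i < n) (tnth x i : R) * (tnth xi i : R).

Definition enorm x : R := Num.sqrt (dotp x x).

Definition cmeasurable f : Prop :=
  measurable_fun [set: Rn R n] (fun x => complex.Re (f x)) /\
  measurable_fun [set: Rn R n] (fun x => complex.Im (f x)).

Definition cLnorm (p : R) f : \bar R :=
  Lnorm mu p%:E (fun x => (Normc.normc (f x))%:E).

Definition inL (p : R) f : Prop := cmeasurable f /\ (cLnorm p f < +oo)%E.

Definition cintegral f : R[i] :=
  Rintegral mu setT (fun x => complex.Re (f x))
  +i* Rintegral mu setT (fun x => complex.Im (f x)).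

(* Unitary normalization, so that the transform is an isometry of L^2. *)
Definition fourier_integral f xi : R[i] :=
  ((2 * pi) `^ (- (n%:R / 2)))%:C *
  cintegral (fun x => f x * (cos (dotp x xi) -i* sin (dotp x xi))).

Definition truncation (m : nat) f x : R[i] :=
  if enorm x <= m%:R then f x else 0.

(* L^2 Fourier transform as a limit in mean of the integrals over balls; for
   f in L^1 it agrees a.e. with [fourier_integral f]. *)
Definition is_fourier f g : Prop :=
  [/\ inL 2 f, inL 2 g &
      cLnorm 2 (fun xi => fourier_integral (truncation m f) xi - g xi)
        @[m --> \oo] --> 0%E].

(* By Plancherel's theorem the set below is a single a.e. class when f is in
   L^2; the default value 0 is only reached outside L^2. *)
Definition fourier f : Rn R n -> R[i] :=
  xget (fun=> 0) [set g | is_fourier f g].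

Definition japanese xi : R := Num.sqrt (1 + enorm xi ^+ 2).

(* H^r norm of the (possibly not function-valued, if r < 0) distribution whose
   Fourier transform is g. *)
Definition Hhatnorm (r : R) g : \bar R :=
  cLnorm 2 (fun xi => (japanese xi `^ r)%:C * g xi).

Definition Hnorm (r : R) f : \bar R := Hhatnorm r (fourier f).

(* For r >= 0 only. *)
Definition inH (r : R) f : Prop :=
  is_fourier f (fourier f) /\ (Hnorm r f < +oo)%E.

(* The L^2 norm of |D|^k f, by the isometry property. *)
Definition Hdotnorm (k : R) f : \bar R :=
  cLnorm 2 (fun xi => (enorm xi `^ k)%:C * fourier f xi).

(* g = m(|D|) f *)
Definition is_multiplier (m : R -> R) f g : Prop :=
  is_fourier g (fun xi => (m (enorm xi))%:C * fourier f xi).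

Definition inA (s : R) f0 f1 f2 : Prop :=
  [/\ inH (s + 2) f0 /\ inL 1 f0,
      inH (s + 1) f1 /\ inL 1 f1 &
      inH s f2 /\ inL 1 f2].

Definition Anorm (s : R) f0 f1 f2 : \bar R :=
  ((Hnorm (s + 2) f0 + cLnorm 1 f0) +
   (Hnorm (s + 1) f1 + cLnorm 1 f1) +
   (Hnorm s f2 + cLnorm 1 f2))%E.

End fourier.

Section MGT.
Variables (R : realType) (n : nat) (tau delta : R).

(* Strong solutions in
     C([0,oo), H^(s+2)) n C^1([0,oo), H^(s+1)) n C^2([0,oo), H^s);
   [psi l t] is the l-th time derivative of the solution at time t.
   Since psi_tt is only H^s-valued, psi_ttt and the equation live in H^(s-1);
   [MGT_equation] says that tau psi_tt is differentiable there with derivative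
   - psi_tt + Delta psi + (delta + tau) Delta psi_t, where Delta is the Fourier
   multiplier with symbol - |xi|^2. One-sided derivatives at t = 0. *)
Record MGT_solution (s : R) (psi0 psi1 psi2 : Rn R n -> R[i])
    (psi : nat -> R -> Rn R n -> R[i]) : Prop := {
  MGT_inH : forall (l : nat) (t : R), (l <= 2)%N -> 0 <= t ->
    inH (s + 2 - l%:R) (psi l t) ;
  MGT_continuous : forall (l : nat) (t : R), (l <= 2)%N -> 0 <= t ->
    Hnorm (s + 2 - l%:R) (fun x => psi l (t + h) x - psi l t x)
      @[h --> within [set h | 0 <= t + h] (nbhs (0 : R))] --> 0%E ;
  MGT_derive : forall (l : nat) (t : R), (l < 2)%N -> 0 <= t ->
    Hnorm (s + 2 - l.+1%:R)
      (fun x => (h^-1)%:C * (psi l (t + h) x - psi l t x) - psi l.+1 t x)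
      @[h --> within [set h | 0 <= t + h] (0 : R)^'] --> 0%E ;
  MGT_equation : forall t : R, 0 < t ->
    Hhatnorm (s - 1)
      (fun xi =>
         tau%:C * ((h^-1)%:C *
           (fourier (psi 2%N (t + h)) xi - fourier (psi 2%N t) xi))
         + fourier (psi 2%N t) xi
         + (enorm xi ^+ 2)%:C * fourier (psi 0%N t) xi
         + ((delta + tau) * enorm xi ^+ 2)%:C * fourier (psi 1%N t) xi)
      @[h --> (0 : R)^'] --> 0%E ;
  MGT_init : [/\ {ae leb R n, forall x, psi 0%N 0 x = psi0 x},
                 {ae leb R n, forall x, psi 1%N 0 x = psi1 x} &
                 {ae leb R n, forall x, psi 2%N 0 x = psi2 x}] }.

(* Symbols, as functions of r = |xi|; their value at r = 0 (where 0^-1 = 0)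
   is irrelevant, {0} being negligible for n >= 1. *)
Definition J0hat (t r : R) : R :=
  sin (r * t) / r * expR (- (delta / 2) * r ^+ 2 * t).

Definition J1hat (t r : R) : R :=
  cos (r * t) * expR (- (delta / 2) * r ^+ 2 * t).

Definition Nhat (l : nat) (t r : R) : R :=
  match l with
  | 0 => delta * (4 * tau - delta) / 8 * t * r ^+ 2 * J1hat t r
  | 1 => - delta * ((4 * tau - delta) / 8 * r ^+ 2 * t + 1 / 2) * r ^+ 2
         * J0hat t r
  | _ => - delta * ((4 * tau - delta) / 8 * r ^+ 2 * t + 1) * r ^+ 2
         * J1hat t r
  end.

Definition sin_symbol (l : nat) (t r : R) : R :=
  r^-1 * expR (- (delta / 2) * r ^+ 2 * t)
  * derive1n l (fun u : R => sin (r * u)) t.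

Definition cos_symbol (l : nat) (t r : R) : R :=
  expR (- (delta / 2) * r ^+ 2 * t) * derive1n l (fun u : R => cos (r * u)) t.

End MGT.

(* Main.v *)
(* In Fourier space the equation is, for each r = |xi|, the ODE
     tau w''' + w'' + (delta + tau) r^2 w' + r^2 w = 0.
   A Lyapunov functional in y = w + tau w' shows that its solutions decay like
   exp (- c min (r^2, 1) t). For r <= 1, the profile corrected by a fast mode in
   exp (- t / tau) solves the ODE and the initial conditions up to higher powers
   of r, so the energy estimate bounds the difference by
   r^(l+1) exp (- c r^2 t) + exp (- c t). For r >= 1, the solution and the profile
   are both exponentially small, at the cost of the Sobolev weights of the data.
   The solution operator S of the ODE represents the strong solution: on a ball
   of frequencies, S(t - sg) applied to the Fourier transforms at time sg has zero
   derivative in sg with respect to the L^2 norm. Finally the Fourier transforms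
   of the data are bounded by their L^1 norms on r <= 1, where the L^2 norm of
   r^(k+l+1) exp (- c r^2 t) is of order t^(- n/4 - (k+l+1)/2). *)
Require Import Defs.
From HB Require Import structures.
From mathcomp Require Import all_boot all_order all_algebra.
From mathcomp Require Import complex ring lra.
From mathcomp Require Import all_classical all_reals all_analysis measurable_realfun.
Import Order.TTheory GRing.Theory Num.Theory.
Import numFieldNormedType.Exports.
Local Open Scope classical_set_scope.
Local Open Scope ring_scope.
Local Open Scope complex_scope.

Set Implicit Arguments.
Unset Strict Implicit.
Unset Printing Implicit Defensive.

(** * Differential inequalities *)

(** The roots of tau x^3 + x^2 + (delta + tau) r^2 x + r^2 may collide at intermediate r, so no
    estimate relies on them: energy inequalities and relaxation along a f' + f give constants
    uniform in r. The roots do explain the profile. Near r = 0 two of them are +- i r - delta r^2 /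
    2 +- i c r^3 up to higher order, with c = delta (4 tau - delta) / 8; expanding the phase c r^3 t
    to first order yields the terms of [Nhat] that are linear in t. At r = 0 the equation has the
    solution (w0 - tau^2 w2) + (w1 + tau w2) t + tau^2 w2 exp (- t / tau), where wi is the i-th
    initial value: this is the origin of the two combinations of data in the theorem. A strong
    solution is differentiable in time only with values in Sobolev spaces, at top order in H^(s-1),
    so no ODE is available at a fixed frequency. Hence the detour through L^2 norms on balls, where
    S is bounded and negative Sobolev weights are harmless. *)

Ltac le_of_eq := rewrite le_eqVlt; apply/orP; left; apply/eqP.

Section derivative_calculus.
Variable R : realType.
Implicit Types f g : R -> R.

Definition derivf f f' := forall t : R, is_derive t (1 : R) f (f' t).

Lemma derivf_ext f f' g : derivf f f' -> f' =1 g -> derivf f g.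
Proof. by move=> ff' e t; rewrite -e; exact: ff'. Qed.

Lemma derivf_cst (c : R) : derivf (fun=> c) (fun=> 0).
Proof. by move=> t; exact: is_derive_cst. Qed.

Lemma derivf_id : derivf (fun t => t) (fun=> 1).
Proof. by move=> t; exact: is_derive_id. Qed.

Lemma derivfD f f' g g' : derivf f f' -> derivf g g' ->
  derivf (fun t => f t + g t) (fun t => f' t + g' t).
Proof. by move=> ff' gg' t; exact: (is_deriveD (ff' t) (gg' t)). Qed.

Lemma derivfN f f' : derivf f f' -> derivf (fun t => - f t) (fun t => - f' t).
Proof. by move=> ff' t; exact: (is_deriveN (ff' t)). Qed.

Lemma derivfM f f' g g' : derivf f f' -> derivf g g' ->
  derivf (fun t => f t * g t) (fun t => f' t * g t + f t * g' t).
Proof.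
move=> ff' gg' t; apply: is_derive_eq (is_deriveM (ff' t) (gg' t)) _.
by rewrite /GRing.scale /=; ring.
Qed.

Lemma derivf_sqr f f' : derivf f f' ->
  derivf (fun t => f t ^+ 2) (fun t => 2 * f t * f' t).
Proof.
move=> ff'; apply: (@derivf_ext _ (fun t => f' t * f t + f t * f' t)).
  exact: derivfM.
by move=> t; ring.
Qed.

Lemma derivf_comp f f' g g' : derivf f f' -> derivf g g' ->
  derivf (fun t => f (g t)) (fun t => f' (g t) * g' t).
Proof. by move=> ff' gg' t; exact: (is_derive1_comp (ff' (g t)) (gg' t)). Qed.

Lemma derivf_exp f f' : derivf f f' ->
  derivf (fun t => expR (f t)) (fun t => expR (f t) * f' t).
Proof. by move=> h; apply: derivf_comp h => t; exact: is_derive_expR. Qed.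

Lemma derivf_sin f f' : derivf f f' ->
  derivf (fun t => sin (f t)) (fun t => cos (f t) * f' t).
Proof. by move=> h; apply: derivf_comp h => t; exact: is_derive_sin. Qed.

Lemma derivf_cos f f' : derivf f f' ->
  derivf (fun t => cos (f t)) (fun t => - sin (f t) * f' t).
Proof. move=> h; apply: (@derivf_comp cos (fun x => - sin x)) h => t.
exact: is_derive_cos. Qed.

Lemma derivf_derivable f f' t : derivf f f' -> derivable f t 1.
Proof. by move=> h; case: (h t). Qed.

Lemma derivf_continuous f f' : derivf f f' -> continuous f.
Proof.
move=> h t; apply/differentiable_continuous/derivable1_diffP.
exact: derivf_derivable h.
Qed.

Lemma derivf_le f f' g g' : derivf f f' -> derivf g g' -> f 0 <= g 0 ->
  (forall t, 0 <= t -> f' t <= g' t) -> forall t, 0 <= t -> f t <= g t.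
Proof.
move=> ff' gg' fg0 fg' t t0.
have hh : derivf (fun u => f u + - g u) (fun u => f' u + - g' u).
  exact: (derivfD ff' (derivfN gg')).
have := @ler0_derive1_nincr R _ 0 t _ _ _ 0 t (lexx _) t0 (lexx _).
move=> /(_ (fun u => f u + - g u)) H.
suff : f t + - g t <= f 0 + - g 0 by move: fg0; lra.
apply: H => [x _|x|].
- exact: derivf_derivable hh.
- rewrite in_itv/= => /andP[x0 _]; rewrite derive1E (@derive_val _ _ _ _ _ _ _ (hh x)).
  by rewrite subr_le0 fg'// ltW.
- by apply: continuous_subspaceT; exact: derivf_continuous hh.
Qed.

End derivative_calculus.

Ltac derivf_auto :=
  match goal with |- derivf _ _ => idtac end;
  eapply derivf_ext;
  [ repeat first [ eassumption | eapply derivf_cst | eapply derivf_id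
      | eapply derivfD | eapply derivfN | eapply derivf_sqr | eapply derivfM
      | eapply derivf_exp | eapply derivf_sin | eapply derivf_cos ]
  | move=> ? /= ].

Section comparison.
Variable R : realType.
Implicit Types f g : R -> R.

(** Integrating factor exp (t / a). As a b1 and a b2 are at most 1/2, the function 2 exp ((1/a - b)
    t) grows faster than exp ((1/a - b) t) / a for b = b1, b2, whence the factors 2. Two forcing
    rates are kept because low-frequency errors mix a diffusive rate proportional to r^2 with the
    fast rate of the mode in exp (- t / tau). *)
Lemma relaxation_le (a b1 b2 G1 G2 : R) f f' : 0 < a ->
  2 * (a * b1) <= 1 -> 2 * (a * b2) <= 1 -> 0 <= G1 -> 0 <= G2 -> derivf f f' ->
  (forall t, 0 <= t ->
     a * f' t + f t <= G1 * expR (- b1 * t) + G2 * expR (- b2 * t)) ->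
  forall t, 0 <= t -> f t <= f 0 * expR (- a^-1 * t)
    + 2 * G1 * expR (- b1 * t) + 2 * G2 * expR (- b2 * t).
Proof.
move=> a0 ab1 ab2 G10 G20 ff' H t t0.
have ha : a * a^-1 = 1 by rewrite divff// gt_eqF.
have i0 : 0 < a^-1 by rewrite invr_gt0.
have d1 : derivf (fun u => f u * expR (a^-1 * u))
    (fun u => (f' u + a^-1 * f u) * expR (a^-1 * u)).
  by derivf_auto; ring.
have d2 : derivf (fun u => f 0 + 2 * G1 * expR ((a^-1 - b1) * u)
      + 2 * G2 * expR ((a^-1 - b2) * u))
    (fun u => 2 * G1 * (a^-1 - b1) * expR ((a^-1 - b1) * u)
      + 2 * G2 * (a^-1 - b2) * expR ((a^-1 - b2) * u)).
  by derivf_auto; ring.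
have eE b u : expR ((a^-1 - b) * u) = expR (a^-1 * u) * expR (- b * u).
  by rewrite -expRD; congr expR; ring.
have aB b : 2 * (a * b) <= 1 -> a^-1 <= 2 * (a^-1 - b).
  move=> ab; have : a^-1 * (2 * (a * b)) <= a^-1 * 1 by rewrite ler_pM2l.
  have -> : a^-1 * (2 * (a * b)) = 2 * b * (a * a^-1) by ring.
  by rewrite ha; lra.
have : f t * expR (a^-1 * t) <= f 0 + 2 * G1 * expR ((a^-1 - b1) * t)
      + 2 * G2 * expR ((a^-1 - b2) * t).
  apply: (derivf_le d1 d2) => // [|u u0].
    rewrite !mulr0 expR0; lra.
  rewrite !eE.
  have -> : (f' u + a^-1 * f u) = a^-1 * (a * f' u + f u).
    by rewrite mulrDr mulrA mulVf ?mul1r// gt_eqF.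
  apply: (@le_trans _ _ (a^-1 * (G1 * expR (- b1 * u) + G2 * expR (- b2 * u))
     * expR (a^-1 * u))).
    by rewrite ler_pM2r ?expR_gt0// ler_pM2l// H.
  rewrite -subr_ge0.
  have -> : 2 * G1 * (a^-1 - b1) * (expR (a^-1 * u) * expR (- b1 * u)) +
    2 * G2 * (a^-1 - b2) * (expR (a^-1 * u) * expR (- b2 * u)) -
    a^-1 * (G1 * expR (- b1 * u) + G2 * expR (- b2 * u)) * expR (a^-1 * u) =
    expR (a^-1 * u) * (G1 * expR (- b1 * u) * (2 * (a^-1 - b1) - a^-1)
     + G2 * expR (- b2 * u) * (2 * (a^-1 - b2) - a^-1)) by ring.
  have := aB _ ab1; rewrite -subr_ge0 => h1.
  have := aB _ ab2; rewrite -subr_ge0 => h2.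
  apply: mulr_ge0; first exact: expR_ge0.
  by apply: addr_ge0; apply: mulr_ge0 => //; apply: mulr_ge0 => //; exact: expR_ge0.
rewrite !eE => K.
have e : expR (a^-1 * t) * expR (- a^-1 * t) = 1.
  by rewrite -expRD mulNr subrr expR0.
rewrite -(ler_pM2r (expR_gt0 (a^-1 * t))); apply: le_trans K _.
have -> : (f 0 * expR (- a^-1 * t) + 2 * G1 * expR (- b1 * t) +
    2 * G2 * expR (- b2 * t)) * expR (a^-1 * t) =
  f 0 * (expR (a^-1 * t) * expR (- a^-1 * t)) + (2 * G1 * expR (- b1 * t) +
    2 * G2 * expR (- b2 * t)) * expR (a^-1 * t) by ring.
rewrite e; le_of_eq; ring.
Qed.

Lemma relaxation (a b1 b2 G1 G2 : R) f f' : 0 < a ->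
  2 * (a * b1) <= 1 -> 2 * (a * b2) <= 1 -> 0 <= G1 -> 0 <= G2 -> derivf f f' ->
  (forall t, 0 <= t ->
     `|a * f' t + f t| <= G1 * expR (- b1 * t) + G2 * expR (- b2 * t)) ->
  forall t, 0 <= t -> `|f t| <= `|f 0| * expR (- a^-1 * t)
    + 2 * G1 * expR (- b1 * t) + 2 * G2 * expR (- b2 * t).
Proof.
move=> a0 ab1 ab2 G10 G20 ff' H t t0; rewrite ler_norml; apply/andP; split.
  rewrite lerNl.
  apply: le_trans (relaxation_le a0 ab1 ab2 G10 G20 (derivfN ff') _ t0) _.
    move=> u u0; rewrite mulrN -opprD; apply: le_trans (H u u0).
    by rewrite -normrN ler_norm.
  by rewrite !lerD2r ler_pM2r ?expR_gt0// -normrN ler_norm.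
apply: le_trans (relaxation_le a0 ab1 ab2 G10 G20 ff' _ t0) _.
  by move=> u u0; apply: le_trans (H u u0); rewrite ler_norm.
by rewrite !lerD2r ler_pM2r ?expR_gt0// ler_norm.
Qed.

(** Formally the derivative of sqrt X is X' / (2 sqrt X) <= g. As the square root is not
    differentiable at 0, the argument runs on X + e^2 with e > 0 arbitrary. A primitive [G] of [g]
    is supplied by the caller, so that the energy method involves no integral. *)
Lemma sqrt_gronwall X X' G g : derivf X X' -> derivf G g ->
  (forall t, 0 <= X t) -> (forall t, 0 <= t -> 0 <= g t) ->
  (forall t, 0 <= t -> X' t <= 2 * Num.sqrt (X t) * g t) ->
  forall t, 0 <= t -> Num.sqrt (X t) <= Num.sqrt (X 0) + (G t - G 0).
Proof.
move=> dX dG X0 g0 H t t0; apply/ler_addgt0Pr => e e0.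
have e2 : 0 < e ^+ 2 by rewrite exprn_gt0.
have Xe u : 0 < X u + e ^+ 2 by rewrite ltr_wpDl.
have dS : derivf (fun u => (X u + e ^+ 2) `^ 2^-1)
    (fun u => 2^-1 * (X u + e ^+ 2) `^ (2^-1 - 1) * X' u).
  have dXe : derivf (fun u => X u + e ^+ 2) X' by derivf_auto; ring.
  move=> u; exact: (@is_derive1_comp R (fun x => x `^ 2^-1)
    (fun v => X v + e ^+ 2) u _ _ (is_derive1_powR 2^-1 (Xe u)) (dXe u)).
have dR : derivf (fun u => Num.sqrt (X 0 + e ^+ 2) + (G u - G 0)) g.
  by derivf_auto; ring.
have : (X t + e ^+ 2) `^ 2^-1 <= Num.sqrt (X 0 + e ^+ 2) + (G t - G 0).
  apply: (derivf_le dS dR) => // [|u u0].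
    by rewrite powR12_sqrt ?(ltW (Xe _))// subrr addr0.
  rewrite powRB; last first.
    by apply/implyP => _; rewrite gt_eqF.
  rewrite powR12_sqrt ?(ltW (Xe _))// powRr1 ?(ltW (Xe _))//.
  have s0 : 0 < Num.sqrt (X u + e ^+ 2) by rewrite sqrtr_gt0.
  have := sqr_sqrtr (ltW (Xe u)).
  set s := Num.sqrt _ in s0 * => <-.
  have -> : 2^-1 * (s / s ^+ 2) * X' u = X' u / (2 * s).
    by field; rewrite gt_eqF.
  rewrite ler_pdivrMr ?mulr_gt0//; apply: le_trans (H u u0) _.
  rewrite [leRHS]mulrC ler_wpM2r ?g0// ler_pM2l//.
  by rewrite /s ler_wsqrtr// lerDl ltW.
rewrite powR12_sqrt ?(ltW (Xe _))// => K.
apply: (@le_trans _ _ (Num.sqrt (X t + e ^+ 2))).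
  by rewrite ler_wsqrtr// lerDl ltW.
apply: le_trans K _; rewrite addrAC lerD2r.
have p0 := sqrtr_ge0 (X 0).
rewrite -(@ler_pXn2r _ 2)// ?nnegrE ?sqrtr_ge0 ?addr_ge0// ?(ltW e0)//.
rewrite sqr_sqrtr ?(ltW (Xe 0))// sqrrD sqr_sqrtr// lerD2r lerDl.
by rewrite mulrn_wge0// mulr_ge0// ltW.
Qed.

End comparison.

(** * Energy estimates for the Fourier-side equation *)

Ltac nneg := repeat match goal with
  | H : is_true ?P |- is_true ?P => exact: H
  | H : is_true (0 < ?x) |- is_true (0 <= ?x) => exact: (ltW H)
  | |- is_true (0 <= _ ^+ 2) => exact: sqr_ge0
  | |- is_true (0 <= `|_|) => exact: normr_ge0
  | |- is_true (0 <= expR _) => exact: expR_ge0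
  | |- is_true (0 <= Num.sqrt _) => exact: sqrtr_ge0
  | |- is_true (0 <= _ + _) => apply: addr_ge0
  | |- is_true (0 <= _ * _) => apply: mulr_ge0
  | |- is_true (0 <= _ ^+ _) => apply: exprn_ge0
  | |- is_true (0 <= _ ^-1) => rewrite invr_ge0
  | |- is_true (0 <= _) => first [by [] | by apply: ltW]
  end.

Ltac posi := repeat match goal with
  | H : is_true ?P |- is_true ?P => exact: H
  | |- is_true (0 < expR _) => exact: expR_gt0
  | |- is_true (0 < _ + _) => apply: addr_gt0
  | |- is_true (0 < _ * _) => apply: mulr_gt0
  | |- is_true (0 < _ ^-1) => rewrite invr_gt0
  | |- is_true (0 < _ ^+ _) => apply: exprn_gt0
  | |- is_true (0 < _) => by []
  end.

Section energy.
Variable R : realType.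

(** With v = w', y = w + tau w' and z = y', one has v' = (z - v) / tau and z' = - q y - delta q v +
    F, and the left side is the time derivative of the functional [L] of [lyapunov_equiv]. The main
    part of [L] dissipates only v^2; the corrector - eps v z adds dissipation of z^2, and eps y z /
    (4 tau) that of q y^2. The weight [rho] will be 1 at high and q at low frequency. *)
Lemma lyapunov_dissipation (tau delta eps rho q y z v F : R) :
  0 < tau -> 0 < delta -> 0 < eps -> 0 < rho -> rho <= 1 -> rho <= q ->
  eps * (tau^-1 / 2 + 4 * tau + delta + tau^-1 * delta ^+ 2 / 4) <= delta / 2 ->
  - delta * q * v ^+ 2 + F * z
    + rho * (- eps * ((z - v) / tau * z + v * (- q * y - delta * q * v + F))
      + eps / (4 * tau) * (z ^+ 2 + y * (- q * y - delta * q * v + F))) <=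
  - (rho * (eps / (8 * tau) * (z ^+ 2 + q * y ^+ 2)) + delta / 2 * (q * v ^+ 2))
    + F * (z + rho * (- eps * v + eps / (4 * tau) * y)).
Proof.
move=> t0 d0 e0 r0 r1 rq H.
have tn0 : tau != 0 by rewrite gt_eqF.
have i0 : 0 < tau^-1 by rewrite invr_gt0.
have q0 : 0 < q by apply: lt_le_trans rq.
rewrite -subr_ge0.
(* The first three squares absorb the cross term z v, the term y v of the first corrector and the
   term y v of the second. Their cost in v^2, together with the term delta q v^2 of the first
   corrector, is what the condition on [eps] keeps below half of the dissipation. *)
suff -> : - (rho * (eps / (8 * tau) * (z ^+ 2 + q * y ^+ 2)) + delta / 2 * (q * v ^+ 2))
    + F * (z + rho * (- eps * v + eps / (4 * tau) * y)) -
  (- delta * q * v ^+ 2 + F * z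
    + rho * (- eps * ((z - v) / tau * z + v * (- q * y - delta * q * v + F))
      + eps / (4 * tau) * (z ^+ 2 + y * (- q * y - delta * q * v + F)))) =
  (rho * eps * tau^-1 / 2) * (z - v) ^+ 2
  + (rho * eps * q * tau^-1 / 16) * (y - 8 * tau * v) ^+ 2
  + (rho * eps * tau^-1 / 4 * q) * (y / 2 + delta * v) ^+ 2
  + (rho * eps * tau^-1 / 8) * z ^+ 2
  + v ^+ 2 * (delta / 2 * q - eps * (rho * (tau^-1 / 2)
     + rho * q * (4 * tau + delta + tau^-1 * delta ^+ 2 / 4))).
  apply: addr_ge0; first by nneg.
  apply: mulr_ge0; first exact: sqr_ge0.
  rewrite subr_ge0; apply: (@le_trans _ _ (eps * (tau^-1 / 2 + 4 * tau + delta + tau^-1 * delta ^+ 2 / 4) * q)).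
    set P := tau^-1 / 2; set Q := 4 * tau + delta + tau^-1 * delta ^+ 2 / 4.
    have P0 : 0 <= P by rewrite divr_ge0// ltW.
    have Q0 : 0 <= Q by rewrite /Q; nneg.
    have -> : eps * (P + 4 * tau + delta + tau^-1 * delta ^+ 2 / 4) * q =
      eps * (q * P + q * Q) by rewrite /Q; ring.
    rewrite ler_pM2l//; apply: lerD; first by rewrite ler_wpM2r.
    by rewrite -mulrA ler_piMl// mulr_ge0// ltW.
  by rewrite ler_pM2r.
by field.
Qed.

Lemma mul_le_sqr (x y : R) : `|x * y| <= (x ^+ 2 + y ^+ 2) / 2.
Proof.
by rewrite ler_norml; apply/andP; split;
  [have := sqr_ge0 (x + y) | have := sqr_ge0 (x - y)]; nra.
Qed.

(** The correctors are at most half of the main part: in rho v z the factor [rho] is at most 1,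
    which serves z^2, and at most q, which serves v^2; likewise for y z. The three bounds on [eps]
    then pay for z^2, q y^2 and q v^2. *)
Lemma lyapunov_equiv (tau delta eps rho q y z v : R) :
  0 < tau -> 0 < delta -> 0 < eps -> 0 < rho -> rho <= 1 -> rho <= q ->
  eps <= 1 / 4 -> eps <= tau -> eps <= delta * tau / 2 ->
  let L := (z ^+ 2 + q * y ^+ 2 + delta * tau * (q * v ^+ 2)) / 2
    + rho * (- eps * (v * z) + eps / (4 * tau) * (y * z)) in
  let E := z ^+ 2 + q * y ^+ 2 + q * v ^+ 2 in
  Num.min (1 / 4) (delta * tau / 4) * E <= L /\ L <= (1 + delta * tau) * E.
Proof.
move=> t0 d0 e0 r0 r1 rq e4 et ed L E.
have q0 : 0 < q by apply: lt_le_trans rq.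
set m := Num.min _ _.
have m1 : m <= 1 / 4 by rewrite ge_min lexx.
have m2 : m <= delta * tau / 4 by rewrite ge_min lexx orbT.
set e' := eps / (4 * tau).
have e'0 : 0 < e' by rewrite divr_gt0// mulr_gt0.
have e'4 : e' <= 1 / 4.
  by rewrite /e' ler_pdivrMr ?mulr_gt0//; lra.
have z2 := sqr_ge0 z; have y2 := sqr_ge0 y; have v2 := sqr_ge0 v.
have qy : rho * y ^+ 2 <= q * y ^+ 2 by rewrite ler_wpM2r.
have qv : rho * v ^+ 2 <= q * v ^+ 2 by rewrite ler_wpM2r.
have rz : rho * z ^+ 2 <= z ^+ 2 by rewrite ler_piMl.
have vz := mul_le_sqr v z; have yz := mul_le_sqr y z.
have b1 : `|rho * (v * z)| <= (q * v ^+ 2 + z ^+ 2) / 2.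
  rewrite normrM (gtr0_norm r0); apply: le_trans (_ : rho * ((v ^+ 2 + z ^+ 2) / 2) <= _).
    by rewrite ler_wpM2l// ltW.
  by lra.
have b2 : `|rho * (y * z)| <= (q * y ^+ 2 + z ^+ 2) / 2.
  rewrite normrM (gtr0_norm r0); apply: le_trans (_ : rho * ((y ^+ 2 + z ^+ 2) / 2) <= _).
    by rewrite ler_wpM2l// ltW.
  by lra.
have b : `|L - (z ^+ 2 + q * y ^+ 2 + delta * tau * (q * v ^+ 2)) / 2| <=
   eps * ((q * v ^+ 2 + z ^+ 2) / 2) + e' * ((q * y ^+ 2 + z ^+ 2) / 2).
  rewrite /L addrAC subrr add0r.
  have -> : rho * (- eps * (v * z) + e' * (y * z)) =
    - (eps * (rho * (v * z))) + e' * (rho * (y * z)) by ring.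
  rewrite (le_trans (ler_normD _ _))// normrN (normrM eps) (normrM e').
  by rewrite (gtr0_norm e0) (gtr0_norm e'0) lerD// ler_wpM2l// ltW.
set A := q * y ^+ 2 in qy b b2 *; set B := q * v ^+ 2 in qv b b1 *.
have A0 : 0 <= A by rewrite mulr_ge0// ltW.
have B0 : 0 <= B by rewrite mulr_ge0// ltW.
move: b; rewrite ler_norml /E -/A -/B => /andP[l1 l2].
have dt : 0 < delta * tau by rewrite mulr_gt0.
have k1 : m * z ^+ 2 <= 1 / 4 * z ^+ 2 by rewrite ler_wpM2r.
have k2 : m * A <= 1 / 4 * A by rewrite ler_wpM2r.
have k3 : m * B <= delta * tau / 4 * B by rewrite ler_wpM2r.
have k4 : eps * z ^+ 2 <= 1 / 4 * z ^+ 2 by rewrite ler_wpM2r.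
have k5 : e' * z ^+ 2 <= 1 / 4 * z ^+ 2 by rewrite ler_wpM2r.
have k6 : e' * A <= 1 / 4 * A by rewrite ler_wpM2r.
have k7 : eps * B <= delta * tau / 2 * B by rewrite ler_wpM2r.
have k8 : 0 <= delta * tau * z ^+ 2 by rewrite mulr_ge0// ltW.
have k9 : 0 <= delta * tau * A by rewrite mulr_ge0// ltW.
have k10 : 0 <= delta * tau * B by rewrite mulr_ge0// ltW.
by split; clear -l1 l2 k1 k2 k3 k4 k5 k6 k7 k8 k9 k10 z2 A0 B0; lra.
Qed.

Definition energy (tau q w w1 w2 : R) : R :=
  (w1 + tau * w2) ^+ 2 + q * (w + tau * w1) ^+ 2 + q * w1 ^+ 2.

Lemma energy_ge0 tau q w w1 w2 : 0 <= q -> 0 <= energy tau q w w1 w2.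
Proof. by move=> q0; rewrite /energy; nneg. Qed.

(* With y = w + tau w', the equation becomes y'' + q y + delta q w' = F. *)
Lemma energy_decay (tau delta : R) : 0 < tau -> 0 < delta ->
  exists a0 C : R, [/\ 0 < a0, 0 < C &
  forall a q rho w w1 w2 w3 F G g, 0 < a -> a <= a0 -> 0 < rho -> rho <= 1 -> rho <= q ->
  derivf w w1 -> derivf w1 w2 -> derivf w2 w3 ->
  (forall t, tau * w3 t + w2 t + q * w t + (delta + tau) * q * w1 t = F t) ->
  derivf G g ->
  (forall t, 0 <= t -> expR (a * rho * t) * `|F t| <= g t) ->
  forall t, 0 <= t ->
  expR (a * rho * t) * Num.sqrt (energy tau q (w t) (w1 t) (w2 t)) <=
  C * (Num.sqrt (energy tau q (w 0) (w1 0) (w2 0)) + (G t - G 0))].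
Proof.
move=> t0 d0.
pose B := tau^-1 / 2 + 4 * tau + delta + tau^-1 * delta ^+ 2 / 4.
have i0 : 0 < tau^-1 by rewrite invr_gt0.
have B0 : 0 < B by rewrite !addr_gt0 ?divr_gt0 ?mulr_gt0 ?exprn_gt0.
have dt : 0 < delta * tau by rewrite mulr_gt0.
(* The upper bounds on [eps] are those of [lyapunov_equiv] and, for the last one, of
   [lyapunov_dissipation]. *)
have [eps [e0 e4 et ed eB]] : exists eps, [/\ 0 < eps, eps <= 1 / 4, eps <= tau,
    eps <= delta * tau / 2 & eps * B <= delta / 2].
  exists (Num.min (1 / 4) (Num.min tau (Num.min (delta * tau / 2) (delta / 2 / B)))).
  split; last by rewrite -ler_pdivlMr// !ge_min lexx !orbT.
  - by rewrite !lt_min t0 !divr_gt0.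
  - by rewrite ge_min lexx.
  - by rewrite !ge_min lexx !orbT.
  - by rewrite !ge_min lexx !orbT.
pose m := Num.min (1 / 4) (delta * tau / 4).
have m0 : 0 < m by rewrite lt_min !divr_gt0.
pose M := 1 + delta * tau.
have M0 : 0 < M by rewrite addr_gt0.
pose k := Num.min (eps / (8 * tau)) (delta / 2).
have k0 : 0 < k by rewrite lt_min !divr_gt0// mulr_gt0.
(* Without forcing, L' <= - k rho E and L <= M E, so L decays at rate (k / M) rho and its square
   root at half of that rate. *)
pose b := k / M / 2.
have b0 : 0 < b by rewrite !divr_gt0.
pose C1 := 1 + eps + eps / (4 * tau).
have e'0 : 0 < eps / (4 * tau) by rewrite divr_gt0// mulr_gt0.
have C10 : 0 < C1 by rewrite !addr_gt0.
have sm : 0 < Num.sqrt m by rewrite sqrtr_gt0.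
pose C2 := C1 / (2 * Num.sqrt m).
have C20 : 0 < C2 by rewrite divr_gt0// mulr_gt0.
pose C := (Num.sqrt M + C2) / Num.sqrt m.
have C0 : 0 < C by rewrite divr_gt0// addr_gt0// sqrtr_gt0.
exists b, C; split => // a q rho w w1 w2 w3 F G g a0 ab r0 r1 rq dw dw1 dw2 ode dG HF t tge0.
have q0 : 0 < q by apply: lt_le_trans rq.
pose y u := w u + tau * w1 u; pose z u := w1 u + tau * w2 u.
pose L u := ((z u) ^+ 2 + q * (y u) ^+ 2 + delta * tau * (q * (w1 u) ^+ 2)) / 2
    + rho * (- eps * (w1 u * z u) + eps / (4 * tau) * (y u * z u)).
pose E u := energy tau q (w u) (w1 u) (w2 u).
have E0 u : 0 <= E u by apply: energy_ge0; exact: ltW.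
have LE u : m * E u <= L u /\ L u <= M * E u.
  exact: (lyapunov_equiv (y u) (z u) (w1 u) t0 d0 e0 r0 r1 rq e4 et ed).
have L0 u : 0 <= L u.
  by have [h _] := LE u; apply: le_trans h; rewrite mulr_ge0// ltW.
pose z' u := w2 u + tau * w3 u.
have z'E u : z' u = - q * y u - delta * q * w1 u + F u.
  by rewrite -(ode u) /z' /y; ring.
pose L' u := - delta * q * (w1 u) ^+ 2 + F u * z u
    + rho * (- eps * ((z u - w1 u) / tau * z u + w1 u * (- q * y u - delta * q * w1 u + F u))
      + eps / (4 * tau) * ((z u) ^+ 2 + y u * (- q * y u - delta * q * w1 u + F u))).
have dy : derivf y z by rewrite /y /z; derivf_auto; ring.
have dz : derivf z z' by rewrite /z /z'; derivf_auto; ring.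
have tn0 : tau != 0 by rewrite gt_eqF.
have w2E u : w2 u = (z u - w1 u) / tau by rewrite /z; field.
have dL : derivf L L'.
  rewrite /L; derivf_auto; rewrite /L' z'E w2E; field => //.
have L'le u : L' u <= - (k * rho * E u) + C1 * (`|F u| * Num.sqrt (E u)).
  have h := lyapunov_dissipation (y u) (z u) (w1 u) (F u) t0 d0 e0 r0 r1 rq eB.
  apply: le_trans h _; apply: lerD.
    rewrite lerN2; rewrite /E /energy -/(y u) -/(z u).
    have k1 : k <= eps / (8 * tau) by rewrite ge_min lexx.
    have k2 : k <= delta / 2 by rewrite ge_min lexx orbT.
    have p1 : 0 <= z u ^+ 2 + q * y u ^+ 2 by nneg.
    have p2 : 0 <= q * w1 u ^+ 2 by nneg.
    have -> : k * rho * (z u ^+ 2 + q * y u ^+ 2 + q * w1 u ^+ 2) =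
      rho * (k * (z u ^+ 2 + q * y u ^+ 2)) + rho * (k * (q * w1 u ^+ 2)) by ring.
    apply: lerD; first by rewrite ler_pM2l// ler_wpM2r.
    apply: (@le_trans _ _ (k * (q * w1 u ^+ 2))); last by rewrite ler_wpM2r.
    by rewrite ler_piMl// mulr_ge0// ltW.
  apply: (@le_trans _ _ `|F u * (z u + rho * (- eps * w1 u + eps / (4 * tau) * y u))|).
    exact: ler_norm.
  rewrite normrM [leRHS]mulrCA ler_wpM2l//.
  (* Since rho <= 1, one has rho^2 <= rho <= q. *)
  have rr : rho <= Num.sqrt q.
    rewrite -[rho]ger0_norm ?(ltW r0)// -sqrtr_sqr ler_wsqrtr//.
    apply: le_trans rq; rewrite expr2 ler_piMl// ltW//.
  have sE x c : 0 <= c -> c * x ^+ 2 <= E u -> Num.sqrt c * `|x| <= Num.sqrt (E u).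
    by move=> c0 h; rewrite -sqrtr_sqr -sqrtrM// ler_wsqrtr.
  have n2 x : 0 <= q * x ^+ 2 by nneg.
  have sz : `|z u| <= Num.sqrt (E u).
    rewrite -[`|_|]mul1r -[X in X * _]sqrtr1; apply: sE => //; rewrite mul1r.
    by rewrite /E /energy -/(y u) -/(z u) -addrA lerDl addr_ge0.
  have sy : rho * `|y u| <= Num.sqrt (E u).
    apply: (@le_trans _ _ (Num.sqrt q * `|y u|)); first by rewrite ler_wpM2r.
    apply: sE; rewrite ?(ltW q0)// /E /energy -/(y u) -/(z u) addrAC lerDr addr_ge0//.
    by rewrite sqr_ge0.
  have sv : rho * `|w1 u| <= Num.sqrt (E u).
    apply: (@le_trans _ _ (Num.sqrt q * `|w1 u|)); first by rewrite ler_wpM2r.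
    by apply: sE; rewrite ?(ltW q0)// /E /energy lerDr addr_ge0// sqr_ge0.
  have -> : C1 * Num.sqrt (E u) = Num.sqrt (E u) +
    (eps * Num.sqrt (E u) + eps / (4 * tau) * Num.sqrt (E u)) by rewrite /C1; ring.
  apply: le_trans (ler_normD _ _) _; apply: lerD => //.
  rewrite normrM (gtr0_norm r0).
  apply: (@le_trans _ _ (rho * (eps * `|w1 u| + eps / (4 * tau) * `|y u|))).
    rewrite ler_wpM2l ?(ltW r0)//; apply: le_trans (ler_normD _ _) _.
    by rewrite (normrM (- eps)) normrN (normrM (eps / _)) (gtr0_norm e0) (gtr0_norm e'0).
  by rewrite mulrDr; apply: lerD; rewrite mulrCA ler_wpM2l// ltW.
(* The square root of [X] is exp (a rho u) sqrt L, so [sqrt_gronwall] bounds the weighted norm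
   directly. *)
pose X u := expR (2 * a * rho * u) * L u.
pose X' u := expR (2 * a * rho * u) * (2 * a * rho * L u + L' u).
have dX : derivf X X' by rewrite /X; derivf_auto; rewrite /X'; ring.
have sqe u : Num.sqrt (expR (2 * a * rho * u)) = expR (a * rho * u).
  have -> : 2 * a * rho * u = a * rho * u + a * rho * u by ring.
  by rewrite expRD -expr2 sqrtr_sqr ger0_norm ?expR_ge0.
have eM u : expR (2 * a * rho * u) = expR (a * rho * u) ^+ 2.
  by rewrite -sqe sqr_sqrtr// expR_ge0.
have sX u : Num.sqrt (X u) = expR (a * rho * u) * Num.sqrt (L u).
  by rewrite /X sqrtrM ?expR_ge0// sqe.
have dG' : derivf (fun u => C2 * G u) (fun u => C2 * g u).
  by derivf_auto; ring.
have key : forall u, 0 <= u -> X' u <= 2 * Num.sqrt (X u) * (C2 * g u).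
  move=> u u0.
  have aL : 2 * a * rho * L u <= k * rho * E u.
    apply: (@le_trans _ _ (2 * a * rho * (M * E u))).
      by rewrite ler_wpM2l ?(LE u).2// mulr_ge0 ?(ltW r0)// mulr_ge0// ltW.
    apply: (@le_trans _ _ (2 * b * rho * (M * E u))).
      rewrite ler_wpM2r//; first by rewrite mulr_ge0// ltW.
      by rewrite ler_pM2r// ler_pM2l.
    by rewrite /b; le_of_eq; field; rewrite gt_eqF.
  have sEL : Num.sqrt m * Num.sqrt (E u) <= Num.sqrt (L u).
    by rewrite -sqrtrM ?(ltW m0)// ler_wsqrtr// (LE u).1.
  apply: (@le_trans _ _ (expR (2 * a * rho * u) * (C1 * (`|F u| * Num.sqrt (E u))))).
    rewrite /X' ler_wpM2l ?expR_ge0//.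
    by have := L'le u; move: aL; lra.
  rewrite eM sX.
  have -> : 2 * (expR (a * rho * u) * Num.sqrt (L u)) * (C2 * g u) =
     (C1 * expR (a * rho * u)) * ((Num.sqrt (L u) / Num.sqrt m) * g u).
    by rewrite /C2; field; rewrite gt_eqF.
  have -> : expR (a * rho * u) ^+ 2 * (C1 * (`|F u| * Num.sqrt (E u))) =
     (C1 * expR (a * rho * u)) * (Num.sqrt (E u) * (expR (a * rho * u) * `|F u|)) by ring.
  rewrite ler_wpM2l//; first by rewrite mulr_ge0 ?expR_ge0// ltW.
  apply: ler_pM; [by nneg|by nneg| |].
  - by rewrite ler_pdivlMr// mulrC.
  - exact: HF.
have g0 u : 0 <= u -> 0 <= C2 * g u.
  by move=> u0; rewrite mulr_ge0 ?(ltW C20)// (le_trans _ (HF u u0))// mulr_ge0// expR_ge0.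
have X0 u : 0 <= X u by rewrite mulr_ge0// expR_ge0.
have := sqrt_gronwall dX dG' X0 g0 key tge0.
rewrite !sX mulr0 expR0 mul1r -mulrBr => fin.
have sEt : Num.sqrt m * Num.sqrt (E t) <= Num.sqrt (L t).
  by rewrite -sqrtrM ?(ltW m0)// ler_wsqrtr// (LE t).1.
have sE0 : Num.sqrt (L 0) <= Num.sqrt M * Num.sqrt (E 0).
  by rewrite -sqrtrM ?(ltW M0)// ler_wsqrtr// (LE 0).2.
have Gp : 0 <= G t - G 0.
  rewrite subr_ge0.
  apply: (@derivf_le _ (fun=> G 0) (fun=> 0) G g) => //; first exact: derivf_cst.
  by move=> u u0; have := g0 u u0; rewrite pmulr_rge0.
rewrite /C [leRHS]mulrAC ler_pdivlMr// -(mulrA (expR _)) (mulrC _ (Num.sqrt m)).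
apply: (@le_trans _ _ (expR (a * rho * t) * Num.sqrt (L t))).
  by rewrite ler_wpM2l// expR_ge0.
apply: le_trans fin _; rewrite mulrDl; apply: lerD.
  apply: le_trans sE0 _; rewrite ler_wpM2l ?sqrtr_ge0//.
  by rewrite lerDl.
by rewrite ler_wpM2l ?(ltW C20)// lerDr sqrtr_ge0.
Qed.

End energy.

(** * Pointwise consequences of the energy decay *)

Section pointwise_bounds.
Variables (R : realType) (tau delta : R).
Hypotheses (tau0 : 0 < tau) (delta0 : 0 < delta).

Local Notation b := (delta + tau).

Definition mgt_ode (r : R) (W : nat -> R -> R) :=
  (forall i, derivf (W i) (W i.+1)) /\
  forall t, tau * W 3%N t + W 2%N t + r ^+ 2 * W 0%N t
    + b * r ^+ 2 * W 1%N t = 0.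

Lemma le_sqrt_energy (r w w1 w2 : R) : 0 <= r ->
  let s := Num.sqrt (energy tau (r ^+ 2) w w1 w2) in
  [/\ `|w1 + tau * w2| <= s, r * `|w + tau * w1| <= s, r * `|w1| <= s &
      s <= `|w1 + tau * w2| + r * `|w + tau * w1| + r * `|w1|].
Proof.
move=> r0 s.
have n2 (x : R) : 0 <= r ^+ 2 * x ^+ 2 by nneg.
have sE (x : R) : x ^+ 2 <= energy tau (r ^+ 2) w w1 w2 -> `|x| <= s.
  by move=> h; rewrite -sqrtr_sqr /s ler_wsqrtr.
have rE (x : R) : r ^+ 2 * x ^+ 2 <= energy tau (r ^+ 2) w w1 w2 -> r * `|x| <= s.
  by rewrite -exprMn => /sE; rewrite normrM (ger0_norm r0).
split.
- by apply: sE; rewrite /energy -addrA lerDl addr_ge0.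
- by apply: rE; rewrite /energy addrAC lerDr addr_ge0// sqr_ge0.
- by apply: rE; rewrite /energy lerDr addr_ge0// sqr_ge0.
rewrite -[leRHS]ger0_norm; last by nneg.
rewrite -sqrtr_sqr /s ler_wsqrtr// /energy.
rewrite -(real_normK (num_real (w1 + tau * w2))) -(real_normK (num_real (w + tau * w1))).
rewrite -(real_normK (num_real w1)).
have := normr_ge0 (w1 + tau * w2); have := normr_ge0 (w + tau * w1).
have := normr_ge0 w1.
move: `|w1| `|w + _| `|w1 + _| => x y z x0 y0 z0.
rewrite -subr_ge0.
have -> : (z + r * y + r * x) ^+ 2 - (z ^+ 2 + r ^+ 2 * y ^+ 2 + r ^+ 2 * x ^+ 2)
  = 2 * (z * (r * y)) + 2 * (z * (r * x)) + 2 * ((r * y) * (r * x)) by ring.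
by nneg.
Qed.

(** The energy with rho = 1 decays at a rate independent of r, but it carries only one power of r on
    w. The weight r^2 is recovered from the equation itself, read as a relaxation of r^2 w at rate 1
    / (delta + tau). *)
Lemma high_frequency : exists beta C : R, [/\ 0 < beta, 0 < C &
  forall r W, 1 <= r -> mgt_ode r W -> forall t, 0 <= t ->
  let M := r ^+ 2 * `|W 0%N 0| + r * `|W 1%N 0| + `|W 2%N 0| in
  forall l, (l <= 2)%N ->
  r ^+ (2 - l) * `|W l t| <= C * M * expR (- beta * t)].
Proof.
have [a0 [C [a00 C0 H]]] := energy_decay tau0 delta0.
have b0 : 0 < b by rewrite addr_gt0.
pose beta := Num.min a0 (b^-1 / 2).
have beta0 : 0 < beta by rewrite lt_min a00 divr_gt0 ?invr_gt0.
have beta_a : beta <= a0 by rewrite ge_min lexx.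
have beta_b : 2 * (b * beta) <= 1.
  have h : beta <= b^-1 / 2 by rewrite ge_min lexx orbT.
  have : b * beta <= b * (b^-1 / 2) by rewrite ler_pM2l.
  have -> : b * (b^-1 / 2) = 1 / 2 by field; rewrite gt_eqF.
  by lra.
have beta_i : beta <= b^-1.
  have h : beta <= b^-1 / 2 by rewrite ge_min lexx orbT.
  have : 0 < b^-1 by rewrite invr_gt0.
  by lra.
pose C1 := C * (2 + 2 * tau).
have C10 : 0 < C1 by rewrite mulr_gt0// addr_gt0// mulr_gt0.
pose C2 := 2 * C1 / tau.
have C20 : 0 < C2 by rewrite divr_gt0// mulr_gt0.
pose C3 := 1 + tau / b + 2 * (delta / b * C2) + tau / b * C2.
have tb0 : 0 < tau / b by rewrite divr_gt0.
have db0 : 0 < delta / b by rewrite divr_gt0.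
have C30 : 0 < C3 by rewrite /C3; posi.
exists beta, (C1 + C2 + C3); split => // [|r W r1 [dW ode] t t0 M].
  by posi.
have r0 : 0 <= r by apply: le_trans r1.
have rr : r <= r ^+ 2 by rewrite expr2 ler_peMl.
have M0 : 0 <= M by rewrite /M; nneg.
have key u : 0 <= u -> Num.sqrt (energy tau (r ^+ 2) (W 0%N u) (W 1%N u) (W 2%N u))
    <= C1 * M * expR (- beta * u).
  move=> u0.
  have := H beta (r ^+ 2) 1 (W 0%N) (W 1%N) (W 2%N) (W 3%N) (fun=> 0) (fun=> 0) (fun=> 0)
    beta0 beta_a ltr01 (lexx _) (le_trans r1 rr) (dW _) (dW _) (dW _) _
    (derivf_cst _) _ u u0.
  rewrite mulr1 subrr addr0 => /(_ ode) K.
  rewrite mulNr expRN ler_pdivlMr ?expR_gt0// mulrC.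
  apply: le_trans (K _) _.
    by move=> v v0; rewrite normr0 mulr0.
  have [_ _ _ h] := le_sqrt_energy (W 0%N 0) (W 1%N 0) (W 2%N 0) r0.
  rewrite /C1 -mulrA ler_pM2l//; apply: le_trans h _.
  have h1 := ler_normD (W 1%N 0) (tau * W 2%N 0).
  have h2 := ler_normD (W 0%N 0) (tau * W 1%N 0).
  rewrite !normrM (gtr0_norm tau0) in h1 h2.
  rewrite /M.
  have q0 := normr_ge0 (W 0%N 0); have q1 := normr_ge0 (W 1%N 0).
  have q2 := normr_ge0 (W 2%N 0).
  move: `|W 1%N 0| `|W 0%N 0| `|W 2%N 0| h1 h2 q0 q1 q2 => x y z h1 h2 y0 x0 z0.
  have k1 : x <= r * x by rewrite ler_peMl.
  have k2 : r * y <= r ^+ 2 * y by rewrite ler_wpM2r.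
  have k3 : r * `|W 0%N 0 + tau * W 1%N 0| <= r * (y + tau * x) by rewrite ler_wpM2l.
  have k4 : 0 <= tau * (r ^+ 2 * y) by nneg.
  have k5 : 0 <= r ^+ 2 * y by nneg.
  have k6 : 0 <= tau * (r * x) by nneg.
  have k7 : 0 <= tau * z by nneg.
  have k8 : 0 <= r * x by nneg.
  apply: le_trans (_ : (x + tau * z) + r * (y + tau * x) + r * x <= _).
    by rewrite !lerD.
  by lra.
have tn0 : tau != 0 by rewrite gt_eqF.
have bn0 : b != 0 by rewrite gt_eqF.
have E0 u : 0 <= expR (- beta * u) by exact: expR_ge0.
have W1 u : 0 <= u -> r * `|W 1%N u| <= C1 * M * expR (- beta * u).
  move=> u0; apply: le_trans (key u u0).
  by have [] := le_sqrt_energy (W 0%N u) (W 1%N u) (W 2%N u) r0.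
have W2 u : 0 <= u -> `|W 2%N u| <= C2 * M * expR (- beta * u).
  move=> u0.
  have -> : W 2%N u = ((W 1%N u + tau * W 2%N u) - W 1%N u) / tau by field.
  rewrite normrM normfV (gtr0_norm tau0) ler_pdivrMr//.
  have -> : C2 * M * expR (- beta * u) * tau =
    C1 * M * expR (- beta * u) + C1 * M * expR (- beta * u) by rewrite /C2; field.
  apply: le_trans (ler_normB _ _) _; apply: lerD.
    apply: le_trans (key u u0).
    by have [] := le_sqrt_energy (W 0%N u) (W 1%N u) (W 2%N u) r0.
  by apply: le_trans (W1 u u0); rewrite ler_peMl.
have W0 u : 0 <= u -> r ^+ 2 * `|W 0%N u| <= C3 * M * expR (- beta * u).
  move=> u0.
  (* By the equation, b m' + m = - (delta / b) w'': adding (tau / b) w'' to r^2 w absorbs the term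
     in w''' and leaves a forcing that is already estimated. *)
  pose m v := r ^+ 2 * W 0%N v + tau / b * W 2%N v.
  have dm : derivf m (fun v => r ^+ 2 * W 1%N v + tau / b * W 3%N v).
    have := dW 0%N; have := dW 2%N => dW2 dW0.
    by rewrite /m; derivf_auto; ring.
  have c0 : 2 * (b * 0) <= 1 by rewrite !mulr0 ler01.
  have G10 : 0 <= delta / b * C2 * M.
    by apply: mulr_ge0 => //; apply: mulr_ge0; exact: ltW.
  have K : `|m u| <= `|m 0| * expR (- b^-1 * u)
      + 2 * (delta / b * C2 * M) * expR (- beta * u).
    apply: le_trans (relaxation b0 beta_b c0 G10 (lexx (0 : R)) dm _ u0) _; last first.
      by rewrite mulr0 mul0r addr0.
    move=> v v0.
    have -> : b * (r ^+ 2 * W 1%N v + tau / b * W 3%N v) + m v =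
      (tau * W 3%N v + W 2%N v + r ^+ 2 * W 0%N v + b * r ^+ 2 * W 1%N v)
      - delta / b * W 2%N v by rewrite /m; field.
    rewrite ode sub0r normrN normrM (gtr0_norm db0) mul0r addr0.
    by rewrite -(mulrA (delta / b)) -(mulrA (delta / b)) ler_pM2l// W2.
  have m0 : `|m 0| <= (1 + tau / b) * M.
    rewrite /m; apply: le_trans (ler_normD _ _) _.
    rewrite (normrM (r ^+ 2)) (normrM (tau / b)) (gtr0_norm tb0) (ger0_norm (sqr_ge0 r)).
    rewrite mulrDl mul1r; apply: lerD.
      by rewrite /M -addrA lerDl addr_ge0// mulr_ge0.
    by rewrite ler_pM2l// /M lerDr; nneg.
  have -> : r ^+ 2 * `|W 0%N u| = `|m u - tau / b * W 2%N u|.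
    by rewrite /m addrK normrM (ger0_norm (sqr_ge0 r)).
  apply: le_trans (ler_normB _ _) _.
  rewrite normrM (gtr0_norm tb0).
  have e1 : expR (- b^-1 * u) <= expR (- beta * u).
    by rewrite ler_expR ler_wpM2r// lerN2.
  have -> : C3 * M * expR (- beta * u) = ((1 + tau / b) * M * expR (- beta * u)
      + 2 * (delta / b * C2 * M) * expR (- beta * u))
      + tau / b * (C2 * M * expR (- beta * u)) by rewrite /C3; ring.
  apply: lerD; last by rewrite ler_pM2l// W2.
  apply: le_trans K _; rewrite lerD2r.
  by apply: ler_pM => //; exact: expR_ge0.
have ext x y : 0 <= x -> y <= x -> y * M * expR (- beta * t) <= x * M * expR (- beta * t).
  by move=> x0 yx; rewrite ler_wpM2r// ler_wpM2r.
have S0 : 0 <= C1 + C2 + C3 by nneg.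
move=> [|[|[|//]]] _ /=.
- by apply: le_trans (W0 t t0) (ext _ _ S0 _); rewrite lerDr; nneg.
- by rewrite expr1; apply: le_trans (W1 t t0) (ext _ _ S0 _); rewrite -addrA lerDl; nneg.
- rewrite expr0 mul1r; apply: le_trans (W2 t t0) (ext _ _ S0 _).
  by rewrite addrAC lerDr; nneg.
Qed.

End pointwise_bounds.

(** * Low frequencies *)

Section low_frequencies.
Variables (R : realType) (tau delta : R).
Hypotheses (tau0 : 0 < tau) (delta0 : 0 < delta).

Local Notation b := (delta + tau).

(** Integration in time costs two powers of r, so the square root of the energy is of order r^2 exp
    (- beta r^2 t). The energy weighs both w + tau w' and w' by r, hence only order r for [D 0] and,
    at first, for [D 1]. The missing powers come from relaxation: tau D'' + D' is of order r^2, and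
    by the equation tau D''' + D'' is of order r^3 up to a fast exponential. *)
Lemma low_frequency_error : exists beta C : R,
  [/\ 0 < beta, beta <= delta / 8, beta <= tau^-1 / 2, 0 < C &
  forall r N (D : nat -> R -> R) F, 0 < r -> r <= 1 -> 0 <= N ->
  (forall i, derivf (D i) (D i.+1)) ->
  (forall t, tau * D 3%N t + D 2%N t + r ^+ 2 * D 0%N t
    + b * r ^+ 2 * D 1%N t = F t) ->
  (forall t, 0 <= t -> `|F t| <= N * (r ^+ 2 * expR (- tau^-1 * t)
    + r ^+ 4 * expR (- (delta / 4) * r ^+ 2 * t))) ->
  D 0%N 0 = 0 -> `|D 1%N 0| <= N * r ^+ 2 -> `|D 2%N 0| <= N * r ^+ 2 ->
  forall t l, 0 <= t -> (l <= 2)%N ->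
  `|D l t| <= C * N * (r ^+ l.+1 * expR (- (beta * r ^+ 2) * t)
    + expR (- (tau^-1 / 2) * t))].
Proof.
have [a0 [C [a00 C0 H]]] := energy_decay tau0 delta0.
have b0 : 0 < b by rewrite addr_gt0.
have i0 : 0 < tau^-1 by rewrite invr_gt0.
have tn0 : tau != 0 by rewrite gt_eqF.
(* The forcing must still decay after multiplication by the weight exp (beta r^2 t): at rate beta
   r^2 for the diffusive part, by 2 beta <= delta / 4, and at rate 1 / (2 tau) for the fast part, by
   beta r^2 <= 1 / (2 tau). *)
pose beta := Num.min a0 (Num.min (delta / 8) (tau^-1 / 2)).
have beta0 : 0 < beta by rewrite !lt_min a00 !divr_gt0.
have beta_a : beta <= a0 by rewrite ge_min lexx.
have beta_d : beta <= delta / 8 by rewrite !ge_min lexx !orbT.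
have beta_t : beta <= tau^-1 / 2 by rewrite !ge_min lexx !orbT.
have bn0 : beta != 0 by rewrite gt_eqF.
pose C1 := C * ((1 + tau) + tau + 1 + (2 * tau + beta^-1)).
have C10 : 0 < C1 by rewrite /C1; posi.
pose C2 := (1 + tau) * C1.
pose C3 := 1 + 2 * C1.
pose C4 := C2 + b * C3 + 1.
have C20 : 0 < C2 by rewrite /C2; posi.
have C30 : 0 < C3 by rewrite /C3; posi.
have C40 : 0 < C4 by rewrite /C4; posi.
exists beta, (C2 + C3 + (3 + 2 * C4)); split => //.
  by posi.
move=> r N D F r0 r1 N0 dD ode HF D00 D10 D20.
have r0' := ltW r0.
have q0 : 0 < r ^+ 2 by posi.
have q1 : r ^+ 2 <= 1 by rewrite expr_le1.
have e_le u : 0 <= u -> expR (- (delta / 4) * r ^+ 2 * u) <= expR (- (2 * beta * r ^+ 2) * u).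
  move=> u0; rewrite ler_expR ler_wpM2r// mulNr lerN2 ler_pM2r//.
  by lra.
have e_le1 u : 0 <= u -> expR (- tau^-1 * u) <= expR (- (beta * r ^+ 2) * u).
  move=> u0; rewrite ler_expR ler_wpM2r// lerN2.
  by apply: (@le_trans _ _ (beta * 1)); [rewrite ler_pM2l|lra].
have e_le2 u : 0 <= u -> expR (- tau^-1 * u) <= expR (- (tau^-1 / 2) * u).
  by move=> u0; rewrite ler_expR ler_wpM2r// lerN2; lra.
have e_le3 u : 0 <= u -> expR (- (2 * beta * r ^+ 2) * u) <= expR (- (beta * r ^+ 2) * u).
  move=> u0; rewrite ler_expR ler_wpM2r// lerN2 ler_pM2r//; lra.
have E0 x : 0 <= expR x :> R by exact: expR_ge0.
have key u : 0 <= u -> Num.sqrt (energy tau (r ^+ 2) (D 0%N u) (D 1%N u) (D 2%N u))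
    <= C1 * N * r ^+ 2 * expR (- (beta * r ^+ 2) * u).
  move=> u0.
  pose g v := N * (r ^+ 2 * expR (- (tau^-1 / 2) * v)
     + r ^+ 4 * expR (- (beta * r ^+ 2) * v)).
  (* Explicit primitive of [g]; the quotient r^4 / (beta r^2) is where two powers of r are lost. *)
  pose G v := - (N * (2 * tau * r ^+ 2 * expR (- (tau^-1 / 2) * v)
     + r ^+ 2 / beta * expR (- (beta * r ^+ 2) * v))).
  have dG : derivf G g.
    by rewrite /G /g; derivf_auto; field; rewrite tn0 bn0.
  have := H beta (r ^+ 2) (r ^+ 2) (D 0%N) (D 1%N) (D 2%N) (D 3%N) F G g
    beta0 beta_a q0 q1 (lexx _) (dD _) (dD _) (dD _) ode dG _ u u0.
  move=> K.
  rewrite mulNr expRN ler_pdivlMr ?expR_gt0// mulrC.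
  apply: le_trans (K _) _ => [v v0|].
    have -> : g v = expR (beta * r ^+ 2 * v) * (N * (r ^+ 2 *
        expR (- (tau^-1 / 2 + beta * r ^+ 2) * v) + r ^+ 4 *
        expR (- (2 * beta * r ^+ 2) * v))).
      have -> : - (tau^-1 / 2 + beta * r ^+ 2) * v =
        - (tau^-1 / 2) * v - beta * r ^+ 2 * v by ring.
      have -> : - (2 * beta * r ^+ 2) * v =
        - (beta * r ^+ 2) * v - beta * r ^+ 2 * v by ring.
      rewrite !expRD expRN /g; field.
      by rewrite gt_eqF// expR_gt0.
    rewrite ler_wpM2l//; apply: le_trans (HF v v0) _.
    rewrite ler_wpM2l//; apply: lerD; rewrite ler_wpM2l ?exprn_ge0//.
      rewrite ler_expR ler_wpM2r// lerN2.
      suff : beta * r ^+ 2 <= beta * 1 by lra.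
      by rewrite ler_pM2l.
    exact: e_le.
  rewrite /C1 -!mulrA ler_pM2l//.
  have [_ _ _ h] := le_sqrt_energy tau (D 0%N 0) (D 1%N 0) (D 2%N 0) r0'.
  rewrite D00 add0r in h.
  have h1 : `|D 1%N 0 + tau * D 2%N 0| <= (1 + tau) * (N * r ^+ 2).
    apply: le_trans (ler_normD _ _) _; rewrite normrM (gtr0_norm tau0) mulrDl mul1r.
    by apply: lerD => //; rewrite ler_pM2l.
  have h2 : r * `|tau * D 1%N 0| <= tau * (N * r ^+ 2).
    rewrite normrM (gtr0_norm tau0) mulrCA ler_pM2l//; apply: le_trans D10.
    by rewrite ler_piMl.
  have h3 : r * `|D 1%N 0| <= N * r ^+ 2.
    by apply: le_trans D10; rewrite ler_piMl.
  have h4 : G u - G 0 <= (2 * tau + beta^-1) * (N * r ^+ 2).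
    have p1 : 0 <= N * (2 * tau * r ^+ 2 * expR (- (tau^-1 / 2) * u)
      + r ^+ 2 / beta * expR (- (beta * r ^+ 2) * u)).
      apply: mulr_ge0 => //; apply: addr_ge0; apply: mulr_ge0 => //.
        by nneg.
      by rewrite divr_ge0 ?ltW.
    rewrite /G !mulr0 expR0 !mulr1 opprK.
    have -> : N * (2 * tau * r ^+ 2 + r ^+ 2 / beta) =
      (2 * tau + beta^-1) * (N * r ^+ 2) by ring.
    by rewrite gerDr oppr_le0.
  by rewrite D00; move: h h1 h2 h3 h4; lra.
have Dz u : 0 <= u -> `|D 1%N u + tau * D 2%N u| <= C1 * N * r ^+ 2 * expR (- (beta * r ^+ 2) * u).
  move=> u0; apply: le_trans (key u u0).
  by have [] := le_sqrt_energy tau (D 0%N u) (D 1%N u) (D 2%N u) r0'.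
have D0 u : 0 <= u -> `|D 0%N u| <= C2 * N * (r * expR (- (beta * r ^+ 2) * u)).
  move=> u0; rewrite -(ler_pM2l r0).
  have [_ h1 h2 _] := le_sqrt_energy tau (D 0%N u) (D 1%N u) (D 2%N u) r0'.
  have -> : D 0%N u = (D 0%N u + tau * D 1%N u) - tau * D 1%N u by ring.
  have -> : r * (C2 * N * (r * expR (- (beta * r ^+ 2) * u))) =
    C1 * N * r ^+ 2 * expR (- (beta * r ^+ 2) * u) +
    tau * (C1 * N * r ^+ 2 * expR (- (beta * r ^+ 2) * u)) by rewrite /C2; ring.
  apply: (@le_trans _ _ (r * `|D 0%N u + tau * D 1%N u| + tau * (r * `|D 1%N u|))).
    rewrite mulrCA -mulrDr ler_pM2l//; apply: le_trans (ler_normB _ _) _.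
    by rewrite lerD2l normrM (gtr0_norm tau0).
  apply: lerD; first exact: le_trans h1 (key u u0).
  by rewrite ler_pM2l//; apply: le_trans h2 (key u u0).
have bt2 : 2 * (tau * (beta * r ^+ 2)) <= 1.
  have : beta * r ^+ 2 <= tau^-1 / 2.
    by apply: le_trans beta_t; rewrite -[leRHS]mulr1 ler_pM2l.
  rewrite -(ler_pM2l tau0) => h.
  have : tau * (tau^-1 / 2) = 1 / 2 by field.
  by move: h => /[swap] ->; lra.
have t2 : 2 * (tau * (tau^-1 / 2)) <= 1.
  by have -> : 2 * (tau * (tau^-1 / 2)) = 1 by field.
have D1 u : 0 <= u -> `|D 1%N u| <= C3 * N * (r ^+ 2 * expR (- (beta * r ^+ 2) * u)).
  move=> u0.
  have G10 : 0 <= C1 * N * r ^+ 2 by nneg.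
  apply: le_trans (relaxation tau0 bt2 bt2 G10 (lexx (0 : R)) (dD 1%N) _ u0) _.
    by move=> v v0; rewrite mul0r addr0 addrC; exact: Dz.
  rewrite mulr0 mul0r addr0.
  have -> : C3 * N * (r ^+ 2 * expR (- (beta * r ^+ 2) * u)) =
   N * r ^+ 2 * expR (- (beta * r ^+ 2) * u) +
   2 * (C1 * N * r ^+ 2) * expR (- (beta * r ^+ 2) * u) by rewrite /C3; ring.
  by rewrite lerD2r; apply: ler_pM => //; exact: e_le1.
have D2 u : 0 <= u -> `|D 2%N u| <= (3 + 2 * C4) * N * (r ^+ 3 * expR (- (beta * r ^+ 2) * u)
    + expR (- (tau^-1 / 2) * u)).
  move=> u0.
  have G10 : 0 <= C4 * N * r ^+ 3 by nneg.
  have G20 : 0 <= N * r ^+ 2 by nneg.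
  apply: le_trans (relaxation tau0 bt2 t2 G10 G20 (dD 2%N) _ u0) _.
    move=> v v0.
    have -> : tau * D 3%N v + D 2%N v = F v - r ^+ 2 * D 0%N v - b * r ^+ 2 * D 1%N v.
      by rewrite -ode; ring.
    pose e := expR (- (beta * r ^+ 2) * v); pose e2 := expR (- (tau^-1 / 2) * v).
    have f1 : `|F v| <= N * (r ^+ 2 * e2 + r ^+ 3 * e).
      apply: le_trans (HF v v0) _; rewrite ler_wpM2l//; apply: lerD.
        by rewrite ler_pM2l// e_le2.
      apply: ler_pM => //; rewrite ?exprn_ge0//.
        by rewrite exprS ler_piMl// exprn_ge0.
      by apply: le_trans (e_le v v0) _; exact: e_le3.
    have f2 : `|r ^+ 2 * D 0%N v| <= C2 * N * (r ^+ 3 * e).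
      rewrite normrM (gtr0_norm q0).
      have -> : C2 * N * (r ^+ 3 * e) = r ^+ 2 * (C2 * N * (r * e)) by ring.
      by rewrite ler_pM2l// D0.
    have f3 : `|b * r ^+ 2 * D 1%N v| <= b * C3 * N * (r ^+ 3 * e).
      rewrite normrM (gtr0_norm (mulr_gt0 b0 q0)) -!(mulrA b) ler_pM2l//.
      apply: (@le_trans _ _ (r * `|D 1%N v|)).
        by rewrite ler_wpM2r// expr2 ler_piMl.
      have -> : C3 * N * (r ^+ 3 * e) = r * (C3 * N * (r ^+ 2 * e)) by ring.
      by rewrite ler_pM2l// D1.
    apply: (@le_trans _ _ (`|F v| + `|r ^+ 2 * D 0%N v| + `|b * r ^+ 2 * D 1%N v|)).
      apply: le_trans (ler_normB _ _) _; rewrite lerD2r.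
      exact: ler_normB.
    rewrite -/e -/e2.
    have -> : C4 * N * r ^+ 3 * e + N * r ^+ 2 * e2 =
      N * (r ^+ 2 * e2 + r ^+ 3 * e) + C2 * N * (r ^+ 3 * e) + b * C3 * N * (r ^+ 3 * e).
      by rewrite /C4; ring.
    by apply: lerD => //; apply: lerD.
  have p1 : `|D 2%N 0| * expR (- tau^-1 * u) <= N * expR (- (tau^-1 / 2) * u).
    apply: ler_pM => //; last exact: e_le2.
    by apply: le_trans D20 _; rewrite ler_piMr.
  have p2 : 2 * (N * r ^+ 2) * expR (- (tau^-1 / 2) * u) <= 2 * N * expR (- (tau^-1 / 2) * u).
    by rewrite ler_wpM2r// ler_pM2l// ler_piMr.
  have p3 : 0 <= C4 * N * expR (- (tau^-1 / 2) * u) by nneg.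
  have p4 : 0 <= 3 * N * (r ^+ 3 * expR (- (beta * r ^+ 2) * u)).
    by apply: mulr_ge0; [nneg|apply: mulr_ge0 => //; rewrite exprn_ge0].
  by move: p1 p2 p3 p4; lra.
have Cext x y z : 0 <= x -> y <= x -> 0 <= z -> y * N * z <= x * N * z.
  by move=> x0 yx z0; rewrite ler_wpM2r// ler_wpM2r.
have CC : 0 <= C2 + C3 + (3 + 2 * C4) by nneg.
have CD x y : 0 <= x -> 0 <= y -> (C2 + C3 + (3 + 2 * C4)) * N * x <=
    (C2 + C3 + (3 + 2 * C4)) * N * (x + y).
  by move=> x0 y0; rewrite ler_wpM2l ?lerDl//; nneg.
move=> t [|[|[|//]]] t0 _ /=.
- apply: le_trans (D0 t t0) _; rewrite expr1.
  have h : 0 <= r * expR (- (beta * r ^+ 2) * t) by nneg.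
  by apply: le_trans (Cext _ _ _ CC _ h) (CD _ _ h _) => //; rewrite -addrA lerDl; nneg.
- apply: le_trans (D1 t t0) _.
  have h : 0 <= r ^+ 2 * expR (- (beta * r ^+ 2) * t) by nneg.
  by apply: le_trans (Cext _ _ _ CC _ h) (CD _ _ h _) => //; rewrite addrAC lerDr; nneg.
- apply: le_trans (D2 t t0) _; apply: Cext => //; first by rewrite lerDr; nneg.
  by apply: addr_ge0 => //; apply: mulr_ge0 => //; rewrite exprn_ge0.
Qed.

End low_frequencies.

(** * Damped trigonometric functions with amplitudes affine in time *)

Section damped_trigonometric.
Variable R : realType.
Implicit Types (mu r A B C D t : R).

(** A class stable under time differentiation, so that derivatives and residuals of the profile
    reduce to algebra on four coefficients. The slopes B and D are there for the factor t in
    [Nhat]. *)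
Definition dtrig mu r (v : R * R * R * R) t :=
  let: (A, B, C, D) := v in
  expR (- mu * t) * ((A + B * t) * cos (r * t) + (C + D * t) * sin (r * t)).

Definition dtrig_step mu r (v : R * R * R * R) :=
  let: (A, B, C, D) := v in
  (- mu * A + r * C + B, - mu * B + r * D, - mu * C - r * A + D, - mu * D - r * B).

Lemma derivf_dtrig mu r v :
  derivf (dtrig mu r v) (dtrig mu r (dtrig_step mu r v)).
Proof.
by move: v => [[[A B] C] D]; rewrite /dtrig /=; derivf_auto; ring.
Qed.

Lemma mul_expRN_le1 (x : R) : x * expR (- x) <= 1.
Proof.
rewrite expRN ler_pdivrMr ?expR_gt0// mul1r.
by apply: le_trans (expR_ge1Dx x); rewrite lerDr.
Qed.

(** A factor t costs two powers of r, by r^2 t exp (- delta r^2 t / 4) <= 4 / delta. This spends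
    half of the damping, and explains why the slopes are assumed smaller than the constant terms by
    r^2. *)
Lemma dtrig_le (delta M r A B C D t : R) (p : nat) : 0 < delta -> 0 <= M ->
  0 < r -> `|A| <= M * r ^+ p -> `|B| <= M * r ^+ p.+2 ->
  `|C| <= M * r ^+ p -> `|D| <= M * r ^+ p.+2 -> 0 <= t ->
  `|dtrig (delta / 2 * r ^+ 2) r (A, B, C, D) t| <=
  (2 + 8 / delta) * M * r ^+ p * expR (- (delta / 4) * r ^+ 2 * t).
Proof.
move=> d0 M0 r0 hA hB hC hD t0.
pose x := delta / 4 * r ^+ 2 * t.
have x0 : 0 <= x by rewrite /x; apply: mulr_ge0 => //; nneg.
have rp : 0 <= r ^+ p by rewrite exprn_ge0// ltW.
have dn : delta != 0 by rewrite gt_eqF.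
rewrite /dtrig.
have -> : - (delta / 2 * r ^+ 2) * t = - x + - x by rewrite /x; field.
have -> : - (delta / 4) * r ^+ 2 * t = - x by rewrite /x; ring.
rewrite expRD normrM ger0_norm; last by nneg.
have tr (a c : R) : `|c| <= 1 -> `|a * c| <= `|a|.
  by move=> c1; rewrite normrM ler_piMr.
have c1 : `|cos (r * t)| <= 1 by rewrite ler_norml cos_geN1 cos_le1.
have s1 : `|sin (r * t)| <= 1 by rewrite ler_norml sin_geN1 sin_le1.
have h (a c : R) : `|a| <= M * r ^+ p -> `|c| <= M * r ^+ p.+2 ->
    `|a + c * t| <= M * r ^+ p * (1 + 4 / delta * x).
  move=> ha hc; apply: le_trans (ler_normD _ _) _.
  rewrite mulrDr mulr1; apply: lerD => //.
  rewrite normrM (ger0_norm t0).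
  have -> : M * r ^+ p * (4 / delta * x) = M * r ^+ p.+2 * t.
    by rewrite /x !exprS; field.
  by rewrite ler_wpM2r.
have hh : `|(A + B * t) * cos (r * t) + (C + D * t) * sin (r * t)| <=
    2 * (M * r ^+ p * (1 + 4 / delta * x)).
  apply: le_trans (ler_normD _ _) _; rewrite mulr_natl mulr2n; apply: lerD.
    by apply: le_trans (tr _ _ c1) (h _ _ hA hB).
  by apply: le_trans (tr _ _ s1) (h _ _ hC hD).
apply: (@le_trans _ _ (expR (- x) * expR (- x) * (2 * (M * r ^+ p * (1 + 4 / delta * x))))).
  by rewrite ler_wpM2l//; nneg.
have -> : expR (- x) * expR (- x) * (2 * (M * r ^+ p * (1 + 4 / delta * x))) =
  M * r ^+ p * expR (- x) * (2 * expR (- x) + 8 / delta * (x * expR (- x))) by ring.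
have -> : (2 + 8 / delta) * M * r ^+ p * expR (- x) =
  M * r ^+ p * expR (- x) * (2 * 1 + 8 / delta * 1) by ring.
rewrite ler_wpM2l//; first by apply: mulr_ge0 => //; apply: mulr_ge0.
apply: lerD.
  by rewrite ler_pM2l// -[leRHS]expR0 ler_expR oppr_le0.
by rewrite ler_pM2l ?divr_gt0// mul_expRN_le1.
Qed.

(** Meant for forms linear in the data whose coefficients are polynomials in r on (0, 1]. Stability
    under sums and products lets [unif_auto] bound long explicit coefficients without computing any
    constant. *)
Definition unif_linear (f : R -> R -> R -> R) := exists2 K, 0 <= K &
  forall r x y, 0 < r -> r <= 1 -> `|f r x y| <= K * (`|x| + `|y|).

Definition unif_bounded (h : R -> R) := exists2 K, 0 <= K &
  forall r, 0 < r -> r <= 1 -> `|h r| <= K.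

Lemma unif_bounded_cst (c : R) : unif_bounded (fun=> c).
Proof. by exists `|c|. Qed.

Lemma unif_bounded_id : unif_bounded (fun r => r).
Proof. by exists 1 => // r r0 r1; rewrite gtr0_norm. Qed.

Lemma unif_boundedM h1 h2 : unif_bounded h1 -> unif_bounded h2 ->
  unif_bounded (fun r => h1 r * h2 r).
Proof.
move=> [K1 K10 H1] [K2 K20 H2]; exists (K1 * K2); first exact: mulr_ge0.
by move=> r r0 r1; rewrite normrM ler_pM ?H1 ?H2.
Qed.

Lemma unif_boundedX h n : unif_bounded h -> unif_bounded (fun r => h r ^+ n).
Proof.
elim: n => [|n IH] hb; first exact: (unif_bounded_cst 1).
have [K K0 H] := unif_boundedM hb (IH hb).
by exists K => // r r0 r1; rewrite exprS H.
Qed.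

Lemma unif_linear0 : unif_linear (fun _ _ _ => 0).
Proof. by exists 0 => // r x y _ _; rewrite normr0 mul0r. Qed.

Lemma unif_linearD f g : unif_linear f -> unif_linear g ->
  unif_linear (fun r x y => f r x y + g r x y).
Proof.
move=> [K1 K10 H1] [K2 K20 H2]; exists (K1 + K2); first exact: addr_ge0.
move=> r x y r0 r1; apply: le_trans (ler_normD _ _) _.
by rewrite mulrDl lerD ?H1 ?H2.
Qed.

Lemma unif_linear1 h : unif_bounded h -> unif_linear (fun r x y => h r * x).
Proof.
move=> [K K0 H]; exists K => // r x y r0 r1; rewrite normrM ler_pM ?H//.
by rewrite lerDl.
Qed.

Lemma unif_linear2 h : unif_bounded h -> unif_linear (fun r x y => h r * y).
Proof.
move=> [K K0 H]; exists K => // r x y r0 r1; rewrite normrM ler_pM ?H//.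
by rewrite lerDr.
Qed.

End damped_trigonometric.

Ltac unif_auto := repeat first
  [ apply: unif_linear0 | apply: unif_linearD | apply: unif_linear1
  | apply: unif_linear2 | apply: unif_bounded_cst | apply: unif_bounded_id
  | apply: unif_boundedX | apply: unif_boundedM ].

(** * Asymptotic profile at low frequency *)

Section low_frequency_expansion.
Variables (R : realType) (tau delta : R).
Hypotheses (tau0 : 0 < tau) (delta0 : 0 < delta).

Local Notation b := (delta + tau).
Local Notation c := (delta * (4 * tau - delta) / 8).

(** For l = 0 this is the approximation of the theorem for the data p0, p1. For l > 0 it is the
    exact l-th time derivative, as required to insert the profile into the ODE, whereas the symbols
    of the theorem differentiate the trigonometric factor and keep only leading corrections;
    [profile_symbol] measures the gap. *)
Definition profile (r p0 p1 : R) (l : nat) : R -> R :=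
  dtrig (delta / 2 * r ^+ 2) r
    (iter l (dtrig_step (delta / 2 * r ^+ 2) r) (p0, c * r ^+ 2 * p1, p1 / r, 0)).

Lemma derivf_profile r p0 p1 l :
  derivf (profile r p0 p1 l) (profile r p0 p1 l.+1).
Proof. exact: derivf_dtrig. Qed.

Lemma derive1n_sin (r t : R) l : (l <= 2)%N ->
  derive1n l (fun u : R => sin (r * u)) t =
  nth 0 [:: sin (r * t); r * cos (r * t); - r ^+ 2 * sin (r * t)] l.
Proof.
have d1 : derivf (fun u : R => sin (r * u)) (fun u => r * cos (r * u)).
  by derivf_auto; ring.
have d2 : derivf (fun u : R => r * cos (r * u)) (fun u => - r ^+ 2 * sin (r * u)).
  by derivf_auto; ring.
have dE (f f' : R -> R) : derivf f f' -> derive1 f = f'.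
  by move=> h; apply/funext => u; rewrite derive1E (@derive_val _ _ _ _ _ _ _ (h u)).
by move: l => [|[|[|//]]] _ //=; rewrite ?(dE _ _ d1) ?(dE _ _ d2).
Qed.

Lemma derive1n_cos (r t : R) l : (l <= 2)%N ->
  derive1n l (fun u : R => cos (r * u)) t =
  nth 0 [:: cos (r * t); - r * sin (r * t); - r ^+ 2 * cos (r * t)] l.
Proof.
have d1 : derivf (fun u : R => cos (r * u)) (fun u => - r * sin (r * u)).
  by derivf_auto; ring.
have d2 : derivf (fun u : R => - r * sin (r * u)) (fun u => - r ^+ 2 * cos (r * u)).
  by derivf_auto; ring.
have dE (f f' : R -> R) : derivf f f' -> derive1 f = f'.
  by move=> h; apply/funext => u; rewrite derive1E (@derive_val _ _ _ _ _ _ _ (h u)).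
by move: l => [|[|[|//]]] _ //=; rewrite ?(dE _ _ d1) ?(dE _ _ d2).
Qed.

(** Brings the symbols of the theorem into the class [dtrig], so that they are compared with the
    profile coefficient by coefficient. *)
Lemma symbol_dtrig r p0 p1 t l : 0 < r -> (l <= 2)%N ->
  (sin_symbol delta l t r + Nhat tau delta l t r) * p1 + cos_symbol delta l t r * p0 =
  dtrig (delta / 2 * r ^+ 2) r (nth 0
    [:: (p0, c * r ^+ 2 * p1, p1 / r, 0);
        (p1, 0, - r * p0 - delta / 2 * r * p1, - c * r ^+ 3 * p1);
        (- r ^+ 2 * p0 - delta * r ^+ 2 * p1, - c * r ^+ 4 * p1, - r * p1, 0)] l) t.
Proof.
move=> r0 hl; rewrite /sin_symbol /cos_symbol derive1n_sin// derive1n_cos//.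
have rn : r != 0 by rewrite gt_eqF.
move: l hl => [|[|[|//]]] _ /=; rewrite /J0hat /J1hat mulNr; field => //.
Qed.

(** A derivative that falls on the damping or on the factor t, instead of the trigonometric
    function, gains one power of r. For p0 this gain suffices. For p1 the term sin (r t) / r is
    larger by 1 / r, and the contributions of its damping that would be too large are exactly the
    constants 1/2 and 1 in [Nhat] for l = 1, 2. *)
Lemma profile_symbol : exists2 K, 0 <= K & forall r p0 p1 t l,
  0 < r -> r <= 1 -> 0 <= t -> (l <= 2)%N ->
  `|profile r p0 p1 l t - (sin_symbol delta l t r + Nhat tau delta l t r) * p1
    - cos_symbol delta l t r * p0| <=
  K * (`|p0| + `|p1|) * (r ^+ l.+1 * expR (- (delta / 4) * r ^+ 2 * t)).
Proof.
(* The six forms are the coefficients of the difference divided by their power of r: A and B for l =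
   1, then A, B, C, D for l = 2. All other coefficients cancel. *)
have [K1 K10 H1] : unif_linear (fun r p0 p1 : R => (-1 / 2) * delta * p0 + (1 / 2) * delta * tau * p1 + (-1 / 8) * delta ^+ 2 * p1) by unif_auto.
have [K2 K20 H2] : unif_linear (fun r p0 p1 : R => (-1 / 4) * delta ^+ 2 * tau * p1 + (1 / 16) * delta ^+ 3 * p1) by unif_auto.
have [K3 K30 H3] : unif_linear (fun r p0 p1 : R => (1 / 4) * r * delta ^+ 2 * p0 + (-1 / 2) * r * delta ^+ 2 * tau * p1 + (1 / 8) * r * delta ^+ 3 * p1) by unif_auto.
have [K4 K40 H4] : unif_linear (fun r p0 p1 : R => (1 / 8) * r * delta ^+ 3 * tau * p1 + (-1 / 32) * r * delta ^+ 4 * p1) by unif_auto.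
have [K5 K50 H5] : unif_linear (fun r p0 p1 : R => delta * p0 + (-1) * delta * tau * p1 + (1 / 2) * delta ^+ 2 * p1) by unif_auto.
have [K6 K60 H6] : unif_linear (fun r p0 p1 : R => (1 / 2) * delta ^+ 2 * tau * p1 + (-1 / 8) * delta ^+ 3 * p1) by unif_auto.
pose K := K1 + K2 + K3 + K4 + K5 + K6.
have K0 : 0 <= K by rewrite /K; nneg.
have d2 : 0 < 2 + 8 / delta by posi.
exists ((2 + 8 / delta) * K); first by rewrite mulr_ge0// ltW.
move=> r p0 p1 t l r0 r1 t0 hl.
have rn : r != 0 by rewrite gt_eqF.
set N := `|p0| + `|p1|.
have N0 : 0 <= N by rewrite /N; nneg.
have le_K k z p : 0 <= k -> k <= K -> `|z| <= k * N ->
    `|z * r ^+ p| <= K * N * r ^+ p.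
  move=> k0 kK h; rewrite normrM (ger0_norm (exprn_ge0 p (ltW r0))) ler_wpM2r ?exprn_ge0 ?(ltW r0)//.
  by apply: le_trans h _; rewrite ler_wpM2r.
have le0 p : `|0 : R| <= K * N * r ^+ p.
  by rewrite normr0; apply: mulr_ge0; [nneg|rewrite exprn_ge0// ltW].
rewrite -addrA -opprD symbol_dtrig//.
have sub (v w : R * R * R * R) : dtrig (delta / 2 * r ^+ 2) r v t - dtrig (delta / 2 * r ^+ 2) r w t =
    dtrig (delta / 2 * r ^+ 2) r (v.1.1.1 - w.1.1.1, v.1.1.2 - w.1.1.2, v.1.2 - w.1.2, v.2 - w.2) t.
  by move: v w => [[[? ?] ?] ?] [[[? ?] ?] ?]; rewrite /dtrig /=; ring.
rewrite /profile sub.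
have -> : (2 + 8 / delta) * K * N * (r ^+ l.+1 * expR (- (delta / 4) * r ^+ 2 * t)) =
  (2 + 8 / delta) * (K * N) * r ^+ l.+1 * expR (- (delta / 4) * r ^+ 2 * t) by ring.
have KN : 0 <= K * N by nneg.
have {}H1 := H1 r p0 p1 r0 r1; have {}H2 := H2 r p0 p1 r0 r1.
have {}H3 := H3 r p0 p1 r0 r1; have {}H4 := H4 r p0 p1 r0 r1.
have {}H5 := H5 r p0 p1 r0 r1; have {}H6 := H6 r p0 p1 r0 r1.
have le1 : K1 <= K by rewrite /K; clear -K10 K20 K30 K40 K50 K60; lra.
have le2 : K2 <= K by rewrite /K; clear -K10 K20 K30 K40 K50 K60; lra.
have le3 : K3 <= K by rewrite /K; clear -K10 K20 K30 K40 K50 K60; lra.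
have le4 : K4 <= K by rewrite /K; clear -K10 K20 K30 K40 K50 K60; lra.
have le5 : K5 <= K by rewrite /K; clear -K10 K20 K30 K40 K50 K60; lra.
have le6 : K6 <= K by rewrite /K; clear -K10 K20 K30 K40 K50 K60; lra.
move: l hl => [|[|[|//]]] _; apply: dtrig_le => //=.
- by rewrite subrr le0.
- by rewrite subrr le0.
- by rewrite subrr le0.
- by rewrite subrr le0.
- by apply: le_trans (le_K _ _ 2%N K10 le1 H1); le_of_eq; congr (`|_|); field.
- by apply: le_trans (le_K _ _ 4%N K20 le2 H2); le_of_eq; congr (`|_|); field.
- by apply: le_trans (le0 2%N); le_of_eq; congr (`|_|); field.
- by apply: le_trans (le0 4%N); le_of_eq; congr (`|_|); field.
- by apply: le_trans (le_K _ _ 3%N K30 le3 H3); le_of_eq; congr (`|_|); field.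
- by apply: le_trans (le_K _ _ 5%N K40 le4 H4); le_of_eq; congr (`|_|); field.
- by apply: le_trans (le_K _ _ 3%N K50 le5 H5); le_of_eq; congr (`|_|); field.
- by apply: le_trans (le_K _ _ 5%N K60 le6 H6); le_of_eq; congr (`|_|); field.
Qed.

(** The approximate root i r - delta r^2 / 2 is wrong by order r^3, which leaves a residual of order
    r^4 for p0. For p1 the amplitude 1 / r would leave r^3; the slope c r^2 p1 is what cancels this
    term, and this determines c. The slopes of the residual are of order r^6, as [dtrig_le]
    requires. *)
Lemma profile_residual : exists2 K, 0 <= K & forall r p0 p1 t,
  0 < r -> r <= 1 -> 0 <= t ->
  `|tau * profile r p0 p1 3 t + profile r p0 p1 2 t + r ^+ 2 * profile r p0 p1 0 t
    + b * r ^+ 2 * profile r p0 p1 1 t| <=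
  K * (`|p0| + `|p1|) * (r ^+ 4 * expR (- (delta / 4) * r ^+ 2 * t)).
Proof.
have [K1 K10 H1] : unif_linear (fun r p0 p1 : R =>
 delta * tau * p0 + (-1) * delta * tau ^+ 2 * p1 + (-1 / 4) * delta ^+ 2 * p0 + delta ^+ 2 * tau * p1 + (-1 / 8) * r ^+ 2 * delta ^+ 3 * tau * p0 + (3 / 8) * r ^+ 2 * delta ^+ 3 * tau ^+ 2 * p1 + (-3 / 32) * r ^+ 2 * delta ^+ 4 * tau * p1) by unif_auto.
have [K2 K20 H2] : unif_linear (fun r p0 p1 : R =>
 (1 / 2) * delta ^+ 2 * tau ^+ 2 * p1 + (-1 / 4) * delta ^+ 3 * tau * p1 + (1 / 32) * delta ^+ 4 * p1 + (-1 / 16) * r ^+ 2 * delta ^+ 4 * tau ^+ 2 * p1 + (1 / 64) * r ^+ 2 * delta ^+ 5 * tau * p1) by unif_auto.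
have [K3 K30 H3] : unif_linear (fun r p0 p1 : R =>
 (-3 / 4) * r * delta ^+ 2 * tau * p0 + (3 / 2) * r * delta ^+ 2 * tau ^+ 2 * p1 + (-1 / 2) * r * delta ^+ 3 * tau * p1) by unif_auto.
have [K4 K40 H4] : unif_linear (fun r p0 p1 : R =>
 (-3 / 8) * r * delta ^+ 3 * tau ^+ 2 * p1 + (3 / 32) * r * delta ^+ 4 * tau * p1) by unif_auto.
pose K := K1 + K2 + K3 + K4.
have K0 : 0 <= K by rewrite /K; nneg.
have d2 : 0 < 2 + 8 / delta by posi.
exists ((2 + 8 / delta) * K); first by rewrite mulr_ge0// ltW.
move=> r p0 p1 t r0 r1 t0.
have rn : r != 0 by rewrite gt_eqF.
set N := `|p0| + `|p1|.
have N0 : 0 <= N by rewrite /N; nneg.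
have le_K k z p : 0 <= k -> k <= K -> `|z| <= k * N ->
    `|z * r ^+ p| <= K * N * r ^+ p.
  move=> k0 kK h; rewrite normrM (ger0_norm (exprn_ge0 p (ltW r0))) ler_wpM2r ?exprn_ge0 ?(ltW r0)//.
  by apply: le_trans h _; rewrite ler_wpM2r.
have lin (x y z u : R * R * R * R) (m : R) :
    tau * dtrig m r x t + dtrig m r y t + r ^+ 2 * dtrig m r z t
      + b * r ^+ 2 * dtrig m r u t =
    dtrig m r (tau * x.1.1.1 + y.1.1.1 + r ^+ 2 * z.1.1.1 + b * r ^+ 2 * u.1.1.1,
       tau * x.1.1.2 + y.1.1.2 + r ^+ 2 * z.1.1.2 + b * r ^+ 2 * u.1.1.2,
       tau * x.1.2 + y.1.2 + r ^+ 2 * z.1.2 + b * r ^+ 2 * u.1.2,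
       tau * x.2 + y.2 + r ^+ 2 * z.2 + b * r ^+ 2 * u.2) t.
  by move: x y z u => [[[? ?] ?] ?] [[[? ?] ?] ?] [[[? ?] ?] ?] [[[? ?] ?] ?]; rewrite /dtrig /=; ring.
rewrite /profile lin.
have -> : (2 + 8 / delta) * K * N * (r ^+ 4 * expR (- (delta / 4) * r ^+ 2 * t)) =
  (2 + 8 / delta) * (K * N) * r ^+ 4 * expR (- (delta / 4) * r ^+ 2 * t) by ring.
have KN : 0 <= K * N by nneg.
have {}H1 := H1 r p0 p1 r0 r1; have {}H2 := H2 r p0 p1 r0 r1.
have {}H3 := H3 r p0 p1 r0 r1; have {}H4 := H4 r p0 p1 r0 r1.
have le1 : K1 <= K by rewrite /K; clear -K10 K20 K30 K40; lra.
have le2 : K2 <= K by rewrite /K; clear -K10 K20 K30 K40; lra.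
have le3 : K3 <= K by rewrite /K; clear -K10 K20 K30 K40; lra.
have le4 : K4 <= K by rewrite /K; clear -K10 K20 K30 K40; lra.
apply: dtrig_le => //=.
- by apply: le_trans (le_K _ _ 4%N K10 le1 H1); le_of_eq; congr (`|_|); field.
- by apply: le_trans (le_K _ _ 6%N K20 le2 H2); le_of_eq; congr (`|_|); field.
- by apply: le_trans (le_K _ _ 4%N K30 le3 H3); le_of_eq; congr (`|_|); field.
- by apply: le_trans (le_K _ _ 6%N K40 le4 H4); le_of_eq; congr (`|_|); field.
Qed.

End low_frequency_expansion.

(** * Comparison of the solution with the profile for r <= 1 *)

Section low_frequency.
Variables (R : realType) (tau delta : R).
Hypotheses (tau0 : 0 < tau) (delta0 : 0 < delta).

Local Notation b := (delta + tau).
Local Notation c := (delta * (4 * tau - delta) / 8).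

Lemma profile_init : exists2 K, 0 <= K & forall r p0 p1, 0 < r -> r <= 1 ->
  [/\ profile tau delta r p0 p1 0 0 = p0,
    `|profile tau delta r p0 p1 1 0 - p1| <= K * (`|p0| + `|p1|) * r ^+ 2 &
    `|profile tau delta r p0 p1 2 0| <= K * (`|p0| + `|p1|) * r ^+ 2].
Proof.
have [K1 K10 H1] : unif_linear (fun r p0 p1 : R => (-1 / 2) * delta * p0 + (1 / 2) * delta * tau * p1 + (-1 / 8) * delta ^+ 2 * p1) by unif_auto.
have [K2 K20 H2] : unif_linear (fun r p0 p1 : R => (-1) * p0 + (-1) * delta * p1 + (1 / 4) * r ^+ 2 * delta ^+ 2 * p0 + (-1 / 2) * r ^+ 2 * delta ^+ 2 * tau * p1 + (1 / 8) * r ^+ 2 * delta ^+ 3 * p1) by unif_auto.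
exists (K1 + K2); first by nneg.
move=> r p0 p1 r0 r1.
have rn : r != 0 by rewrite gt_eqF.
have le_K k z : 0 <= k -> k <= K1 + K2 -> `|z| <= k * (`|p0| + `|p1|) ->
    `|z * r ^+ 2| <= (K1 + K2) * (`|p0| + `|p1|) * r ^+ 2.
  move=> k0 kK h; rewrite normrM (ger0_norm (sqr_ge0 r)) ler_wpM2r ?sqr_ge0//.
  by apply: le_trans h _; rewrite ler_wpM2r//; nneg.
have le1 : K1 <= K1 + K2 by lra.
have le2 : K2 <= K1 + K2 by lra.
have e0 (v : R * R * R * R) m : dtrig m r v 0 = v.1.1.1.
  by move: v => [[[? ?] ?] ?]; rewrite /dtrig !mulr0 expR0 cos0 sin0 /=; ring.
rewrite /profile !e0; split => //=.
- apply: le_trans (le_K _ _ K10 le1 (H1 r p0 p1 r0 r1)).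
  by le_of_eq; congr (`|_|); field.
- apply: le_trans (le_K _ _ K20 le2 (H2 r p0 p1 r0 r1)).
  by le_of_eq; congr (`|_|); field.
Qed.

(* The fast mode Q = tau^2 w''(0) e^(-t / tau) of the equation at r = 0 is
   subtracted together with the profile, so that the remaining initial data are
   O(r^2). *)
Lemma low_frequency : exists beta C : R, [/\ 0 < beta, 0 < C &
  forall r W, 0 < r -> r <= 1 -> mgt_ode tau delta r W ->
  forall t l, 0 <= t -> (l <= 2)%N ->
  `|W l t - (sin_symbol delta l t r + Nhat tau delta l t r) * (W 1%N 0 + tau * W 2%N 0)
    - cos_symbol delta l t r * (W 0%N 0 - tau ^+ 2 * W 2%N 0)| <=
  C * (`|W 0%N 0| + `|W 1%N 0| + `|W 2%N 0|)
    * (r ^+ l.+1 * expR (- beta * r ^+ 2 * t) + expR (- beta * t))].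
Proof.
have [beta [C [beta0 beta_d beta_t C0 H]]] := low_frequency_error tau0 delta0.
have [K1 K10 H1] := profile_symbol tau delta0.
have [K2 K20 H2] := profile_residual tau delta0.
have [K3 K30 H3] := profile_init.
have i0 : 0 < tau^-1 by rewrite invr_gt0.
have tn0 : tau != 0 by rewrite gt_eqF.
have b0 : 0 < b by rewrite addr_gt0.
pose T := 1 + tau + tau ^+ 2.
have T0 : 0 < T by rewrite /T; posi.
pose K4 := tau ^+ 2 + b * tau.
have K40 : 0 < K4 by rewrite /K4; posi.
pose K := K2 * T + K3 * T + K4.
have K0 : 0 <= K by rewrite /K; nneg.
exists beta, (C * K + (1 + tau + tau ^+ 2) + K1 * T); split => //.
  by apply: ltr_wpDr; [nneg|apply: ltr_wpDl; [nneg|posi]].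
move=> r W r0 r1 [dW ode] t l t0 hl.
set w0 := W 0%N 0; set w1 := W 1%N 0; set w2 := W 2%N 0.
set p1 := w1 + tau * w2; set p0 := w0 - tau ^+ 2 * w2.
set N := `|w0| + `|w1| + `|w2|.
have N0 : 0 <= N by rewrite /N; nneg.
have q0 : 0 < r ^+ 2 by posi.
have q1 : r ^+ 2 <= 1 by rewrite expr_le1// ltW.
have pN : `|p0| + `|p1| <= T * N.
  have h0 : `|p0| <= `|w0| + tau ^+ 2 * `|w2|.
    by rewrite /p0; apply: le_trans (ler_normB _ _) _; rewrite normrM (ger0_norm (sqr_ge0 tau)).
  have h1 : `|p1| <= `|w1| + tau * `|w2|.
    by rewrite /p1; apply: le_trans (ler_normD _ _) _; rewrite normrM (gtr0_norm tau0).
  have g0 : 0 <= (tau + tau ^+ 2) * `|w0| by nneg.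
  have g1 : 0 <= (tau + tau ^+ 2) * `|w1| by nneg.
  have := normr_ge0 w2.
  by rewrite /T /N; clear -h0 h1 g0 g1; lra.
have w2N : `|w2| <= N by rewrite /N lerDr addr_ge0.
(* [Q i] is the i-th derivative of the fast mode. As tau Q''' + Q'' = 0, only r^2 (Q + b Q') enters
   the forcing, with constant [K4]. Its initial values tau^2 w2, - tau w2 and w2 complete p0, p1 and
   0 to the three data. *)
pose Q (i : nat) u := (- tau^-1) ^+ i * (tau ^+ 2 * w2) * expR (- tau^-1 * u).
have dQ i : derivf (Q i) (Q i.+1).
  by rewrite /Q; derivf_auto; rewrite (exprS _ i); set a := (- tau^-1) ^+ i; ring.
have QN i u : (i <= 2)%N -> `|Q i u| <= (1 + tau + tau ^+ 2) * N * expR (- tau^-1 * u).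
  move=> hi; rewrite /Q normrM (ger0_norm (expR_ge0 _)) ler_wpM2r ?expR_ge0//.
  have -> : (- tau^-1) ^+ i * (tau ^+ 2 * w2) = ((- tau^-1) ^+ i * tau ^+ 2) * w2 by ring.
  rewrite normrM; apply: ler_pM; rewrite ?normr_ge0//.
  have h1 : 0 <= tau ^+ 2 by nneg.
  move: i hi => [|[|[|//]]] _; rewrite ?expr0 ?expr1 ?mul1r.
  - by rewrite ger0_norm// lerDr; nneg.
  - have -> : - tau^-1 * tau ^+ 2 = - tau by field.
    by rewrite normrN gtr0_norm// addrAC lerDr; nneg.
  - have -> : (- tau^-1) ^+ 2 * tau ^+ 2 = 1 by field.
    by rewrite normr1 -addrA lerDl; nneg.
pose D (i : nat) u := W i u - profile tau delta r p0 p1 i u - Q i u.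
pose F u := - (tau * profile tau delta r p0 p1 3 u + profile tau delta r p0 p1 2 u
    + r ^+ 2 * profile tau delta r p0 p1 0 u
    + b * r ^+ 2 * profile tau delta r p0 p1 1 u)
    - r ^+ 2 * (Q 0%N u + b * Q 1%N u).
have KN : 0 <= K * N by nneg.
have e0 x : 0 <= expR x :> R by exact: expR_ge0.
have HD := H r (K * N) D F r0 r1 KN.
have {}HD : forall u i, 0 <= u -> (i <= 2)%N -> `|D i u| <=
    C * (K * N) * (r ^+ i.+1 * expR (- (beta * r ^+ 2) * u) + expR (- (tau^-1 / 2) * u)).
  apply: HD.
  - by move=> i; have d1 := dW i; have d2 := @derivf_profile _ tau delta r p0 p1 i;
      have d3 := dQ i; rewrite /D; derivf_auto.
  - move=> u; rewrite /D /F.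
    have -> : tau * (W 3%N u - profile tau delta r p0 p1 3 u - Q 3%N u) +
      (W 2%N u - profile tau delta r p0 p1 2 u - Q 2%N u) +
      r ^+ 2 * (W 0%N u - profile tau delta r p0 p1 0 u - Q 0%N u) +
      b * r ^+ 2 * (W 1%N u - profile tau delta r p0 p1 1 u - Q 1%N u) =
      (tau * W 3%N u + W 2%N u + r ^+ 2 * W 0%N u + b * r ^+ 2 * W 1%N u)
      - (tau * profile tau delta r p0 p1 3 u + profile tau delta r p0 p1 2 u
      + r ^+ 2 * profile tau delta r p0 p1 0 u
      + b * r ^+ 2 * profile tau delta r p0 p1 1 u)
      - (tau * Q 3%N u + Q 2%N u) - r ^+ 2 * (Q 0%N u + b * Q 1%N u) by ring.
    have -> : tau * Q 3%N u + Q 2%N u = 0 by rewrite /Q; field.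
    by rewrite ode; ring.
  - move=> u u0; rewrite /F; apply: le_trans (ler_normB _ _) _.
    rewrite normrN.
    have h2 := H2 r p0 p1 u r0 r1 u0.
    have {}h2 := le_trans h2 (ler_wpM2r (mulr_ge0 (exprn_ge0 4 (ltW r0))
      (e0 (- (delta / 4) * r ^+ 2 * u))) (ler_wpM2l K20 pN)).
    have h3 : `|r ^+ 2 * (Q 0%N u + b * Q 1%N u)| <= K4 * N * (r ^+ 2 * expR (- tau^-1 * u)).
      have -> : Q 0%N u + b * Q 1%N u = (tau ^+ 2 - b * tau) * w2 * expR (- tau^-1 * u).
        by rewrite /Q; field.
      rewrite normrM (gtr0_norm q0) normrM (ger0_norm (e0 _)) normrM.
      have -> : K4 * N * (r ^+ 2 * expR (- tau^-1 * u)) = r ^+ 2 * (K4 * N * expR (- tau^-1 * u)).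
        by ring.
      rewrite ler_pM2l//; apply: ler_wpM2r => //; apply: ler_pM => //.
      apply: le_trans (ler_normB _ _) _; rewrite /K4.
      by rewrite !ger0_norm//; nneg.
    apply: le_trans (lerD h2 h3) _.
    have a1 : 0 <= r ^+ 4 * expR (- (delta / 4) * r ^+ 2 * u).
      by apply: mulr_ge0 => //; rewrite exprn_ge0// ltW.
    have a2 : 0 <= r ^+ 2 * expR (- tau^-1 * u) by nneg.
    set x := r ^+ 4 * _ in a1 *; set y := r ^+ 2 * _ in a2 *.
    have g1 : 0 <= (K3 * T + K4) * N * x by nneg.
    have g2 : 0 <= (K2 * T + K3 * T) * N * y by nneg.
    by rewrite /K; clear -g1 g2; lra.
  - have [h _ _] := H3 r p0 p1 r0 r1.
    by rewrite /D h /Q mulr0 expR0 /p0 /w0; ring.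
  - have [_ h _] := H3 r p0 p1 r0 r1.
    have -> : D 1%N 0 = - (profile tau delta r p0 p1 1 0 - p1).
      by rewrite /D /Q mulr0 expR0 /p1 -/w1; field.
    rewrite normrN; apply: le_trans h _; rewrite ler_pM2r//.
    apply: le_trans (ler_wpM2l K30 pN) _.
    have g1 : 0 <= (K2 * T + K4) * N by nneg.
    by rewrite /K; clear -g1; lra.
  - have [_ _ h] := H3 r p0 p1 r0 r1.
    have -> : D 2%N 0 = - profile tau delta r p0 p1 2 0.
      by rewrite /D /Q mulr0 expR0 -/w2; field.
    rewrite normrN; apply: le_trans h _; rewrite ler_pM2r//.
    apply: le_trans (ler_wpM2l K30 pN) _.
    have g1 : 0 <= (K2 * T + K4) * N by nneg.
    by rewrite /K; clear -g1; lra.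
have hD := HD t l t0 hl.
have hS := H1 r p0 p1 t l r0 r1 t0 hl.
have hQ := QN l t hl.
set S := sin_symbol delta l t r + Nhat tau delta l t r in hS *.
set V := cos_symbol delta l t r in hS *.
have -> : W l t - S * p1 - V * p0 =
   D l t + Q l t + (profile tau delta r p0 p1 l t - S * p1 - V * p0) by rewrite /D; ring.
set x := r ^+ l.+1.
have x0 : 0 <= x by rewrite /x exprn_ge0// ltW.
apply: (@le_trans _ _ (`|D l t| + `|Q l t| + `|profile tau delta r p0 p1 l t - S * p1 - V * p0|)).
  by apply: le_trans (ler_normD _ _) _; rewrite lerD2r ler_normD.
set E1 := expR (- beta * r ^+ 2 * t); set E2 := expR (- beta * t).
have E10 : 0 <= E1 by exact: e0.
have E20 : 0 <= E2 by exact: e0.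
have l1 : expR (- (tau^-1 / 2) * t) <= E2 by rewrite ler_expR ler_wpM2r// lerN2.
have l2 : expR (- tau^-1 * t) <= E2.
  by apply: le_trans l1; rewrite ler_expR ler_wpM2r// lerN2; clear -i0 tau0 delta0; lra.
have l3 : expR (- (delta / 4) * r ^+ 2 * t) <= E1.
  by rewrite ler_expR ler_wpM2r// ler_wpM2r ?(ltW q0)// lerN2; clear -beta_d beta0 tau0 delta0; lra.
have b1 : `|D l t| <= C * K * N * (x * E1 + E2).
  apply: le_trans hD _; rewrite (mulrA C) -mulNr.
  by apply: ler_wpM2l; [nneg|rewrite lerD2l].
have b2 : `|Q l t| <= (1 + tau + tau ^+ 2) * N * (x * E1 + E2).
  apply: le_trans hQ _; apply: ler_wpM2l; first by nneg.
  by apply: le_trans l2 _; rewrite lerDr; nneg.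
have b3 : `|profile tau delta r p0 p1 l t - S * p1 - V * p0| <= K1 * T * N * (x * E1 + E2).
  apply: le_trans hS _; rewrite -(mulrA K1 T); apply: ler_pM.
  - by nneg.
  - by apply: mulr_ge0 => //; exact: e0.
  - by rewrite ler_wpM2l.
  - apply: (@le_trans _ _ (x * E1)); last by rewrite lerDl.
    by rewrite ler_wpM2l.
by rewrite -/N; clear -b1 b2 b3 tau0 delta0; lra.
Qed.

End low_frequency.

(** * High frequencies *)

Section high_frequency_difference.
Variables (R : realType) (tau delta : R).
Hypotheses (tau0 : 0 < tau) (delta0 : 0 < delta).

Local Notation c := (delta * (4 * tau - delta) / 8).

(** For t >= 1 the damping absorbs any power of r, and what is left is at most exp (- delta t / 8)
    because r >= 1. Time has to stay away from 0, where the symbols do not smooth. *)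
Lemma high_frequency_symbol : exists2 K, 0 <= K & forall r p0 p1 t l,
  1 <= r -> 1 <= t -> (l <= 2)%N ->
  r ^+ 2 * `|(sin_symbol delta l t r + Nhat tau delta l t r) * p1
    + cos_symbol delta l t r * p0| <=
  K * (`|p0| + `|p1|) * expR (- (delta / 8) * t).
Proof.
(* Dominates 1, |c|, 1 + delta / 2 and 1 + delta, the sizes of the coefficients in
   [symbol_dtrig]. *)
pose K1 := 2 + `|c| + delta.
have K10 : 0 < K1 by rewrite /K1; apply: addr_gt0 => //; apply: ltr_wpDr.
have d2 : 0 < 2 + 8 / delta by posi.
have d16 : 0 < 16 / delta by posi.
have dn : delta != 0 by rewrite gt_eqF.
exists ((2 + 8 / delta) * K1 * (16 / delta) ^+ 2); first by nneg.
move=> r p0 p1 t l r1 t1 hl.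
have r0 : 0 < r by apply: lt_le_trans r1.
have t0 : 0 <= t by apply: le_trans t1.
set N := `|p0| + `|p1|.
have N0 : 0 <= N by rewrite /N; nneg.
have p0N : `|p0| <= N by rewrite lerDl.
have p1N : `|p1| <= N by rewrite lerDr.
have KN : 0 <= K1 * N by nneg.
have rX n m : (n <= m)%N -> r ^+ n <= r ^+ m by move=> h; apply: ler_weXn2l.
have rX0 n : 0 <= r ^+ n by rewrite exprn_ge0// ltW.
have c0 := normr_ge0 c.
have mono k n m p : (n <= m)%N -> `|k| <= K1 -> `|p| <= N ->
    `|k * r ^+ n * p| <= K1 * N * r ^+ m.
  move=> nm kK pN; rewrite !normrM (ger0_norm (rX0 n)).
  have -> : `|k| * r ^+ n * `|p| = `|k| * `|p| * r ^+ n by ring.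
  by apply: ler_pM; [nneg|exact: rX0|apply: ler_pM => //|exact: rX].
have zer m : `|0 : R| <= K1 * N * r ^+ m by rewrite normr0; apply: mulr_ge0.
have k1 : `|1 : R| <= K1 by rewrite normr1 /K1; have := delta0; move: `|c| c0 => x x0; lra.
have kc : `|c| <= K1 by rewrite /K1; have := delta0; move: `|c| c0 => x x0; lra.
have kNc : `|- c| <= K1 by rewrite normrN.
have two k l' : `|k| + `|l'| <= K1 ->
    forall n, `|k * r ^+ n * p0 + l' * r ^+ n * p1| <= K1 * N * r ^+ n.
  move=> kl n; apply: le_trans (ler_normD _ _) _; rewrite !normrM (ger0_norm (rX0 n)).
  have -> : `|k| * r ^+ n * `|p0| + `|l'| * r ^+ n * `|p1| =
    (`|k| * `|p0| + `|l'| * `|p1|) * r ^+ n by ring.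
  apply: ler_wpM2r => //; apply: (@le_trans _ _ (`|k| * N + `|l'| * N)).
    by apply: lerD; rewrite ler_wpM2l.
  by rewrite -mulrDl ler_wpM2r.
have rX2 k n : (n <= k)%N -> K1 * N * r ^+ n <= K1 * N * r ^+ k.
  by move=> h; rewrite ler_wpM2l// rX.
have dD : `|- 1 : R| + `|- (delta / 2)| <= K1.
  by rewrite !normrN normr1 ger0_norm ?divr_ge0 ?(ltW delta0)//; rewrite /K1; have := delta0; move: `|c| c0 => x x0; lra.
have dD2 : `|- 1 : R| + `|- delta| <= K1.
  by rewrite !normrN normr1 gtr0_norm//; rewrite /K1; have := delta0; move: `|c| c0 => x x0; lra.
have key : `|(sin_symbol delta l t r + Nhat tau delta l t r) * p1
    + cos_symbol delta l t r * p0| <=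
    (2 + 8 / delta) * (K1 * N) * r ^+ 2 * expR (- (delta / 4) * r ^+ 2 * t).
  rewrite symbol_dtrig//.
  move: l hl => [|[|[|//]]] _; apply: dtrig_le => //=.
  - by have := mono 1 0%N 2%N p0 isT k1 p0N; rewrite expr0 !mul1r.
  - exact: mono.
  - apply: le_trans (_ : `|p1| <= _).
      rewrite normrM ler_piMr// normfV gtr0_norm// invf_le1//.
    by have := mono 1 0%N 2%N p1 isT k1 p1N; rewrite expr0 !mul1r.
  - by have := mono 1 0%N 2%N p1 isT k1 p1N; rewrite expr0 !mul1r.
  - have := two _ _ dD 1%N; rewrite expr1 mulN1r => h.
    by apply: le_trans (rX2 2%N 1%N isT); rewrite -!mulNr in h *; rewrite expr1.
  - exact: mono.
  - by have := two _ _ dD2 2%N; rewrite mulN1r !mulNr.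
  - exact: mono.
  - by have := mono (-1) 1%N 2%N p1 isT _ p1N; rewrite expr1 mulN1r normrN => /(_ k1).
apply: le_trans (ler_wpM2l (rX0 2%N) key) _.
set y := r ^+ 2 * t.
have r2y : r ^+ 2 <= y by rewrite /y ler_peMr.
have ty : t <= y by rewrite /y ler_peMl// exprn_ege1.
have y0 : 0 <= y by apply: le_trans ty.
(* The exponent is cut in three: two factors [e] absorb one r^2 each, by r^2 <= y, and the third one
   provides the decay, by t <= y. *)
have -> : - (delta / 4) * r ^+ 2 * t = - (delta / 16 * y) + - (delta / 16 * y) + - (delta / 8) * y.
  by rewrite /y; field.
rewrite !expRD; set e := expR (- (delta / 16 * y)).
have e0 : 0 <= e by exact: expR_ge0.
have ye : y * e <= 16 / delta.
  have := mul_expRN_le1 (delta / 16 * y); rewrite -/e => h.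
  have -> : y * e = 16 / delta * (delta / 16 * y * e) by field.
  by rewrite -[leRHS]mulr1 ler_pM2l.
have -> : r ^+ 2 * ((2 + 8 / delta) * (K1 * N) * r ^+ 2 * (e * e * expR (- (delta / 8) * y))) =
  (2 + 8 / delta) * (K1 * N) * ((r ^+ 2 * e) * (r ^+ 2 * e) * expR (- (delta / 8) * y)) by ring.
have -> : (2 + 8 / delta) * K1 * (16 / delta) ^+ 2 * N * expR (- (delta / 8) * t) =
  (2 + 8 / delta) * (K1 * N) * ((16 / delta) * (16 / delta) * expR (- (delta / 8) * t)).
  by ring.
have re : r ^+ 2 * e <= 16 / delta by apply: le_trans ye; rewrite ler_wpM2r.
apply: ler_wpM2l; first by nneg.
apply: ler_pM; [by nneg|exact: expR_ge0| |].
  by apply: ler_pM => //; nneg.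
by rewrite ler_expR !mulNr lerN2 ler_wpM2l// ltW// divr_gt0.
Qed.

Lemma high_frequency_difference : exists beta C : R, [/\ 0 < beta, 0 < C &
  forall r W, 1 <= r -> mgt_ode tau delta r W ->
  forall t l, 1 <= t -> (l <= 2)%N ->
  r ^+ (2 - l) *
  `|W l t - (sin_symbol delta l t r + Nhat tau delta l t r) * (W 1%N 0 + tau * W 2%N 0)
    - cos_symbol delta l t r * (W 0%N 0 - tau ^+ 2 * W 2%N 0)| <=
  C * (r ^+ 2 * `|W 0%N 0| + r * `|W 1%N 0| + `|W 2%N 0|) * expR (- beta * t)].
Proof.
have [b1 [C1 [b10 C10 H1]]] := high_frequency tau0 delta0.
have [K2 K20 H2] := high_frequency_symbol.
pose beta := Num.min b1 (delta / 8).
have beta0 : 0 < beta by rewrite lt_min b10 divr_gt0.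
pose T := 1 + tau + tau ^+ 2.
have T0 : 0 < T by rewrite /T; posi.
exists beta, (C1 + K2 * T); split => //; first by apply: ltr_wpDr => //; nneg.
move=> r W r1 hW t l t1 hl.
have r0 : 0 < r by apply: lt_le_trans r1.
have t0 : 0 <= t by apply: le_trans t1.
have {}H1 := H1 r W r1 hW t t0 l hl.
set w0 := W 0%N 0 in H1 *; set w1 := W 1%N 0 in H1 *; set w2 := W 2%N 0 in H1 *.
set p1 := w1 + tau * w2; set p0 := w0 - tau ^+ 2 * w2.
set M := r ^+ 2 * `|w0| + r * `|w1| + `|w2| in H1 *.
have rr : r <= r ^+ 2 by rewrite expr2 ler_peMl// ltW.
have M0 : 0 <= M by rewrite /M; nneg.
have pM : `|p0| + `|p1| <= T * M.
  have h0 : `|p0| <= `|w0| + tau ^+ 2 * `|w2|.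
    by rewrite /p0; apply: le_trans (ler_normB _ _) _; rewrite normrM (ger0_norm (sqr_ge0 tau)).
  have h1 : `|p1| <= `|w1| + tau * `|w2|.
    by rewrite /p1; apply: le_trans (ler_normD _ _) _; rewrite normrM (gtr0_norm tau0).
  have g1 : `|w1| <= r * `|w1| by rewrite ler_peMl.
  have g0 : `|w0| <= r ^+ 2 * `|w0| by rewrite ler_peMl// exprn_ege1.
  have g2 : 0 <= (tau + tau ^+ 2) * (r ^+ 2 * `|w0|) by nneg.
  have g3 : 0 <= (tau + tau ^+ 2) * (r * `|w1|) by nneg.
  have := normr_ge0 w2.
  by rewrite /T /M; lra.
set S := sin_symbol delta l t r + Nhat tau delta l t r.
set V := cos_symbol delta l t r.
have -> : W l t - S * p1 - V * p0 = W l t - (S * p1 + V * p0) by ring.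
apply: (@le_trans _ _ (r ^+ (2 - l) * `|W l t| + r ^+ (2 - l) * `|S * p1 + V * p0|)).
  rewrite -mulrDr ler_wpM2l ?exprn_ge0 ?(ltW r0)//; exact: ler_normB.
have -> : (C1 + K2 * T) * M * expR (- beta * t) =
  C1 * M * expR (- beta * t) + K2 * (T * M) * expR (- beta * t) by ring.
have be (a : R) : beta <= a -> expR (- a * t) <= expR (- beta * t).
  by move=> h; rewrite ler_expR ler_wpM2r// lerN2.
apply: lerD.
  apply: le_trans H1 _; apply: ler_wpM2l; first by nneg.
  by apply: be; rewrite ge_min lexx.
apply: (@le_trans _ _ (r ^+ 2 * `|S * p1 + V * p0|)).
  by rewrite ler_wpM2r// ler_weXn2l// leq_subr.
apply: le_trans (H2 r p0 p1 t l r1 t1 hl) _; apply: ler_pM.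
- by nneg.
- exact: expR_ge0.
- by rewrite ler_wpM2l.
- by apply: be; rewrite ge_min lexx orbT.
Qed.

End high_frequency_difference.

(** * Solution operator of the Fourier-side equation *)

Section kernel.
Variables (R : realType) (tau delta : R).
Hypotheses (tau0 : 0 < tau) (delta0 : 0 < delta).

Local Notation b := (delta + tau).

(** Companion map of the ODE on (w, w', w''). Its iterates from (0, 0, 1) list the derivatives at t
    = 0 of the fundamental solution, which is then defined by its Taylor series: this works for
    every q, whether or not the characteristic roots are distinct. *)
Definition kernel_step (q : R) (v : R * R * R) : R * R * R :=
  (v.1.2, v.2, - (v.2 + b * q * v.1.2 + q * v.1.1) / tau).

Definition kernel_coef (q : R) (j : nat) : R :=
  (iter j (kernel_step q) (0, 0, 1)).1.1.

Lemma kernel_coef_iter q j : iter j (kernel_step q) (0, 0, 1) =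
  (kernel_coef q j, kernel_coef q j.+1, kernel_coef q j.+2).
Proof. by rewrite /kernel_coef /=; case: (iter _ _ _) => [[? ?] ?]. Qed.

Lemma kernel_coefS q j : tau * kernel_coef q j.+3 + kernel_coef q j.+2
  + b * q * kernel_coef q j.+1 + q * kernel_coef q j = 0.
Proof.
rewrite {1}/kernel_coef 3!iterS kernel_coef_iter /=.
by field; rewrite gt_eqF.
Qed.

(** A rate A with A >= 1 and tau A >= 1 + b Q + Q, which closes the induction bounding the j-th
    coefficient by A^j. *)
Definition kernel_rate (Q : R) := 1 + (1 + b * Q + Q) / tau.

Lemma kernel_rate_ge1 Q : 0 <= Q -> 1 <= kernel_rate Q.
Proof. by move=> Q0; rewrite /kernel_rate lerDl; nneg. Qed.

Lemma kernel_coef_le q Q j : 0 <= q -> q <= Q ->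
  `|kernel_coef q j| <= kernel_rate Q ^+ j.
Proof.
move=> q0 qQ; have Q0 := le_trans q0 qQ.
have A1 := kernel_rate_ge1 Q0; set A := kernel_rate Q in A1 *.
have A0 : 0 <= A by apply: le_trans A1.
suff : [/\ `|kernel_coef q j| <= A ^+ j, `|kernel_coef q j.+1| <= A ^+ j.+1 &
  `|kernel_coef q j.+2| <= A ^+ j.+2] by case.
elim: j => [|j [IH0 IH1 IH2]].
  rewrite /kernel_coef /= normr0 normr1; split => //.
  exact: exprn_ege1.
split => //.
have tn0 : tau != 0 by rewrite gt_eqF.
have -> : kernel_coef q j.+3 = - ((kernel_coef q j.+2
  + b * q * kernel_coef q j.+1 + q * kernel_coef q j) / tau).
  have h := kernel_coefS q j.
  have -> : kernel_coef q j.+3 = (tau * kernel_coef q j.+3 + kernel_coef q j.+2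
  + b * q * kernel_coef q j.+1 + q * kernel_coef q j) / tau - ((kernel_coef q j.+2
  + b * q * kernel_coef q j.+1 + q * kernel_coef q j) / tau) by field.
  by rewrite h mul0r sub0r.
rewrite normrN normrM normfV (gtr0_norm tau0) ler_pdivrMr//.
have AX n : 0 <= A ^+ n by exact: exprn_ge0.
have le1 : A ^+ j.+1 <= A ^+ j.+2 by apply: ler_weXn2l.
have le0 : A ^+ j <= A ^+ j.+2 by apply: ler_weXn2l => //; rewrite leqW.
have b0 : 0 <= b by nneg.
apply: (@le_trans _ _ (A ^+ j.+2 * (1 + b * Q + Q))).
  have h1 : `|b * q * kernel_coef q j.+1| <= b * Q * A ^+ j.+2.
    rewrite normrM ger0_norm; last by nneg.
    by apply: ler_pM; [nneg|nneg|rewrite ler_wpM2l|exact: le_trans le1].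
  have h0 : `|q * kernel_coef q j| <= Q * A ^+ j.+2.
    rewrite normrM (ger0_norm q0).
    by apply: ler_pM => //; exact: le_trans le0.
  apply: le_trans (ler_normD _ _) _; rewrite mulrDr (mulrC (A ^+ _) Q); apply: lerD => //.
  apply: le_trans (ler_normD _ _) _; rewrite mulrDr mulr1 (mulrC (A ^+ _)).
  by apply: lerD.
have -> : A ^+ j.+3 * tau = A ^+ j.+2 * (A * tau) by rewrite [RHS]mulrA -exprSr.
rewrite ler_wpM2l//.
have -> : A * tau = tau + (1 + b * Q + Q) by rewrite /A /kernel_rate; field.
by rewrite lerDr ltW.
Qed.

(** Shifting the coefficients by [i] differentiates the exponential-type series [i] times. *)
Definition kernel_taylor (q : R) (i j : nat) : R := kernel_coef q (j + i) / j`!%:R.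

Definition kernel (q : R) (i : nat) (t : R) : R := limn (pseries (kernel_taylor q i) t).

Lemma kernel_taylor_diffs q i :
  pseries_diffs (kernel_taylor q i) = kernel_taylor q i.+1.
Proof.
apply/funext => j; rewrite /pseries_diffs /kernel_taylor addSnnS factS natrM.
by rewrite invfM mulrCA mulVKf// pnatr_eq0.
Qed.

Lemma kernel_taylor_le q Q i (t : R) j : 0 <= q -> q <= Q ->
  `|kernel_taylor q i j * t ^+ j| <=
  (kernel_rate Q ^+ i *: exp_coeff (kernel_rate Q * `|t|)) j.
Proof.
move=> q0 qQ; rewrite /kernel_taylor !normrM normfV normrX.
rewrite (ger0_norm (ler0n _ _)).
have -> : (kernel_rate Q ^+ i *: exp_coeff (kernel_rate Q * `|t|)) j =
  kernel_rate Q ^+ (j + i) / j`!%:R * `|t| ^+ j.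
  transitivity (kernel_rate Q ^+ i * ((kernel_rate Q * `|t|) ^+ j / j`!%:R)) => //.
  by rewrite exprMn exprD; ring.
rewrite ler_wpM2r ?exprn_ge0// ler_wpM2r ?invr_ge0//.
exact: kernel_coef_le.
Qed.

Lemma is_cvg_kernel_bound (a x : R) : cvgn (series (a *: exp_coeff x)).
Proof. by apply: is_cvg_seriesZ; exact: is_cvg_series_exp_coeff. Qed.

Lemma is_cvg_norm_kernel q i t : 0 <= q ->
  cvgn [series `|kernel_taylor q i j * t ^+ j|]_j.
Proof.
move=> q0.
apply: (@series_le_cvg _ _ (kernel_rate q ^+ i *: exp_coeff (kernel_rate q * `|t|))).
- by move=> j; exact: normr_ge0.
- by move=> j; apply: le_trans (kernel_taylor_le i t j q0 (lexx q)); exact: normr_ge0.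
- by move=> j; exact: kernel_taylor_le.
- exact: is_cvg_kernel_bound.
Qed.

Lemma is_cvg_kernel q i t : 0 <= q -> cvgn (pseries (kernel_taylor q i) t).
Proof. by move=> q0; apply: normed_cvg; exact: is_cvg_norm_kernel. Qed.

Lemma derivf_kernel q i : 0 <= q -> derivf (kernel q i) (kernel q i.+1).
Proof.
move=> q0 t; rewrite /kernel -kernel_taylor_diffs.
apply: (@pseries_snd_diffs _ _ (`|t| + 1)); rewrite ?kernel_taylor_diffs;
  try exact: is_cvg_kernel.
by rewrite [ltRHS]ger0_norm ?ltrDl// addr_ge0.
Qed.

Lemma kernel_le q Q i t : 0 <= q -> q <= Q ->
  `|kernel q i t| <= kernel_rate Q ^+ i * expR (kernel_rate Q * `|t|).
Proof.
move=> q0 qQ.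
apply: (@le_trans _ _ (limn [series `|kernel_taylor q i j * t ^+ j|]_j)).
  by apply: lim_series_norm; exact: is_cvg_norm_kernel.
apply: (@le_trans _ _ (limn (series (kernel_rate Q ^+ i *: exp_coeff (kernel_rate Q * `|t|))))).
  apply: lim_series_le; [exact: is_cvg_norm_kernel|exact: is_cvg_kernel_bound|].
  by move=> j; exact: kernel_taylor_le.
by rewrite lim_seriesZ//; exact: is_cvg_series_exp_coeff.
Qed.

Lemma kernel0 q i : kernel q i 0 = kernel_coef q i.
Proof.
rewrite /kernel; apply: lim_near_cst => //; near=> m.
rewrite -[m]prednK; last by near: m; exists 1%N.
rewrite /pseries /series /= big_nat_recl//= big1 ?addr0.
  by rewrite /kernel_taylor add0n expr0 mulr1 divr1.
by move=> j _; rewrite exprS mul0r mulr0.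
Unshelve. all: by end_near. Qed.

Lemma kernel_ode q t : 0 <= q ->
  tau * kernel q 3 t + kernel q 2 t + b * q * kernel q 1 t + q * kernel q 0 t = 0.
Proof.
move=> q0; have cv i := @is_cvg_kernel q i t q0.
have c3 : tau * pseries (kernel_taylor q 3) t n @[n --> \oo] --> tau * kernel q 3 t.
  by apply: cvgMr; exact: cv.
have c1 : b * q * pseries (kernel_taylor q 1) t n @[n --> \oo] --> b * q * kernel q 1 t.
  by apply: cvgMr; exact: cv.
have c0 : q * pseries (kernel_taylor q 0) t n @[n --> \oo] --> q * kernel q 0 t.
  by apply: cvgMr; exact: cv.
have h := cvgD (cvgD (cvgD c3 (cv 2%N)) c1) c0.
rewrite -[LHS](cvg_lim (@Rhausdorff R) (h _ _ _)); apply: lim_near_cst => //; near=> n.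
change (tau * pseries (kernel_taylor q 3) t n + pseries (kernel_taylor q 2) t n
  + b * q * pseries (kernel_taylor q 1) t n + q * pseries (kernel_taylor q 0) t n = 0).
rewrite /pseries /series /= !mulr_sumr -!big_split /= big1// => j _.
rewrite /kernel_taylor !addn0 addn1 addn2 addn3.
set f := j`!%:R.
have -> : tau * (kernel_coef q j.+3 / f * t ^+ j) + kernel_coef q j.+2 / f * t ^+ j +
  b * q * (kernel_coef q j.+1 / f * t ^+ j) + q * (kernel_coef q j / f * t ^+ j) =
  (tau * kernel_coef q j.+3 + kernel_coef q j.+2 + b * q * kernel_coef q j.+1
   + q * kernel_coef q j) * (f^-1 * t ^+ j) by ring.
by rewrite kernel_coefS mul0r.
Unshelve. all: by end_near. Qed.

(* The solution of the ODE whose initial data form the j-th unit vector. *)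
Definition propagator (j : nat) (q : R) (l : nat) (t : R) : R :=
  match j with
  | 0 => kernel q l.+2 t + kernel q l.+1 t / tau + b * q / tau * kernel q l t
  | 1 => kernel q l.+1 t + kernel q l t / tau
  | _ => kernel q l t
  end.

Lemma derivf_propagator j q l : 0 <= q ->
  derivf (propagator j q l) (propagator j q l.+1).
Proof.
move=> q0; have d i := @derivf_kernel q i q0.
have d0 := d l; have d1 := d l.+1; have d2 := d l.+2; clear d.
by case: j => [|[|j]] /=; [derivf_auto; ring|derivf_auto; ring|].
Qed.

Lemma kernel_derive_ode q l t : 0 <= q -> (l <= 2)%N ->
  tau * kernel q l.+3 t + kernel q l.+2 t + b * q * kernel q l.+1 t + q * kernel q l t = 0.
Proof.
move=> q0 hl.
pose f l u := tau * kernel q l.+3 u + kernel q l.+2 u + b * q * kernel q l.+1 u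
  + q * kernel q l u.
have df i : derivf (f i) (f i.+1).
  have d j := @derivf_kernel q j q0.
  have d0 := d i; have d1 := d i.+1; have d2 := d i.+2; have d3 := d i.+3; clear d.
  by rewrite /f; derivf_auto; ring.
suff H i : f i =1 (fun=> 0) by exact: H.
elim: i => [|i IH] u; first exact: kernel_ode.
have h := df i u; rewrite -(@derive_val _ _ _ _ _ _ _ h).
have -> : f i = (fun=> 0) by apply/funext.
exact: derive_cst.
Qed.

(** With M the companion matrix, both S' = M S and S' = S M hold. This is the second form: an entry
    of row l is differentiated into entries of the same row. It is the form that makes the
    derivative of S(t - sg) u(sg) in sg vanish. *)
Lemma propagatorS q l t : 0 <= q -> (l <= 2)%N ->
  [/\ propagator 0 q l.+1 t = - (q / tau) * propagator 2 q l t,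
      propagator 1 q l.+1 t = propagator 0 q l t - b * q / tau * propagator 2 q l t &
      propagator 2 q l.+1 t = propagator 1 q l t - tau^-1 * propagator 2 q l t].
Proof.
move=> q0 hl; have h := kernel_derive_ode t q0 hl.
have tn0 : tau != 0 by rewrite gt_eqF.
split => /=; [|ring|ring].
apply/eqP; rewrite -subr_eq0; apply/eqP.
rewrite -[RHS](mul0r tau^-1) -h; field => //.
Qed.

Lemma propagator_init j q l : 0 <= q -> (j <= 2)%N -> (l <= 2)%N ->
  propagator j q l 0 = (j == l)%:R.
Proof.
move=> q0; have tn0 : tau != 0 by rewrite gt_eqF.
move: j l => [|[|[|//]]] [|[|[|//]]] _ _ /=; rewrite !kernel0 /kernel_coef /=;
  by field.
Qed.

Lemma propagator_mgt_ode j r : mgt_ode tau delta r (propagator j (r ^+ 2)).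
Proof.
have q0 : 0 <= r ^+ 2 by exact: sqr_ge0.
split => [i|t]; first exact: derivf_propagator.
have h0 := kernel_derive_ode t q0 (isT : (0 <= 2)%N).
have h1 := kernel_derive_ode t q0 (isT : (1 <= 2)%N).
have h2 := kernel_derive_ode t q0 (isT : (2 <= 2)%N).
case: j => [|[|j]] /=.
- transitivity ((tau * kernel (r ^+ 2) 5 t + kernel (r ^+ 2) 4 t
    + b * r ^+ 2 * kernel (r ^+ 2) 3 t + r ^+ 2 * kernel (r ^+ 2) 2 t)
    + (tau * kernel (r ^+ 2) 4 t + kernel (r ^+ 2) 3 t
    + b * r ^+ 2 * kernel (r ^+ 2) 2 t + r ^+ 2 * kernel (r ^+ 2) 1 t) / tau
    + b * r ^+ 2 / tau * (tau * kernel (r ^+ 2) 3 t + kernel (r ^+ 2) 2 t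
    + b * r ^+ 2 * kernel (r ^+ 2) 1 t + r ^+ 2 * kernel (r ^+ 2) 0 t)).
    by field; rewrite gt_eqF.
  by rewrite h0 h1 h2; ring.
- transitivity ((tau * kernel (r ^+ 2) 4 t + kernel (r ^+ 2) 3 t
    + b * r ^+ 2 * kernel (r ^+ 2) 2 t + r ^+ 2 * kernel (r ^+ 2) 1 t)
    + (tau * kernel (r ^+ 2) 3 t + kernel (r ^+ 2) 2 t
    + b * r ^+ 2 * kernel (r ^+ 2) 1 t + r ^+ 2 * kernel (r ^+ 2) 0 t) / tau).
    by field; rewrite gt_eqF.
  by rewrite h0 h1; ring.
- by rewrite -[RHS]h0; ring.
Qed.

(** The Taylor series gives uniformity in the frequency only on bounded sets, which is why solutions
    are represented ball by ball. *)
Lemma propagator_le Q T l : 0 <= Q -> 0 <= T -> exists2 B, 0 <= B &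
  forall j q t, 0 <= q -> q <= Q -> `|t| <= T -> `|propagator j q l t| <= B.
Proof.
move=> Q0 T0; have A1 := kernel_rate_ge1 Q0; set A := kernel_rate Q in A1 *.
have A0 : 0 <= A by apply: le_trans A1.
pose e := expR (A * T).
have b0 : 0 <= b by nneg.
have e0 : 0 <= e by exact: expR_ge0.
exists (A ^+ l.+2 * e + A ^+ l.+1 * e / tau + b * Q / tau * (A ^+ l * e)
  + (A ^+ l.+1 * e + A ^+ l * e / tau) + A ^+ l * e).
  by nneg.
move=> j q t q0 qQ tT.
have K i : `|kernel q i t| <= A ^+ i * e.
  apply: le_trans (kernel_le i t q0 qQ) _; rewrite -/A ler_wpM2l ?exprn_ge0//.
  by rewrite /e ler_expR ler_wpM2l.
have K' i : `|kernel q i t / tau| <= A ^+ i * e / tau.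
  by rewrite normrM normfV (gtr0_norm tau0) ler_wpM2r// invr_ge0 ltW.
have P i : 0 <= A ^+ i * e by nneg.
have P' i : 0 <= A ^+ i * e / tau by nneg.
have h : `|b * q / tau * kernel q l t| <= b * Q / tau * (A ^+ l * e).
  rewrite normrM ger0_norm; last by nneg.
  apply: ler_pM => //; first by nneg.
  by rewrite ler_wpM2r ?invr_ge0 ?(ltW tau0)// ler_wpM2l.
have P2 : 0 <= b * Q / tau * (A ^+ l * e) by apply: le_trans h.
case: j => [|[|j]] /=.
- apply: le_trans (ler_normD _ _) _; apply: le_trans (lerD (ler_normD _ _) (lexx _)) _.
  have := K l.+2; have := K' l.+1; have := P l.+1; have := P' l; have := P l; move: h.
  lra.
- apply: le_trans (ler_normD _ _) _.
  have := K l.+1; have := K' l; have := P l.+2; have := P' l.+1; have := P l; move: P2.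
  lra.
- have := K l; have := P l.+2; have := P' l.+1; have := P l.+1; have := P' l; move: P2.
  lra.
Qed.

End kernel.

(** * Measure and L^p norms on R^n *)

Section lebesgue_n.
Variable R : realType.

Lemma measurable_dotp d (T : measurableType d) n (f g : T -> Rn R n) :
  measurable_fun [set: T] f -> measurable_fun [set: T] g ->
  measurable_fun [set: T] (fun x => dotp (f x) (g x)).
Proof.
move=> mf mg; apply: measurable_sum => i; apply: measurable_funM.
- exact: (measurableT_comp (measurable_tnth i) mf).
- exact: (measurableT_comp (measurable_tnth i) mg).
Qed.

Lemma measurable_sqrt : measurable_fun [set: R] (@Num.sqrt R).
Proof. by apply: continuous_measurable_fun; exact: sqrt_continuous. Qed.

Lemma dotp_ge0 n (x : Rn R n) : 0 <= dotp x x.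
Proof. by apply: sumr_ge0 => i _; rewrite -expr2 sqr_ge0. Qed.

Lemma enorm_ge0 n (x : Rn R n) : 0 <= enorm x.
Proof. exact: sqrtr_ge0. Qed.

Lemma sqr_enorm n (x : Rn R n) : enorm x ^+ 2 = dotp x x.
Proof. by rewrite sqr_sqrtr// dotp_ge0. Qed.

Lemma measurable_enorm n : measurable_fun [set: Rn R n] (@enorm R n).
Proof.
apply: (measurableT_comp measurable_sqrt).
by apply: measurable_dotp; exact: measurable_id.
Qed.

Lemma dotp_cons n (x x' : R) (y y' : Rn R n) :
  dotp (Rn_cons (x, y)) (Rn_cons (x', y')) = x * x' + dotp y y'.
Proof.
rewrite /dotp big_ord_recl; congr (_ + _).
by apply: eq_bigr => i _; rewrite !tnthS.
Qed.

Lemma ge0_integral_leb_recl n (f : Rn R n.+1 -> \bar R) :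
  measurable_fun [set: Rn R n.+1] f -> (forall x, (0 <= f x)%E) ->
  (\int[leb R n.+1]_x f x =
   \int[lebesgue_measure]_x \int[leb R n]_y f (Rn_cons (x, y)))%E.
Proof.
move=> mf f0.
have h := ge0_integral_pushforward (@measurable_Rn_cons R n)
  (@lebesgue_measure R \x leb R n)%E measurableT mf (fun x _ => f0 x).
apply: etrans (etrans _ h) _.
  apply: eq_measure_integral => [|mf' A mA _]; last exact: erefl.
  exact: measurable_Rn_cons.
rewrite preimage_setT fubini_tonelli1//; last by move=> x; exact: f0.
by apply: measurableT_comp => //; exact: measurable_Rn_cons.
Qed.

(** The normal density of mean 0 and variance 1 / (2 a) has mass 1. *)
Lemma integral_gaussian (a : R) : 0 < a ->
  (\int[lebesgue_measure]_x (expR (- (a * (x * x))))%:E = (Num.sqrt (pi / a))%:E)%E.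
Proof.
move=> a0; pose s := Num.sqrt (a^-1 / 2).
have an : a != 0 by rewrite gt_eqF.
have ss : s ^+ 2 = a^-1 / 2 by rewrite sqr_sqrtr// divr_ge0// invr_ge0 ltW.
have sn : s != 0 by rewrite gt_eqF// sqrtr_gt0 divr_gt0// invr_gt0.
have pa : 0 < Num.sqrt (pi / a) by rewrite sqrtr_gt0 divr_gt0// pi_gt0.
have peak : normal_peak s = (Num.sqrt (pi / a))^-1.
  by rewrite /normal_peak ss; congr (Num.sqrt _)^-1; field.
have nf x : normal_fun 0 s x = expR (- (a * (x * x))).
  by rewrite /normal_fun ss subr0; congr expR; field.
have := integral_normal_pdf 0 s; rewrite normal_pdfE//.
under eq_integral do rewrite peak nf EFinM.
rewrite ge0_integralZl//=; last first.
  apply/measurable_EFinP; apply: measurableT_comp => //; apply: measurableT_comp => //.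
  by apply: measurable_funM => //; apply: measurable_funM.
move=> /(congr1 (fun z => (Num.sqrt (pi / a))%:E * z)%E).
by rewrite mule1 muleA -EFinM divff ?gt_eqF// mul1e.
Qed.

Lemma measurable_gaussian n (a : R) :
  measurable_fun [set: Rn R n] (fun x => (expR (- (a * dotp x x)))%:E).
Proof.
apply/measurable_EFinP; apply: measurableT_comp => //; apply: measurableT_comp => //.
by apply: measurable_funM => //; apply: measurable_dotp; exact: measurable_id.
Qed.

Lemma integral_gaussian_n n (a : R) : 0 < a ->
  (\int[leb R n]_x (expR (- (a * dotp x x)))%:E = (Num.sqrt (pi / a) ^+ n)%:E)%E.
Proof.
move=> a0; elim: n => [|n IH].
  rewrite [LHS]integral_dirac//; last exact: measurable_gaussian.
  by rewrite diracT mul1e /dotp big_ord0 mulr0 oppr0 expR0 expr0.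
rewrite ge0_integral_leb_recl; [|exact: measurable_gaussian|
  by move=> x; rewrite lee_fin expR_ge0].
under eq_integral => x _.
  under eq_integral do rewrite dotp_cons mulrDr opprD expRD EFinM.
  rewrite ge0_integralZl//=; [|exact: measurable_gaussian].
  rewrite IH muleC.
  over.
rewrite /= ge0_integralZl//=; last first.
  apply/measurable_EFinP; apply: measurableT_comp => //; apply: measurableT_comp => //.
  by apply: measurable_funM => //; apply: measurable_funM.
by rewrite integral_gaussian// -EFinM -exprSr.
Qed.

(** For n >= 1 the origin lies in the hyperplane where the first coordinate vanishes, a null set for
    the product measure. *)
Lemma leb_sphere0 n : (0 < n)%N -> leb R n [set x | enorm x = 0] = 0%E.
Proof.
case: n => [//|n] _.
apply/eqP; rewrite eq_le measure_ge0 andbT.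
have mA : measurable ([set 0%R] `*` [set: Rn R n] : set (measurableTypeR R * Rn R n)).
  by apply: measurableX.
have mB : measurable [set x : Rn R n.+1 | enorm x = 0].
  rewrite -[X in measurable X]setTI.
  exact: (measurable_enorm _ (measurable_set1 0)).
apply: (@le_trans _ _ ((lebesgue_measure \x leb R n)%E
    ([set 0%R] `*` [set: Rn R n] : set (measurableTypeR R * Rn R n)))).
  change ((lebesgue_measure \x leb R n)%E (@Rn_cons R n @^-1` [set x | enorm x = 0%R]) <=
    (lebesgue_measure \x leb R n)%E ([set 0%R] `*` [set: Rn R n]))%E.
  apply: le_measure; rewrite ?inE//.
    rewrite -[X in measurable X]setTI; apply: measurable_Rn_cons => //.
  move=> [x y] /= /(congr1 (fun z => z ^+ 2)); rewrite sqr_enorm dotp_cons expr0n/= => h.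
  split => //=; apply/eqP; rewrite -sqrf_eq0 expr2; apply/eqP.
  by have := dotp_ge0 y; have := sqr_ge0 x; rewrite expr2; lra.
by rewrite product_measure1E// [X in (X * _)%E](lebesgue_measure_set1 (0 : R)) mul0e.
Qed.

End lebesgue_n.

(** * Measurability and L^p norms of complex-valued functions *)

Section complex_functions.
Variables (R : realType) (n : nat).
Local Notation mu := (leb R n).
Implicit Types f g : Rn R n -> R[i].

Local Notation normc := Normc.normc.

Lemma normcE_sqrt (z : R[i]) : normc z = Num.sqrt (complex.Re z ^+ 2 + complex.Im z ^+ 2).
Proof. by case: z. Qed.

Lemma normc_ge0 (z : R[i]) : 0 <= normc z.
Proof. by rewrite normcE_sqrt sqrtr_ge0. Qed.

Lemma normc_le_add (x y : R[i]) : normc (x + y) <= normc x + normc y.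
Proof. exact: (le_normcD x y). Qed.

Lemma normc_opp (x : R[i]) : normc (- x) = normc x.
Proof. by case: x => a b /=; rewrite !sqrrN. Qed.

Lemma normc_le_sub (x y : R[i]) : normc (x - y) <= normc x + normc y.
Proof. by rewrite -(normc_opp y) normc_le_add. Qed.

Lemma normcZ (c : R) (z : R[i]) : normc (c%:C * z) = `|c| * normc z.
Proof. by rewrite Normc.normcM /= expr0n/= addr0 sqrtr_sqr. Qed.

Lemma normc_real (c : R) : normc c%:C = `|c|.
Proof. by rewrite /= expr0n/= addr0 sqrtr_sqr. Qed.

Lemma normc_eq0 (z : R[i]) : normc z = 0 -> z = 0.
Proof. exact: Normc.eq0_normc. Qed.

Lemma Re_le_normc (z : R[i]) : `|complex.Re z| <= normc z.
Proof. by rewrite normcE_sqrt -sqrtr_sqr ler_wsqrtr// lerDl sqr_ge0. Qed.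

Lemma Im_le_normc (z : R[i]) : `|complex.Im z| <= normc z.
Proof. by rewrite normcE_sqrt -sqrtr_sqr ler_wsqrtr// lerDr sqr_ge0. Qed.

Lemma normc_le_ReIm (z : R[i]) : normc z <= `|complex.Re z| + `|complex.Im z|.
Proof.
rewrite normcE_sqrt -[leRHS]ger0_norm ?addr_ge0// -sqrtr_sqr ler_wsqrtr//.
by rewrite sqrrD !real_normK ?num_real// lerD2r lerDl mulrn_wge0// mulr_ge0.
Qed.

Lemma cmeasurableD f g : cmeasurable f -> cmeasurable g ->
  cmeasurable (fun x => f x + g x).
Proof.
move=> [f1 f2] [g1 g2]; split.
- rewrite (_ : (fun x => _) = (fun x => complex.Re (f x) + complex.Re (g x))).
    exact: measurable_funD.
  by apply/funext => x; case: (f x) (g x) => [? ?] [? ?].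
- rewrite (_ : (fun x => _) = (fun x => complex.Im (f x) + complex.Im (g x))).
    exact: measurable_funD.
  by apply/funext => x; case: (f x) (g x) => [? ?] [? ?].
Qed.

Lemma cmeasurableN f : cmeasurable f -> cmeasurable (fun x => - f x).
Proof.
move=> [f1 f2]; split.
- rewrite (_ : (fun x => _) = (fun x => - complex.Re (f x))).
    exact: measurableT_comp.
  by apply/funext => x; case: (f x).
- rewrite (_ : (fun x => _) = (fun x => - complex.Im (f x))).
    exact: measurableT_comp.
  by apply/funext => x; case: (f x).
Qed.

Lemma cmeasurableB f g : cmeasurable f -> cmeasurable g ->
  cmeasurable (fun x => f x - g x).
Proof. by move=> mf mg; apply: cmeasurableD => //; exact: cmeasurableN. Qed.

Lemma cmeasurableM (m : Rn R n -> R) f : measurable_fun [set: Rn R n] m ->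
  cmeasurable f -> cmeasurable (fun x => (m x)%:C * f x).
Proof.
move=> mm [f1 f2]; split.
- rewrite (_ : (fun x => _) = (fun x => m x * complex.Re (f x))).
    exact: measurable_funM.
  by apply/funext => x; case: (f x) => ? ? /=; rewrite mul0r subr0.
- rewrite (_ : (fun x => _) = (fun x => m x * complex.Im (f x))).
    exact: measurable_funM.
  by apply/funext => x; case: (f x) => ? ? /=; rewrite mul0r addr0.
Qed.

Lemma cmeasurableZ (c : R) f : cmeasurable f -> cmeasurable (fun x => c%:C * f x).
Proof. by apply: cmeasurableM; exact: measurable_cst. Qed.

Lemma cmeasurable_real (m : Rn R n -> R) : measurable_fun [set: Rn R n] m ->
  cmeasurable (fun x => (m x)%:C).
Proof. by move=> mm; split => //=; exact: measurable_cst. Qed.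

Lemma measurable_indic_ball (M : R) :
  measurable_fun [set: Rn R n] (fun x => (enorm x <= M)%R%:R : R).
Proof.
rewrite (_ : (fun x => _) = (fun x => if enorm x <= M then 1 else 0)); last first.
  by apply/funext => x; case: ifP.
apply: measurable_fun_if => //.
by apply: measurable_fun_ler => //; exact: measurable_enorm.
Qed.

Lemma truncationE (m : nat) f x :
  truncation m f x = ((enorm x <= m%:R)%R%:R : R)%:C * f x.
Proof. by rewrite /truncation; case: ifP; rewrite ?mul1r ?mul0r. Qed.

Lemma cmeasurable_truncation (m : nat) f : cmeasurable f ->
  cmeasurable (truncation m f).
Proof.
move=> mf; rewrite (_ : truncation m f = fun x => ((enorm x <= m%:R)%R%:R : R)%:C * f x).
  by apply: cmeasurableM => //; exact: measurable_indic_ball.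
by apply/funext => x; exact: truncationE.
Qed.

Lemma measurable_normc f : cmeasurable f ->
  measurable_fun [set: Rn R n] (fun x => normc (f x)).
Proof.
move=> [f1 f2]; rewrite (_ : (fun x => _) =
   (fun x => Num.sqrt (complex.Re (f x) ^+ 2 + complex.Im (f x) ^+ 2))).
  apply: (measurableT_comp (@measurable_sqrt R)).
  by apply: measurable_funD; apply: measurable_funX.
by apply/funext => x; rewrite normcE_sqrt.
Qed.

Lemma cLnormE (p : R) f : p != 0 ->
  (cLnorm p f = (\int[mu]_x (normc (f x) `^ p)%:E) `^ p^-1)%E.
Proof.
move=> p0; rewrite /cLnorm Lnorm.unlock.
apply: (congr1 (fun x => (x `^ p^-1)%E)).
by apply: eq_integral => x _; rewrite abse_EFin ger0_norm ?normc_ge0// poweR_EFin.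
Qed.

Lemma measurable_powR_normc (p : R) f : cmeasurable f ->
  measurable_fun [set: Rn R n] (fun x => (normc (f x) `^ p)%:E).
Proof.
move=> mf; apply/measurable_EFinP.
by apply: (measurableT_comp (measurable_powR p)); exact: measurable_normc.
Qed.

Lemma cLnorm_ge0 (p : R) f : (0 <= cLnorm p f)%E.
Proof. exact: Lnorm_ge0. Qed.

Lemma cLnorm_le (p : R) f g : 0 < p -> cmeasurable f -> cmeasurable g ->
  {ae mu, forall x, normc (f x) <= normc (g x)} -> (cLnorm p f <= cLnorm p g)%E.
Proof.
move=> p0 mf mg fg; have pn := lt0r_neq0 p0; rewrite (cLnormE f pn) (cLnormE g pn).
have I0 h : (\int[mu]_x (normc (h x) `^ p)%:E)%E \in `[0%E, +oo%E].
  rewrite in_itv/= leey andbT.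
  by apply: integral_ge0 => x _; rewrite lee_fin powR_ge0.
apply: (gt0_ler_poweR _ (I0 f) (I0 g)); first by rewrite invr_ge0 ltW.
apply: ae_ge0_le_integral; rewrite ?measurableT//.
- by move=> x _; rewrite lee_fin powR_ge0.
- exact: measurable_powR_normc.
- by move=> x _; rewrite lee_fin powR_ge0.
- exact: measurable_powR_normc.
apply: filterS fg => x fgx _; rewrite lee_fin.
by apply: ge0_ler_powR; rewrite ?nnegrE ?normc_ge0// ltW.
Qed.

Lemma eq_cLnorm (p : R) f g : 0 < p -> cmeasurable f -> cmeasurable g ->
  {ae mu, forall x, f x = g x} -> cLnorm p f = cLnorm p g.
Proof.
move=> p0 mf mg fg; apply/eqP; rewrite eq_le; apply/andP; split;
  by apply: cLnorm_le => //; apply: filterS fg => x ->.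
Qed.

Lemma cLnorm_triangle (p : R) f g : 1 <= p -> cmeasurable f -> cmeasurable g ->
  (cLnorm p (fun x => f x + g x)%R <= cLnorm p f + cLnorm p g)%E.
Proof.
move=> p1 mf mg; have p0 : 0 < p by apply: lt_le_trans p1.
pose h x : R[i] := (normc (f x) + normc (g x))%:C.
have mnf := measurable_normc mf; have mng := measurable_normc mg.
apply: (@le_trans _ _ (cLnorm p h)).
  apply: cLnorm_le => //; first exact: cmeasurableD.
    by apply: cmeasurable_real; exact: measurable_funD.
  apply: aeW => x; rewrite normc_real ger0_norm ?addr_ge0 ?normc_ge0//.
  exact: normc_le_add.
apply: le_trans (_ : cLnorm p h <= _)%E (minkowski_EFin mu mnf mng p1).
rewrite /cLnorm; le_of_eq; apply: eq_Lnorm => x.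
by rewrite /h normc_real ger0_norm ?addr_ge0 ?normc_ge0.
Qed.

Lemma cLnorm_eq0 (p : R) f : 0 < p -> cmeasurable f -> cLnorm p f = 0%E ->
  {ae mu, forall x, f x = 0}.
Proof.
move=> p0 mf f0.
have mE : measurable_fun [set: Rn R n] (EFin \o (fun x => normc (f x))).
  by apply/measurable_EFinP; exact: measurable_normc.
have p0' : (0 < p%:E)%E by rewrite lte_fin.
have := Lnorm_eq0_eq0 mE p0' f0.
by apply: filterS => x /(_ I) /= [] /normc_eq0.
Qed.

Lemma cLnormZ (p c : R) f : 0 < p -> cmeasurable f ->
  (cLnorm p (fun x => c%:C * f x)%R = `|c|%:E * cLnorm p f)%E.
Proof.
move=> p0 mf; rewrite !cLnormE ?gt_eqF//.
under eq_integral do rewrite normcZ powRM ?normc_ge0// EFinM.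
rewrite ge0_integralZl//; last 2 first.
- exact: measurable_powR_normc.
- by move=> x _; rewrite lee_fin powR_ge0.
rewrite poweRM ?lee_fin ?powR_ge0//; last first.
  by apply: integral_ge0 => x _; rewrite lee_fin powR_ge0.
by rewrite poweR_EFin -powRrM divff ?gt_eqF// powRr1.
Qed.

End complex_functions.

(** * Fourier transform *)

Section fourier_facts.
Variables (R : realType) (n : nat).
Local Notation mu := (leb R n).
Implicit Types (f g h : Rn R n -> R[i]) (xi : Rn R n).

Local Notation normc := Normc.normc.

Lemma inLD (p : R) f g : 1 <= p -> inL p f -> inL p g ->
  inL p (fun x => f x + g x).
Proof.
move=> p1 [mf Lf] [mg Lg]; split; first exact: cmeasurableD.
by apply: le_lt_trans (cLnorm_triangle p1 mf mg) _; rewrite lte_add_pinfty.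
Qed.

Lemma inLZ (p c : R) f : 0 < p -> inL p f -> inL p (fun x => c%:C * f x).
Proof.
move=> p0 [mf Lf]; split; first exact: cmeasurableZ.
by rewrite cLnormZ// lte_mul_pinfty.
Qed.

Lemma inL_le (p : R) f g : 0 < p -> cmeasurable f -> inL p g ->
  (forall x, normc (f x) <= normc (g x)) -> inL p f.
Proof.
move=> p0 mf [mg Lg] fg; split => //; apply: le_lt_trans Lg.
by apply: cLnorm_le => //; exact: aeW.
Qed.

Lemma cLnorm1E f : (cLnorm 1 f = \int[mu]_x (normc (f x))%:E)%E.
Proof.
rewrite cLnormE ?oner_neq0// invr1 poweRe1; last first.
  by apply: integral_ge0 => x _; rewrite lee_fin powR_ge0.
by apply: eq_integral => x _; rewrite powRr1// normc_ge0.
Qed.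

Lemma measurable_EFin_normc f : cmeasurable f ->
  measurable_fun [set: Rn R n] (fun x => (normc (f x))%:E).
Proof. by move=> mf; apply/measurable_EFinP; exact: measurable_normc. Qed.

Lemma integrable_Re f : inL 1 f ->
  mu.-integrable [set: Rn R n] (EFin \o (fun x => complex.Re (f x))).
Proof.
move=> [mf Lf]; apply/integrableP; split; first by apply/measurable_EFinP; exact: mf.1.
apply: le_lt_trans Lf; rewrite cLnorm1E; apply: ge0_le_integral => //.
- by apply/measurableT_comp => //; apply/measurable_EFinP; exact: mf.1.
- exact: measurable_EFin_normc.
- by move=> x _; rewrite lee_fin Re_le_normc.
Qed.

Lemma integrable_Im f : inL 1 f ->
  mu.-integrable [set: Rn R n] (EFin \o (fun x => complex.Im (f x))).
Proof.
move=> [mf Lf]; apply/integrableP; split; first by apply/measurable_EFinP; exact: mf.2.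
apply: le_lt_trans Lf; rewrite cLnorm1E; apply: ge0_le_integral => //.
- by apply/measurableT_comp => //; apply/measurable_EFinP; exact: mf.2.
- exact: measurable_EFin_normc.
- by move=> x _; rewrite lee_fin Im_le_normc.
Qed.

Lemma cintegralD f g : inL 1 f -> inL 1 g ->
  cintegral (fun x => f x + g x) = cintegral f + cintegral g.
Proof.
move=> Lf Lg; rewrite /cintegral.
rewrite (_ : (fun x => complex.Re (f x + g x)) =
  (fun x => complex.Re (f x) + complex.Re (g x))); last first.
  by apply/funext => x; case: (f x) (g x) => [? ?] [? ?].
rewrite (_ : (fun x => complex.Im (f x + g x)) =
  (fun x => complex.Im (f x) + complex.Im (g x))); last first.
  by apply/funext => x; case: (f x) (g x) => [? ?] [? ?].
by rewrite !RintegralD//; [exact: integrable_Im|exact: integrable_Im|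
  exact: integrable_Re|exact: integrable_Re].
Qed.

Lemma cintegralZ (c : R) f : inL 1 f ->
  cintegral (fun x => c%:C * f x) = c%:C * cintegral f.
Proof.
move=> Lf; rewrite /cintegral.
rewrite (_ : (fun x => complex.Re (c%:C * f x)) = (fun x => c * complex.Re (f x))); last first.
  by apply/funext => x; case: (f x) => [? ?] /=; rewrite mul0r subr0.
rewrite (_ : (fun x => complex.Im (c%:C * f x)) = (fun x => c * complex.Im (f x))); last first.
  by apply/funext => x; case: (f x) => [? ?] /=; rewrite mul0r addr0.
rewrite !RintegralZl//; [|exact: integrable_Im|exact: integrable_Re].
by apply/eqP; rewrite eq_complex /= !mul0r subr0 addr0 !eqxx.
Qed.

Lemma cintegral_le f : inL 1 f ->
  normc (cintegral f) <= 2 * fine (cLnorm 1 f).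
Proof.
move=> Lf; apply: le_trans (normc_le_ReIm _) _.
have fin : (\int[mu]_x (normc (f x))%:E)%E \is a fin_num.
  rewrite ge0_fin_numE -?cLnorm1E; first by case: Lf.
  exact: cLnorm_ge0.
have I : mu.-integrable [set: Rn R n] (EFin \o (fun x => normc (f x))).
  apply/integrableP; split; first by apply: measurable_EFin_normc; case: Lf.
  rewrite -ge0_fin_numE; last exact: integral_ge0.
  by under eq_integral do rewrite /= ger0_norm ?normc_ge0//.
have -> : fine (cLnorm 1 f) = Rintegral mu setT (fun x => normc (f x)).
  by rewrite cLnorm1E.
rewrite mulr_natl mulr2n; apply: lerD.
- have IR := integrable_Re Lf.
  apply: le_trans (le_normr_Rintegral measurableT IR) _.
  by apply: le_Rintegral => //; [exact: integrable_norm IR|move=> x _; exact: Re_le_normc].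
- have IR := integrable_Im Lf.
  apply: le_trans (le_normr_Rintegral measurableT IR) _.
  by apply: le_Rintegral => //; [exact: integrable_norm IR|move=> x _; exact: Im_le_normc].
Qed.

Definition phase f xi x : R[i] := f x * (cos (dotp x xi) -i* sin (dotp x xi)).

Lemma normc_phase f xi x : normc (phase f xi x) = normc (f x).
Proof.
rewrite Normc.normcM [X in _ * X](_ : _ = 1) ?mulr1//=.
by rewrite sqrrN cos2Dsin2 sqrtr1.
Qed.

Lemma measurable_phase_joint f : cmeasurable f ->
  measurable_fun [set: Rn R n * Rn R n] (fun z => complex.Re (phase f z.1 z.2)) /\
  measurable_fun [set: Rn R n * Rn R n] (fun z => complex.Im (phase f z.1 z.2)).
Proof.
move=> [m1 m2].
have md : measurable_fun [set: Rn R n * Rn R n] (fun z => dotp z.2 z.1).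
  by apply: measurable_dotp; [exact: measurable_snd|exact: measurable_fst].
have mc : measurable_fun [set: Rn R n * Rn R n] (fun z => cos (dotp z.2 z.1)).
  apply: measurableT_comp md; apply: continuous_measurable_fun.
  exact: continuous_cos.
have ms : measurable_fun [set: Rn R n * Rn R n] (fun z => sin (dotp z.2 z.1)).
  apply: measurableT_comp md; apply: continuous_measurable_fun.
  exact: continuous_sin.
have mr : measurable_fun [set: Rn R n * Rn R n] (fun z => complex.Re (f z.2)).
  by apply: (measurableT_comp m1); exact: measurable_snd.
have mi : measurable_fun [set: Rn R n * Rn R n] (fun z => complex.Im (f z.2)).
  by apply: (measurableT_comp m2); exact: measurable_snd.
split.
- rewrite (_ : (fun z => _) = (fun z => complex.Re (f z.2) * cos (dotp z.2 z.1) +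
     complex.Im (f z.2) * sin (dotp z.2 z.1))).
    by apply: measurable_funD; apply: measurable_funM.
  apply/funext => z; rewrite /phase; case: (f _) => a b /=; ring.
- rewrite (_ : (fun z => _) = (fun z => complex.Im (f z.2) * cos (dotp z.2 z.1) -
     complex.Re (f z.2) * sin (dotp z.2 z.1))).
    by apply: measurable_funB; apply: measurable_funM.
  apply/funext => z; rewrite /phase; case: (f _) => a b /=; ring.
Qed.

Lemma cmeasurable_phase f xi : cmeasurable f -> cmeasurable (phase f xi).
Proof.
move=> /measurable_phase_joint[m1 m2].
have mp : measurable_fun [set: Rn R n] (fun x => (xi, x)).
  by apply: measurable_fun_pair; [exact: measurable_cst|exact: measurable_id].
by split; [exact: (measurableT_comp m1 mp)|exact: (measurableT_comp m2 mp)].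
Qed.

Lemma inL1_phase f xi : inL 1 f -> inL 1 (phase f xi).
Proof.
move=> Lf; apply: (@inL_le 1 _ f) => //; first by apply: cmeasurable_phase; case: Lf.
by move=> x; rewrite normc_phase.
Qed.

(** Tonelli's measurability applied to the positive and negative parts; sections whose integral is
    infinite receive the value 0 of [fine]. *)
Lemma measurable_Rintegral_param (F : Rn R n * Rn R n -> R) :
  measurable_fun [set: Rn R n * Rn R n] F ->
  measurable_fun [set: Rn R n] (fun xi => Rintegral mu setT (fun x => F (xi, x))).
Proof.
move=> mF; rewrite /Rintegral.
apply: (measurableT_comp (fine_measurable measurableT)).
rewrite (_ : (fun xi => _) = (fun xi => (\int[mu]_x ((EFin \o F)^\+ (xi, x)) -
   \int[mu]_x ((EFin \o F)^\- (xi, x)))%E)); last first.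
  apply/funext => xi; rewrite [LHS]integralE.
  by congr (_ - _)%E; apply: eq_integral => x _; rewrite ?funeposE ?funenegE.
have mE : measurable_fun [set: Rn R n * Rn R n] (EFin \o F) by exact/measurable_EFinP.
apply: emeasurable_funB.
- apply: (@measurable_fun_fubini_tonelli_F _ _ _ _ _ mu (EFin \o F)^\+%E).
    exact: measurable_funepos.
  by move=> z; exact: funepos_ge0.
- apply: (@measurable_fun_fubini_tonelli_F _ _ _ _ _ mu (EFin \o F)^\-%E).
    exact: measurable_funeneg.
  by move=> z; exact: funeneg_ge0.
Qed.

Lemma cmeasurable_fourier_integral f : cmeasurable f ->
  cmeasurable (fourier_integral f).
Proof.
move=> /measurable_phase_joint[m1 m2]; apply: cmeasurableZ.
by split; [exact: (measurable_Rintegral_param m1)|exact: (measurable_Rintegral_param m2)].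
Qed.

Lemma fourier_integralD f g xi : inL 1 f -> inL 1 g ->
  fourier_integral (fun x => f x + g x) xi =
  fourier_integral f xi + fourier_integral g xi.
Proof.
move=> Lf Lg; rewrite /fourier_integral -mulrDr; congr (_ * _).
rewrite -cintegralD; [|exact: inL1_phase|exact: inL1_phase].
by congr cintegral; apply/funext => x; rewrite mulrDl.
Qed.

Lemma fourier_integralZ (c : R) f xi : inL 1 f ->
  fourier_integral (fun x => c%:C * f x) xi = c%:C * fourier_integral f xi.
Proof.
move=> Lf; rewrite /fourier_integral mulrCA; congr (_ * _).
rewrite -cintegralZ; last exact: inL1_phase.
by congr cintegral; apply/funext => x; rewrite mulrA.
Qed.

Lemma fourier_integral_le f xi : inL 1 f ->
  normc (fourier_integral f xi) <=
  (2 * pi) `^ (- (n%:R / 2)) * (2 * fine (cLnorm 1 f)).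
Proof.
move=> Lf; rewrite /fourier_integral normcZ ger0_norm ?powR_ge0// ler_wpM2l ?powR_ge0//.
have := cintegral_le (inL1_phase xi Lf).
suff -> : cLnorm 1 (phase f xi) = cLnorm 1 f by [].
by rewrite !cLnorm1E; apply: eq_integral => x _; rewrite normc_phase.
Qed.

Lemma inL1_truncation (m : nat) f : inL 2 f -> inL 1 (truncation m f).
Proof.
move=> [mf Lf]; split; first exact: cmeasurable_truncation.
(* On the ball 1 <= exp (m^2 - |x|^2), so |f| <= 1 + |f|^2 is at most this Gaussian plus |f|^2. The
   Gaussian integral thus replaces the volume of the ball. *)
pose e (x : Rn R n) : R := expR (m%:R ^+ 2) * expR (- (1 * dotp x x)).
have me : measurable_fun [set: Rn R n] (fun x => (e x)%:E).
  apply/measurable_EFinP; apply: measurable_funM => //.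
  by apply/measurable_EFinP; exact: measurable_gaussian.
have mp := measurable_powR_normc 2 mf.
have L2 : (\int[mu]_x (normc (f x) `^ 2)%:E < +oo)%E.
  apply: (@lty_poweRy _ _ 2^-1); first by rewrite invr_eq0.
  by rewrite -cLnormE.
rewrite cLnorm1E; apply: (@le_lt_trans _ _
    (\int[mu]_x ((e x)%:E + (normc (f x) `^ 2)%:E))%E).
  apply: ge0_le_integral => //.
  - by move=> x _; rewrite lee_fin normc_ge0.
  - by apply: measurable_EFin_normc; exact: cmeasurable_truncation.
  - exact: emeasurable_funD.
  move=> x _; rewrite -EFinD lee_fin /truncation.
  have p0 := normc_ge0 (f x).
  have e0 : 0 <= e x by rewrite mulr_ge0 ?expR_ge0.
  rewrite powR_mulrn//; case: ifPn => h.
    have e1 : 1 <= e x.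
      rewrite /e -expRD -[leLHS]expR0 ler_expR mul1r subr_ge0 -sqr_enorm.
      by rewrite ler_pXn2r ?nnegrE ?enorm_ge0.
    have := sqr_ge0 (normc (f x) - 1); rewrite sqrrB1.
    move: (normc (f x)) p0 => y y0; nra.
  by rewrite Normc.normc0 addr_ge0// exprn_ge0.
rewrite ge0_integralD//; last 2 first.
- by move=> x _; rewrite lee_fin mulr_ge0 ?expR_ge0.
- by move=> x _; rewrite lee_fin powR_ge0.
rewrite lte_add_pinfty//.
rewrite /e; under eq_integral do rewrite EFinM.
rewrite ge0_integralZl//; last exact: measurable_gaussian.
by rewrite integral_gaussian_n// -EFinM ltry.
Qed.

End fourier_facts.

(** * Limits in mean: uniqueness, linearity, L^1 bound *)

Section fourier_transform.
Variables (R : realType) (n : nat).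
Local Notation mu := (leb R n).
Implicit Types (f g h : Rn R n -> R[i]) (xi : Rn R n).

Local Notation normc := Normc.normc.

Lemma cLnormN (p : R) f : cLnorm p (fun x => - f x) = cLnorm p f.
Proof. by apply: eq_Lnorm => x; rewrite normc_opp. Qed.

Lemma cLnorm_sub (p : R) f g : 1 <= p -> cmeasurable f -> cmeasurable g ->
  (cLnorm p (fun x => f x - g x)%R <= cLnorm p f + cLnorm p g)%E.
Proof.
move=> p1 mf mg; rewrite -(cLnormN p g); apply: cLnorm_triangle => //.
exact: cmeasurableN.
Qed.

Lemma cmeasurable_fourier_error f g (m : nat) : cmeasurable f -> cmeasurable g ->
  cmeasurable (fun xi => fourier_integral (truncation m f) xi - g xi).
Proof.
move=> mf mg; apply: cmeasurableB => //.
exact/cmeasurable_fourier_integral/cmeasurable_truncation.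
Qed.

Lemma cvge0_add (u v : nat -> \bar R) : u @ \oo --> 0%E -> v @ \oo --> 0%E ->
  (fun m => u m + v m)%E @ \oo --> 0%E.
Proof. by move=> u0 v0; rewrite -[X in _ --> X]adde0; exact: cvgeD. Qed.

Lemma le_cvge0 (c : \bar R) (u : nat -> \bar R) :
  (forall m, (c <= u m)%E) -> u @ \oo --> 0%E -> (c <= 0)%E.
Proof. by move=> cu; apply: cvge_ge; exact: nearW. Qed.

Lemma fourier_unique f g h : is_fourier f g -> is_fourier f h ->
  {ae mu, forall xi, g xi = h xi}.
Proof.
move=> [[mf _] [mg _] cg] [_ [mh _] ch].
suff : cLnorm 2 (fun xi => h xi - g xi) = 0%E.
  move=> /(cLnorm_eq0 (ltr0n _ 2) (cmeasurableB mh mg)).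
  by apply: filterS => xi /eqP; rewrite subr_eq0 eq_sym => /eqP.
apply/eqP; rewrite eq_le cLnorm_ge0 andbT.
apply: le_cvge0 (cvge0_add cg ch) => m.
have mg' := cmeasurable_fourier_error m mf mg.
have mh' := cmeasurable_fourier_error m mf mh.
apply: le_trans (cLnorm_sub _ mg' mh'); last by rewrite ler1n.
le_of_eq; apply: eq_Lnorm => xi.
by congr (normc _)%:E; ring.
Qed.

Lemma is_fourier_lin f f' g g' (c : R) : is_fourier f g -> is_fourier f' g' ->
  is_fourier (fun x => f x + c%:C * f' x) (fun xi => g xi + c%:C * g' xi).
Proof.
move=> [Lf Lg cg] [Lf' Lg' cg'].
have l12 : 1 <= 2 :> R by rewrite ler1n.
split; [by apply: inLD => //; exact: inLZ|by apply: inLD => //; exact: inLZ|].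
have mg := cmeasurable_fourier_error _ Lf.1 Lg.1.
have mg' := cmeasurable_fourier_error _ Lf'.1 Lg'.1.
have cg'' : (`|c|%:E * cLnorm 2 (fun xi => fourier_integral (truncation m f') xi - g' xi)%R)%E
    @[m --> \oo] --> 0%E.
  rewrite -[X in _ --> X](mule0 `|c|%:E); apply: cvgeM => //.
  exact: cvg_cst.
apply: squeeze_cvge (@cvg_cst _ _ _ _ _) (cvge0_add cg cg'').
apply: nearW => m; rewrite cLnorm_ge0/= -cLnormZ//.
apply: le_trans (cLnorm_triangle l12 (mg m) (cmeasurableZ c (mg' m))).
le_of_eq; apply: eq_Lnorm => xi.
congr (normc _)%:E.
have -> : truncation m (fun x => f x + c%:C * f' x) =
  (fun x => truncation m f x + c%:C * truncation m f' x).
  by apply/funext => x; rewrite /truncation; case: ifP => //; rewrite mulr0 addr0.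
rewrite fourier_integralD ?fourier_integralZ; try exact: inL1_truncation.
  by ring.
by apply: inLZ => //; exact: inL1_truncation.
Qed.

Lemma is_fourier_ae f f' g : is_fourier f g -> inL 2 f' ->
  {ae mu, forall x, f x = f' x} -> is_fourier f' g.
Proof.
move=> [Lf Lg cg] Lf' ff'; split => //.
suff E m xi : fourier_integral (truncation m f') xi = fourier_integral (truncation m f) xi.
  apply: cvg_trans cg; apply: near_eq_cvg; apply: nearW => m.
  by apply: eq_Lnorm => xi; rewrite E.
have m1 := cmeasurable_phase xi (cmeasurable_truncation m Lf.1).
have m2 := cmeasurable_phase xi (cmeasurable_truncation m Lf'.1).
rewrite /fourier_integral; congr (_ * _); rewrite /cintegral /Rintegral.
by congr (fine _ +i* fine _); apply: ae_eq_integral => //;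
  try (by apply/measurable_EFinP; (exact: m1.1 || exact: m2.1 || exact: m1.2 || exact: m2.2));
  apply: filterS ff' => x xE _; rewrite /truncation xE.
Qed.

Lemma fourierP f g : is_fourier f g ->
  is_fourier f (fourier f) /\ {ae mu, forall xi, fourier f xi = g xi}.
Proof.
move=> fg; have ff : is_fourier f (fourier f) by rewrite /fourier; apply: (@xgetPex _ _ [set g | is_fourier f g]); exists g.
by split => //; exact: fourier_unique fg.
Qed.

(* The factor 2 comes from bounding real and imaginary parts separately. *)
Lemma fourier_L1_bound f g : is_fourier f g -> inL 1 f ->
  {ae mu, forall xi, normc (g xi) <=
    (2 * pi) `^ (- (n%:R / 2)) * (2 * fine (cLnorm 1 f))}.
Proof.
move=> [Lf Lg cg] L1.
set B := _ * _.
(* Excess of |g| above the bound. The transforms of the truncations stay below [B], so [d] is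
   dominated by their distance to g, whose L^2 norm tends to 0; hence [d] vanishes almost
   everywhere. *)
pose d xi : R := Num.max (normc (g xi) - B) 0.
have md : measurable_fun [set: Rn R n] d.
  apply: measurable_maxr => //; apply: measurable_funB => //.
  by apply: measurable_normc; exact: Lg.1.
have tB m xi : normc (fourier_integral (truncation m f) xi) <= B.
  apply: le_trans (fourier_integral_le xi (inL1_truncation m Lf)) _.
  rewrite /B ler_wpM2l ?powR_ge0// ler_pM2l//.
  have mt := cmeasurable_truncation m Lf.1.
  have h : (cLnorm 1 (truncation m f) <= cLnorm 1 f)%E.
    apply: cLnorm_le => //; first exact: L1.1.
    apply: aeW => x; rewrite /truncation; case: ifP => // _.
    by rewrite Normc.normc0 normc_ge0.
  apply: fine_le => //; rewrite ge0_fin_numE ?cLnorm_ge0//; last by case: L1.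
  by apply: le_lt_trans h _; case: L1.
have d0 : cLnorm 2 (fun xi => (d xi)%:C) = 0%E.
  apply/eqP; rewrite eq_le cLnorm_ge0 andbT.
  apply: le_cvge0 cg => m; apply: cLnorm_le => //.
    exact: (cmeasurable_fourier_error m Lf.1 Lg.1).
  apply: aeW => xi; rewrite normc_real ger0_norm ?le_max ?lexx ?orbT//.
  rewrite ge_max normc_ge0 andbT.
  have : normc (g xi) <= normc (fourier_integral (truncation m f) xi) +
      normc (fourier_integral (truncation m f) xi - g xi).
    by apply: le_trans (normc_le_sub _ _); rewrite subKr.
  by have := tB m xi; lra.
have := cLnorm_eq0 (ltr0n R 2) (cmeasurable_real md) d0.
apply: filterS => xi /(congr1 (@complex.Re R)) /= dx.
have : normc (g xi) - B <= d xi by rewrite le_max lexx.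
by rewrite dx subr_le0.
Qed.

End fourier_transform.

(** * Representation of strong solutions *)

Section flat_functions.
Variable R : realType.

(** Mean value theorem. The hypotheses have the epsilon form in which the L^2 estimates deliver
    continuity up to the endpoints and a zero derivative inside. *)
Lemma flat_cst (g : R -> R) (a b : R) : a < b ->
  (forall x e, a <= x <= b -> 0 < e -> exists2 d, 0 < d &
     forall y, a <= y <= b -> `|y - x| < d -> `|g y - g x| <= e) ->
  (forall x e, a < x < b -> 0 < e -> exists2 d, 0 < d &
     forall h, h != 0 -> `|h| < d -> `|g (x + h) - g x| <= e * `|h|) ->
  g b = g a.
Proof.
move=> ab cont flat.
have dg x : x \in `]a, b[ -> is_derive x 1 g 0.
  rewrite in_itv/= => xab.
  have c0 : (fun h => h^-1 *: ((g \o shift x) (h *: (1 : R)) - g x)) @ 0^' --> (0 : R).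
    apply/cvgrPdist_le => e e0.
    have [d d0 H] := flat x e xab e0.
    near=> h.
    have h0 : h != 0 by near: h; exact: nbhs_dnbhs_neq.
    rewrite sub0r normrN normrZ normfV ler_pdivrMl ?normr_gt0// mulrC.
    rewrite /= [h *: _]mulr1 (addrC h); apply: H => //.
    near: h; apply: dnbhs0_lt => //.
  split; first by apply/cvg_ex; exists 0.
  by rewrite /derive; exact: cvg_lim.
suff cg : {within `[a, b], continuous g}.
  have [c _] := @MVT _ g (fun=> 0) a b ab dg cg.
  by rewrite mul0r => /eqP; rewrite subr_eq0 => /eqP.
apply/continuous_within_itvP => //; split.
- move=> x /dg dx; apply/differentiable_continuous/derivable1_diffP.
  exact: (@ex_derive _ _ _ _ _ _ _ dx).
- apply/cvgrPdist_le => e e0.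
  have [|d d0 H] := cont a e _ e0; first by rewrite lexx ltW.
  near=> y; rewrite distrC; apply: H.
    apply/andP; split; first by near: y; exact: nbhs_right_ge.
    by near: y; exact: nbhs_right_ltW.
  rewrite ger0_norm; last by rewrite subr_ge0; near: y; exact: nbhs_right_ge.
  by near: y; exact: nbhs_right_ltDr.
- apply/cvgrPdist_le => e e0.
  have [|d d0 H] := cont b e _ e0; first by rewrite lexx andbT ltW.
  near=> y; rewrite distrC; apply: H.
    apply/andP; split; last by near: y; exact: nbhs_left_le.
    by near: y; exact: nbhs_left_ge.
  rewrite distrC ger0_norm; last by rewrite subr_ge0; near: y; exact: nbhs_left_le.
  by near: y; exact: nbhs_left_ltBl.
Unshelve. all: by end_near. Qed.

Lemma derivf_lipschitz (f f' : R -> R) (T B x y : R) : derivf f f' ->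
  (forall z, `|z| <= T -> `|f' z| <= B) -> `|x| <= T -> `|y| <= T ->
  `|f x - f y| <= B * `|x - y|.
Proof.
move=> df HB; wlog yx : x y / y <= x.
  move=> W xT yT; have [h|h] := leP y x; first exact: W.
  by rewrite distrC (distrC x); apply: W => //; exact: ltW.
move=> xT yT.
have cf : {within `[y, x], continuous f}.
  by apply: continuous_subspaceT; exact: derivf_continuous df.
have [z zin ->] := MVT_segment yx (fun z _ => df z) cf.
rewrite normrM ler_wpM2r// HB//.
move: zin; rewrite in_itv/= => /andP[yz zx].
move: xT yT; rewrite !ler_norml => /andP[_ x2] /andP[y1 _].
by rewrite (le_trans y1 yz) (le_trans zx x2).
Qed.

(** Mean value theorem for f(y) - f'(x) y, then the Lipschitz bound for f'. The increment is - h
    because the propagator is taken at t - sg while sg moves by h. *)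
Lemma derivf_taylor (f f' f'' : R -> R) (T B x h : R) : derivf f f' -> derivf f' f'' ->
  (forall z, `|z| <= T -> `|f'' z| <= B) -> `|x| <= T -> `|x - h| <= T ->
  `|f (x - h) - f x + h * f' x| <= B * `|h| ^+ 2.
Proof.
move=> df df' HB xT xhT.
have dG : derivf (fun y => f y - f' x * y) (fun y => f' y - f' x).
  by derivf_auto; ring.
pose T' := `|h|.
have e : f (x - h) - f x + h * f' x =
   (f (x - h) - f' x * (x - h)) - (f x - f' x * x) by ring.
wlog h0 : / 0 <= B.
  move=> W; apply: W; apply: le_trans (HB x xT); exact: normr_ge0.
have key z : `|z - x| <= `|h| -> `|z| <= T -> `|f' z - f' x| <= B * `|h|.
  move=> zx zT; apply: le_trans (derivf_lipschitz df' HB zT xT) _.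
  by rewrite ler_wpM2l.
rewrite e.
have cG : forall u v, {within `[u, v], continuous (fun y => f y - f' x * y)}.
  by move=> u v; apply: continuous_subspaceT; exact: derivf_continuous dG.
have [hx|hx] := leP (x - h) x.
  have [z zin] := MVT_segment hx (fun z _ => dG z) (cG _ _).
  rewrite distrC => ->; rewrite normrM subKr expr2 mulrA ler_wpM2r// key//.
    move: zin; rewrite in_itv/= => /andP[z1 z2].
    rewrite distrC ger0_norm ?subr_ge0// [leRHS]ger0_norm; last by move: hx; lra.
    by move: z1; lra.
  move: zin; rewrite in_itv/= => /andP[z1 z2].
  move: xT xhT; rewrite !ler_norml => /andP[_ a2] /andP[a1 _].
  by rewrite (le_trans a1 z1) (le_trans z2 a2).
have [z zin] := MVT_segment (ltW hx) (fun z _ => dG z) (cG _ _).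
move=> ->; rewrite normrM addrAC subrr sub0r normrN expr2 mulrA ler_wpM2r// key//.
  move: zin; rewrite in_itv/= => /andP[z1 z2].
  rewrite ger0_norm ?subr_ge0// -[leRHS]normrN [leRHS]ger0_norm; last by move: hx; lra.
  by move: z2; lra.
move: zin; rewrite in_itv/= => /andP[z1 z2].
move: xT xhT; rewrite !ler_norml => /andP[a1 _] /andP[_ a2].
by rewrite (le_trans a1 z1) (le_trans z2 a2).
Qed.

End flat_functions.

(** * L^2 norm on a ball of frequencies *)

Section cutoff_seminorm.
Variables (R : realType) (n m : nat).
Local Notation mu := (leb R n).
Implicit Types (f g : Rn R n -> R[i]).

Local Notation normc := Normc.normc.

Definition inLcut f := inL 2 (truncation m f).

(** Real-valued, so that epsilon-delta arguments stay in [R]; because of [fine] it is meaningful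
    only under [inLcut]. *)
Definition cutnorm f : R := fine (cLnorm 2 (truncation m f)).

Lemma cutnorm_ge0 f : 0 <= cutnorm f.
Proof. by rewrite fine_ge0// cLnorm_ge0. Qed.

Lemma cutnormE f : inLcut f -> (cutnorm f)%:E = cLnorm 2 (truncation m f).
Proof. by move=> [_ Lf]; rewrite fineK// ge0_fin_numE// cLnorm_ge0. Qed.

Lemma inLcut_inL f : inL 2 f -> inLcut f.
Proof.
move=> [mf Lf]; apply: (@inL_le _ _ _ _ f) => //; first exact: cmeasurable_truncation.
by move=> x; rewrite /truncation; case: ifP => // _; rewrite Normc.normc0 normc_ge0.
Qed.

Lemma truncationD f g :
  truncation m (fun x => f x + g x) = (fun x => truncation m f x + truncation m g x).
Proof. by apply/funext => x; rewrite /truncation; case: ifP; rewrite ?addr0. Qed.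

Lemma inLcutD f g : inLcut f -> inLcut g -> inLcut (fun x => f x + g x).
Proof. by move=> Lf Lg; rewrite /inLcut truncationD; apply: inLD; rewrite ?ler1n. Qed.

Lemma cutnormD f g : inLcut f -> inLcut g ->
  cutnorm (fun x => f x + g x) <= cutnorm f + cutnorm g.
Proof.
move=> Lf Lg; rewrite -lee_fin EFinD !cutnormE//; last exact: inLcutD.
rewrite truncationD; apply: cLnorm_triangle; rewrite ?ler1n//; [exact: Lf.1|exact: Lg.1].
Qed.

Lemma inLcutM (p : Rn R n -> R) (B : R) f :
  measurable_fun [set: Rn R n] p -> 0 <= B ->
  (forall x, enorm x <= m%:R -> `|p x| <= B) -> inLcut f ->
  inLcut (fun x => (p x)%:C * f x) /\ cutnorm (fun x => (p x)%:C * f x) <= B * cutnorm f.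
Proof.
move=> mp B0 pB Lf.
have tE : truncation m (fun x => (p x)%:C * f x) = (fun x => (p x)%:C * truncation m f x).
  by apply/funext => x; rewrite /truncation; case: ifP; rewrite ?mulr0.
have mpf : cmeasurable (fun x => (p x)%:C * truncation m f x).
  by apply: cmeasurableM => //; exact: Lf.1.
have le x : normc ((p x)%:C * truncation m f x) <= normc (B%:C * truncation m f x).
  rewrite !normcZ (ger0_norm B0); have [h|h] := boolP (enorm x <= m%:R).
    by rewrite ler_wpM2r ?normc_ge0// pB.
  by rewrite /truncation (negbTE h) Normc.normc0 !mulr0.
have LB : inL 2 (fun x => B%:C * truncation m f x) by apply: inLZ.
have L' : inLcut (fun x => (p x)%:C * f x).
  by rewrite /inLcut tE; apply: inL_le LB le.
split => //; rewrite -lee_fin EFinM !cutnormE// tE.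
rewrite -[X in (X%:E * _)%E]ger0_norm// -cLnormZ//; last exact: Lf.1.
by apply: cLnorm_le => //; [exact: LB.1|exact: aeW].
Qed.

Lemma inLcutZ (c : R) f : inLcut f -> inLcut (fun x => c%:C * f x) /\ cutnorm (fun x => c%:C * f x) = `|c| * cutnorm f.
Proof.
move=> Lf.
have tE : truncation m (fun x => c%:C * f x) = (fun x => c%:C * truncation m f x).
  by apply/funext => x; rewrite /truncation; case: ifP; rewrite ?mulr0.
have L' : inLcut (fun x => c%:C * f x) by rewrite /inLcut tE; apply: inLZ.
split => //; apply: EFin_inj; rewrite EFinM !cutnormE// tE cLnormZ//; exact: Lf.1.
Qed.

Lemma cutnorm_eq0 f : inLcut f -> cutnorm f = 0 ->
  {ae mu, forall x, enorm x <= m%:R -> f x = 0}.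
Proof.
move=> Lf f0; have := cLnorm_eq0 (ltr0n R 2) Lf.1.
rewrite -cutnormE// f0 => /(_ erefl).
by apply: filterS => x; rewrite /truncation => + xm; rewrite xm.
Qed.

End cutoff_seminorm.

Section measurable_propagator.
Variables (R : realType) (n : nat) (tau delta : R).

Lemma measurable_kernel_coef j :
  measurable_fun [set: Rn R n] (fun x => kernel_coef tau delta (enorm x ^+ 2) j).
Proof.
have mq : measurable_fun [set: Rn R n] (fun x => enorm x ^+ 2).
  by apply: measurable_funX; exact: measurable_enorm.
pose v (x : Rn R n) i := iter i (kernel_step tau delta (enorm x ^+ 2)) (0, 0, 1).
suff : [/\ measurable_fun [set: Rn R n] (fun x => (v x j).1.1),
    measurable_fun [set: Rn R n] (fun x => (v x j).1.2) &
    measurable_fun [set: Rn R n] (fun x => (v x j).2)] by case.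
elim: j => [|j [m1 m2 m3]]; first by split; exact: measurable_cst.
split => //=.
apply: measurable_funM; last exact: measurable_cst.
apply: measurableT_comp => //; apply: measurable_funD; last exact: measurable_funM.
apply: measurable_funD => //; apply: measurable_funM => //.
by apply: measurable_funM => //; exact: measurable_cst.
Qed.

Lemma measurable_kernel i t : 0 < tau -> 0 < delta ->
  measurable_fun [set: Rn R n] (fun x => kernel tau delta (enorm x ^+ 2) i t).
Proof.
move=> t0 d0; apply: (@measurable_fun_cvg _ _ _ _
  (fun N x => pseries (kernel_taylor tau delta (enorm x ^+ 2) i) t N)).
  move=> N; rewrite /pseries /series /=.
  apply: measurable_sum => j; apply: measurable_funM; last exact: measurable_cst.
  apply: measurable_funM; last exact: measurable_cst.
  exact: measurable_kernel_coef.
by move=> x _; apply: is_cvg_kernel => //; exact: sqr_ge0.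
Qed.

Lemma measurable_propagator j l t : 0 < tau -> 0 < delta ->
  measurable_fun [set: Rn R n] (fun x => propagator tau delta j (enorm x ^+ 2) l t).
Proof.
move=> t0 d0; have mk i := @measurable_kernel i t t0 d0.
have mq : measurable_fun [set: Rn R n] (fun x => enorm x ^+ 2).
  by apply: measurable_funX; exact: measurable_enorm.
case: j => [|[|j]] /=; last exact: mk.
- apply: measurable_funD; last first.
    apply: measurable_funM => //; apply: measurable_funM; last exact: measurable_cst.
    by apply: measurable_funM => //; exact: measurable_cst.
  apply: measurable_funD => //; apply: measurable_funM => //; exact: measurable_cst.
- by apply: measurable_funD => //; apply: measurable_funM => //; exact: measurable_cst.
Qed.

End measurable_propagator.

(** * Time regularity of the Fourier transforms of a strong solution *)

Section solution_representation.
Variables (R : realType) (n : nat).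
Local Notation mu := (leb R n).
Implicit Types (f g : Rn R n -> R[i]).

Local Notation normc := Normc.normc.

Lemma rescale_increment (K : comPzRingType) (T Ti H h x y z : K) :
  T * Ti = 1 -> H * h = 1 ->
  T * (H * (x - y)) + z = T * H * (x - y - h * (- Ti * z)).
Proof.
move=> tt hh; have -> : T * H * (x - y - h * (- Ti * z)) =
  T * (H * (x - y)) + (T * Ti) * (H * h) * z by ring.
by rewrite tt hh !mul1r.
Qed.

Lemma is_fourierZ f g (c : R) : is_fourier f g ->
  is_fourier (fun x => c%:C * f x) (fun xi => c%:C * g xi).
Proof.
move=> fg; have := is_fourier_lin (c - 1) fg fg.
by congr is_fourier; apply/funext => x; ring.
Qed.

Lemma is_fourierB f f' g g' : is_fourier f g -> is_fourier f' g' ->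
  is_fourier (fun x => f x - f' x) (fun xi => g xi - g' xi).
Proof.
move=> fg fg'; have := is_fourier_lin (-1) fg fg'.
by congr is_fourier; apply/funext => x; ring.
Qed.

Lemma measurable_japanese : measurable_fun [set: Rn R n] (@japanese R n).
Proof.
apply: (measurableT_comp (@measurable_sqrt R)); apply: measurable_funD => //.
by apply: measurable_funX; exact: measurable_enorm.
Qed.

Lemma japanese_ge1 (xi : Rn R n) : 1 <= japanese xi.
Proof. by rewrite /japanese -[leLHS]sqrtr1 ler_wsqrtr// lerDl sqr_ge0. Qed.

Lemma cmeasurable_weight (r : R) g : cmeasurable g ->
  cmeasurable (fun xi => (japanese xi `^ r)%:C * g xi).
Proof.
apply: cmeasurableM.
by apply: (measurableT_comp (measurable_powR r)); exact: measurable_japanese.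
Qed.

Lemma Hnorm_fourier (r : R) f g : is_fourier f g -> Hnorm r f = Hhatnorm r g.
Proof.
move=> fg; have [ff fE] := fourierP fg.
apply: eq_cLnorm => //.
- by apply: cmeasurable_weight; case: ff => _ [].
- by apply: cmeasurable_weight; case: fg => _ [].
- by apply: filterS fE => xi ->.
Qed.

(** On the ball, the weight with any exponent r >= -1 is at least (1 + m^2)^(-1/2). The exponent -1
    occurs for s = 0, in the space H^(s-1) of the equation. *)
Lemma cutoff_le_Hhatnorm (m : nat) (r : R) g : -1 <= r -> cmeasurable g ->
  (cLnorm 2 (truncation m g) <=
   (Num.sqrt (1 + m%:R ^+ 2))%:E * Hhatnorm r g)%E.
Proof.
move=> r1 mg; set A := Num.sqrt _.
have A0 : 0 <= A by exact: sqrtr_ge0.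
rewrite -[X in (X%:E * _)%E]ger0_norm// -cLnormZ//; last exact: cmeasurable_weight.
apply: cLnorm_le => //; first exact: cmeasurable_truncation.
  by apply: cmeasurableZ; exact: cmeasurable_weight.
apply: aeW => xi; rewrite /truncation; case: ifPn => h; last first.
  by rewrite Normc.normc0 normc_ge0.
rewrite !normcZ mulrA ler_peMl ?normc_ge0// (ger0_norm A0) ger0_norm ?powR_ge0//.
have j1 := japanese_ge1 xi.
have j0 : 0 < japanese xi by apply: lt_le_trans j1.
have jA : japanese xi <= A.
  rewrite /A /japanese ler_wsqrtr// lerD2l ler_pXn2r ?nnegrE ?enorm_ge0//.
apply: (@le_trans _ _ (japanese xi * japanese xi `^ (-1))).
  by rewrite powR_inv1 ?(ltW j0)// divff// gt_eqF.
by apply: ler_pM => //; rewrite ?powR_ge0 ?(ltW j0)// ler_powR.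
Qed.

Lemma cvge0_near (F : set_system R) (FF : Filter F) (Phi : R -> \bar R) (e : R) :
  0 < e -> (forall h, (0 <= Phi h)%E) -> Phi h @[h --> F] --> 0%E ->
  \forall h \near F, (Phi h <= e%:E)%E.
Proof.
move=> e0 P0 /fine_cvgP[Pfin /cvgrPdist_le /(_ e e0) Ple].
near=> h.
have hf : Phi h \is a fin_num by near: h.
rewrite -(fineK hf) lee_fin -[leLHS]ger0_norm ?fine_ge0//.
by rewrite -normrN -sub0r; near: h.
Unshelve. all: by end_near. Qed.

Lemma cvge0_within (D : set R) (Phi : R -> \bar R) (e : R) :
  0 < e -> (forall h, (0 <= Phi h)%E) ->
  Phi h @[h --> within D (nbhs (0 : R))] --> 0%E ->
  exists2 d, 0 < d & forall h, `|h| < d -> D h -> (Phi h <= e%:E)%E.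
Proof.
move=> e0 P0 Pc.
have := cvge0_near (within_filter D (nbhs_filter (0 : R))) e0 P0 Pc.
rewrite near_withinE => /nbhs_norm0P[d /= d0 H].
by exists d => // h hd; exact: H.
Qed.

Lemma cvge0_dwithin (D : set R) (Phi : R -> \bar R) (e : R) :
  0 < e -> (forall h, (0 <= Phi h)%E) ->
  Phi h @[h --> within D (0 : R)^'] --> 0%E ->
  exists2 d, 0 < d & forall h, h != 0 -> `|h| < d -> D h -> (Phi h <= e%:E)%E.
Proof.
move=> e0 P0 Pc.
have := cvge0_near (within_filter D (@dnbhs_filter _ (0 : R))) e0 P0 Pc.
rewrite near_withinE /dnbhs near_withinE => /nbhs_norm0P[d /= d0 H].
by exists d => // h h0 hd; exact: H.
Qed.

Variables (tau delta s : R).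
Hypotheses (tau0 : 0 < tau) (delta0 : 0 < delta) (s0 : 0 <= s).
Variables (psi0 psi1 psi2 : Rn R n -> R[i]) (psi : nat -> R -> Rn R n -> R[i]).
Hypothesis sol : MGT_solution tau delta s psi0 psi1 psi2 psi.

Local Notation b := (delta + tau).
Local Notation u j t := (fourier (psi j t)).

Let fourier_psi l t : (l <= 2)%N -> 0 <= t -> is_fourier (psi l t) (u l t).
Proof. by move=> l2 t0; have [] := MGT_inH sol l2 t0. Qed.

Let mu_ l t : (l <= 2)%N -> 0 <= t -> inL 2 (u l t).
Proof. by move=> l2 t0; have [] := fourier_psi l2 t0. Qed.

Lemma Hhatnorm_ge0 (r : R) g : (0 <= Hhatnorm r g)%E.
Proof. exact: cLnorm_ge0. Qed.

Lemma Hnorm_ge0 (r : R) f : (0 <= Hnorm r f)%E.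
Proof. exact: cLnorm_ge0. Qed.

Lemma Hhatnorm_cut (m : nat) (r : R) g (e : R) : -1 <= r -> inL 2 g \/ inLcut m g ->
  (Hhatnorm r g <= e%:E)%E -> cmeasurable g ->
  cutnorm m g <= Num.sqrt (1 + m%:R ^+ 2) * e.
Proof.
move=> r1 Lg ge mg.
have Lc : inLcut m g by case: Lg => // Lg; exact: inLcut_inL.
rewrite -lee_fin cutnormE//; apply: le_trans (cutoff_le_Hhatnorm m r1 mg) _.
by rewrite EFinM lee_wpmul2l// lee_fin sqrtr_ge0.
Qed.

Lemma hat_continuous (m : nat) j t e : (j <= 2)%N -> 0 <= t -> 0 < e ->
  exists2 d, 0 < d & forall h, `|h| < d -> 0 <= t + h ->
  cutnorm m (fun xi => u j (t + h) xi - u j t xi) <= e.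
Proof.
move=> j2 t0 e0.
pose A := Num.sqrt (1 + m%:R ^+ 2 : R).
have A0 : 0 < A by rewrite sqrtr_gt0 ltr_pwDl// sqr_ge0.
have eA : 0 < e / A by rewrite divr_gt0.
have [d d0 H] := cvge0_within eA (fun=> Hnorm_ge0 _ _) (MGT_continuous sol j2 t0).
exists d => // h hd th.
have /= := H h hd th.
have F := is_fourierB (fourier_psi j2 th) (fourier_psi j2 t0).
rewrite (Hnorm_fourier _ F) => le.
have [_ LF _] := F.
have r1 : -1 <= s + 2 - j%:R.
  have : (j%:R : R) <= 2 by rewrite ler_nat.
  by move: s0; lra.
apply: le_trans (Hhatnorm_cut r1 (or_introl LF) le LF.1) _.
by rewrite -/A mulrC divfK// gt_eqF.
Qed.

(** Right-hand side of the first-order system satisfied by the three transforms; the last case is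
    the transform of psi_ttt as prescribed by the equation. *)
Definition hat_rate j t xi : R[i] :=
  match j with
  | 0 => u 1%N t xi
  | 1 => u 2%N t xi
  | _ => (- tau^-1)%:C * (u 2%N t xi + (enorm xi ^+ 2)%:C * u 0%N t xi
           + (b * enorm xi ^+ 2)%:C * u 1%N t xi)
  end.

Lemma inLcut_hat_rate (m : nat) j t : 0 <= t -> inLcut m (hat_rate j t).
Proof.
move=> t0.
have L i : (i <= 2)%N -> inLcut m (u i t) by move=> i2; apply: inLcut_inL; exact: mu_.
have mq : measurable_fun [set: Rn R n] (fun x => enorm x ^+ 2).
  by apply: measurable_funX; exact: measurable_enorm.
have qm (x : Rn R n) : enorm x <= m%:R -> `|enorm x ^+ 2| <= m%:R ^+ 2.
  by move=> h; rewrite ger0_norm ?sqr_ge0// ler_pXn2r ?nnegrE ?enorm_ge0.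
have b0 : 0 < b by rewrite addr_gt0.
case: j => [|[|j]]; [exact: L|exact: L|].
apply: (inLcutZ _ _).1; apply: inLcutD; first apply: inLcutD; first exact: L.
  exact: (inLcutM mq (sqr_ge0 _) qm (L 0%N isT)).1.
have mbq : measurable_fun [set: Rn R n] (fun x => b * enorm x ^+ 2).
  by apply: measurable_funM => //; exact: measurable_cst.
have bqm (x : Rn R n) : enorm x <= m%:R -> `|b * enorm x ^+ 2| <= b * m%:R ^+ 2.
  by move=> h; rewrite normrM (gtr0_norm b0) ler_pM2l// qm.
by apply: (inLcutM mbq _ bqm (L 1%N isT)).1; rewrite mulr_ge0 ?sqr_ge0// ltW.
Qed.

Definition hat_error j t h xi : R[i] :=
  u j (t + h) xi - u j t xi - h%:C * hat_rate j t xi.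

Lemma inLcut_hat_diff (m : nat) j t h : (j <= 2)%N -> 0 <= t -> 0 <= t + h ->
  inLcut m (fun xi => u j (t + h) xi - u j t xi).
Proof.
move=> j2 t0 th; apply: inLcut_inL.
have F := is_fourierB (fourier_psi j2 th) (fourier_psi j2 t0).
by case: F.
Qed.

Lemma inLcut_hat_error (m : nat) j t h : (j <= 2)%N -> 0 <= t -> 0 <= t + h ->
  inLcut m (hat_error j t h).
Proof.
move=> j2 t0 th.
have L1 := inLcut_hat_diff m j2 t0 th.
have [L2 _] := inLcutZ (- h) (inLcut_hat_rate m j t0).
have := inLcutD L1 L2; congr inLcut; apply/funext => xi.
by rewrite /hat_error rmorphN mulNr.
Qed.

Lemma hat_derive (m : nat) j t e : (j <= 2)%N -> 0 < t -> 0 < e ->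
  exists2 d, 0 < d & forall h, h != 0 -> `|h| < d -> 0 <= t + h ->
  cutnorm m (hat_error j t h) <= e * `|h|.
Proof.
move=> j2 t0 e0; have t0' := ltW t0.
pose A := Num.sqrt (1 + m%:R ^+ 2 : R).
have A0 : 0 < A by rewrite sqrtr_gt0 ltr_pwDl// sqr_ge0.
have Lerr h := @inLcut_hat_error m j t h j2 t0'.
have [jlt|] := ltnP j 2.
  have eA : 0 < e / A by rewrite divr_gt0.
  have [d d0 H] := cvge0_dwithin eA (fun=> Hnorm_ge0 _ _) (MGT_derive sol jlt t0').
  exists d => // h h0 hd th.
  have /= := H h h0 hd th.
  have j1 : (j.+1 <= 2)%N by [].
  have F := is_fourierB (is_fourierZ h^-1 (is_fourierB (fourier_psi j2 th) (fourier_psi j2 t0')))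
    (fourier_psi j1 t0').
  rewrite (Hnorm_fourier _ F) => le.
  have [_ LF _] := F.
  have r1 : -1 <= s + 2 - j.+1%:R.
    have : (j.+1%:R : R) <= 2 by rewrite ler_nat.
    by move: s0; lra.
  have le2 := Hhatnorm_cut (m := m) r1 (or_introl LF) le LF.1.
  rewrite -/A [X in _ <= X]mulrC divfK ?gt_eqF// in le2.
  have -> : hat_error j t h = (fun xi => h%:C * (h^-1%:C * (u j (t + h) xi - u j t xi) - u j.+1 t xi)).
    apply/funext => xi; rewrite mulrBr mulrA -rmorphM divff// rmorph1 mul1r /hat_error.
    by move: jlt; case: (j) => [|[|//]].
  have [_ ->] := inLcutZ (m := m) h (inLcut_inL m LF).
  by rewrite mulrC ler_wpM2r.
(* At top order the derivative is read off from the equation: the quotient in [MGT_equation] is tau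
   / h times the error, which explains the tolerance e tau / A. *)
move=> jge; have j_2 : j = 2%N by apply/eqP; rewrite eqn_leq j2 jge.
rewrite {}j_2 in Lerr *.
have eA : 0 < e * tau / A by rewrite divr_gt0// mulr_gt0.
have [d d0 H] := cvge0_within eA (fun=> Hhatnorm_ge0 _ _) (MGT_equation sol t0).
exists d => // h h0 hd th.
have /= := H h hd h0; set g := (fun xi => _) => le.
have tn0 : tau != 0 by rewrite gt_eqF.
have gE : g = (fun xi => (tau / h)%:C * hat_error 2 t h xi).
  apply/funext => xi; rewrite /g /hat_error /hat_rate.
  have hh : h^-1%:C * h%:C = 1 :> R[i] by rewrite -rmorphM mulVf.
  have tt : tau%:C * tau^-1%:C = 1 :> R[i] by rewrite -rmorphM divff.
  have -> : (tau / h)%:C = tau%:C * h^-1%:C :> R[i] by rewrite -rmorphM.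
  have -> : (- tau^-1)%:C = - tau^-1%:C :> R[i] by rewrite rmorphN.
  by rewrite -(rescale_increment _ _ _ tt hh) !addrA.
have hE : hat_error 2 t h = (fun xi => (h / tau)%:C * g xi).
  apply/funext => xi; rewrite gE mulrA -rmorphM.
  have -> : h / tau * (tau / h) = 1 by field; rewrite h0 tn0.
  by rewrite rmorph1 mul1r.
have Lg : inLcut m g.
  by rewrite gE; exact: (inLcutZ (tau / h) (Lerr h th)).1.
have mg : cmeasurable g.
  rewrite gE; apply: cmeasurableZ.
  have m0 := (mu_ (isT : (0 <= 2)%N) t0').1; have m1 := (mu_ (isT : (1 <= 2)%N) t0').1.
  have m2 := (mu_ (isT : (2 <= 2)%N) t0').1; have m3 := (mu_ (isT : (2 <= 2)%N) th).1.
  have mq : measurable_fun [set: Rn R n] (fun x => enorm x ^+ 2).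
    by apply: measurable_funX; exact: measurable_enorm.
  apply: cmeasurableB; first exact: cmeasurableB.
  apply: cmeasurableZ; apply: cmeasurableZ; apply: cmeasurableD.
    by apply: cmeasurableD => //; exact: cmeasurableM.
  apply: cmeasurableM => //.
  by apply: measurable_funM => //; exact: measurable_cst.
have r1 : -1 <= s - 1 by move: s0; lra.
have le2 := Hhatnorm_cut (m := m) r1 (or_intror Lg) le mg.
rewrite -/A [X in _ <= X]mulrC divfK ?gt_eqF// in le2.
rewrite hE; have [_ ->] := inLcutZ (m := m) (h / tau) Lg.
rewrite normrM normfV (gtr0_norm tau0) mulrAC ler_pdivrMr//.
by rewrite (mulrC e) -mulrA ler_wpM2l.
Qed.

End solution_representation.

Section ring_identities.
Variable K : comPzRingType.

Lemma increment_split (p0 p1 p2 q0 q1 q2 x0 x1 x2 y0 y1 y2 : K) :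
  (p0 * (x0 - y0) + (p0 - q0) * y0) + (p1 * (x1 - y1) + (p1 - q1) * y1) +
  (p2 * (x2 - y2) + (p2 - q2) * y2) =
  p0 * x0 + p1 * x1 + p2 * x2 - (q0 * y0 + q1 * y1 + q2 * y2).
Proof. ring. Qed.

(** Increment of S(t - sg) u(sg): here p and a are the propagators at t - sg - h and t - sg, x and y
    the transforms at sg + h and sg, and ti, d, t stand for 1 / tau, delta, tau. The derivatives of
    a come from [propagatorS] and those of y from [hat_rate]; the terms of first order in h cancel
    between the three lines. *)
Lemma increment_taylor (p0 p1 p2 a0 a1 a2 q ti d t h x0 x1 x2 y0 y1 y2 : K) :
  (p0 * (x0 - y0 - h * y1) + h * (p0 - a0) * y1
    + (p0 - a0 + h * (- (q * ti) * a2)) * y0) +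
  (p1 * (x1 - y1 - h * y2) + h * (p1 - a1) * y2
    + (p1 - a1 + h * (a0 - (d + t) * q * ti * a2)) * y1) +
  (p2 * (x2 - y2 - h * (- ti * (y2 + q * y0 + (d + t) * q * y1)))
    + h * (p2 - a2) * (- ti * (y2 + q * y0 + (d + t) * q * y1))
    + (p2 - a2 + h * (a1 - ti * a2)) * y2) =
  p0 * x0 + p1 * x1 + p2 * x2 - (a0 * y0 + a1 * y1 + a2 * y2).
Proof. ring. Qed.

Lemma collect_terms (B C h a0 a1 a2 c0 c1 c2 : K) :
  (B * a0 + h * C * c0) + (B * a1 + h * C * c1) + (B * a2 + h * C * c2) =
  B * (a0 + a1 + a2) + (C * c0 + C * c1 + C * c2) * h.
Proof. ring. Qed.

Lemma collect_terms2 (B C D h a0 a1 a2 c0 c1 c2 d0 d1 d2 : K) :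
  (B * a0 + h * C * c0 + h * D * d0) + (B * a1 + h * C * c1 + h * D * d1) +
  (B * a2 + h * C * c2 + h * D * d2) =
  B * (a0 + a1 + a2)
  + ((C * c0 + D * d0) + (C * c1 + D * d1) + (C * c2 + D * d2)) * h.
Proof. ring. Qed.

End ring_identities.

Lemma increment_taylor_complex (R : realType) (p0 p1 p2 a0 a1 a2 q ti d t h : R)
    (x0 x1 x2 y0 y1 y2 : R[i]) :
  (p0%:C * (x0 - y0 - h%:C * y1) + (h * (p0 - a0))%:C * y1
    + (p0 - a0 + h * (- (q * ti) * a2))%:C * y0) +
  (p1%:C * (x1 - y1 - h%:C * y2) + (h * (p1 - a1))%:C * y2
    + (p1 - a1 + h * (a0 - (d + t) * q * ti * a2))%:C * y1) +
  (p2%:C * (x2 - y2 - h%:C * ((- ti)%:C * (y2 + q%:C * y0 + ((d + t) * q)%:C * y1)))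
    + (h * (p2 - a2))%:C * ((- ti)%:C * (y2 + q%:C * y0 + ((d + t) * q)%:C * y1))
    + (p2 - a2 + h * (a1 - ti * a2))%:C * y2) =
  p0%:C * x0 + p1%:C * x1 + p2%:C * x2 - (a0%:C * y0 + a1%:C * y1 + a2%:C * y2).
Proof. by rewrite !(rmorphD, rmorphB, rmorphM, rmorphN) /= increment_taylor. Qed.

Lemma delta_sum (R : realType) (x : nat -> R[i]) l : (l <= 2)%N ->
  x l = ((0%N == l)%:R : R)%:C * x 0%N + ((1%N == l)%:R : R)%:C * x 1%N
    + ((2%N == l)%:R : R)%:C * x 2%N.
Proof.
by move: l => [|[|[|//]]] _; rewrite /= !mul0r mul1r ?addr0 ?add0r.
Qed.

Lemma half_bound (R : realType) (e K : R) : 0 < e -> 0 <= K ->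
  K * (e / (2 * (K + 1))) <= e / 2.
Proof.
move=> e0 K0; have K1 : 0 < K + 1 by rewrite ltr_wpDl.
have -> : K * (e / (2 * (K + 1))) = (e / 2) * (K / (K + 1)) by field; rewrite gt_eqF.
rewrite ler_piMr//; first by rewrite divr_ge0// ltW.
by rewrite ler_pdivrMr// mul1r lerDl.
Qed.

Lemma third_bound (R : realType) (e B a0 a1 a2 : R) : 0 < e -> 0 <= B ->
  a0 <= e / (6 * (B + 1)) -> a1 <= e / (6 * (B + 1)) -> a2 <= e / (6 * (B + 1)) ->
  B * (a0 + a1 + a2) <= e / 2.
Proof.
move=> e0 B0 h0 h1 h2; apply: le_trans (half_bound e0 B0).
rewrite ler_wpM2l//.
have -> : e / (2 * (B + 1)) = 3 * (e / (6 * (B + 1))) by field; rewrite gt_eqF// ltr_wpDl.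
by move: h0 h1 h2; lra.
Qed.

(** Budget of the epsilon-delta arguments: a sixth of [e] for each of the three norms and half for
    the remainder. Adding 1 to B and K keeps the denominators positive when these vanish. *)
Lemma eps_sum (R : realType) (e B K d a0 a1 a2 : R) : 0 < e -> 0 <= B -> 0 <= K ->
  a0 <= e / (6 * (B + 1)) -> a1 <= e / (6 * (B + 1)) -> a2 <= e / (6 * (B + 1)) ->
  d <= e / (2 * (K + 1)) -> B * (a0 + a1 + a2) + K * d <= e.
Proof.
move=> e0 B0 K0 h0 h1 h2 hd.
have s1 := third_bound e0 B0 h0 h1 h2.
have s2 := le_trans (ler_wpM2l K0 hd) (half_bound e0 K0).
by move: s1 s2; lra.
Qed.

Lemma eps_sum_scaled (R : realType) (e B K d a0 a1 a2 : R) :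
  0 < e -> 0 <= B -> 0 <= K -> 0 < d ->
  a0 <= e / (6 * (B + 1)) * d -> a1 <= e / (6 * (B + 1)) * d ->
  a2 <= e / (6 * (B + 1)) * d ->
  d <= e / (2 * (K + 1)) -> B * (a0 + a1 + a2) + K * d ^+ 2 <= e * d.
Proof.
move=> e0 B0 K0 d0 h0 h1 h2 hd.
have le_div a : a <= e / (6 * (B + 1)) * d -> a / d <= e / (6 * (B + 1)).
  by rewrite ler_pdivrMr.
have := eps_sum e0 B0 K0 (le_div _ h0) (le_div _ h1) (le_div _ h2) hd.
rewrite -(ler_pM2r d0).
suff -> : (B * (a0 / d + a1 / d + a2 / d) + K * d) * d =
  B * (a0 + a1 + a2) + K * d ^+ 2 by [].
by field; rewrite gt_eqF.
Qed.

Lemma cutnorm_reverse_triangle (R : realType) (n m : nat) (f g h : Rn R n -> R[i]) :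
  inLcut m (fun xi => f xi - h xi) -> inLcut m (fun xi => g xi - h xi) ->
  inLcut m (fun xi => g xi - f xi) ->
  `|cutnorm m (fun xi => g xi - h xi) - cutnorm m (fun xi => f xi - h xi)| <=
  cutnorm m (fun xi => g xi - f xi).
Proof.
move=> Lf Lg Lgf.
have [L' N'] := inLcutZ (-1) Lgf.
have e1 : (fun xi => f xi - h xi + (g xi - f xi)) = (fun xi => g xi - h xi).
  by apply/funext => xi; rewrite addrC addrA subrK.
have e2 : (fun xi => g xi - h xi + (-1)%:C * (g xi - f xi)) = (fun xi => f xi - h xi).
  by apply/funext => xi; rewrite rmorphN rmorph1 mulN1r opprB addrC addrA subrK.
have := cutnormD Lf Lgf; have := cutnormD Lg L'.
rewrite e1 e2 N' normrN1 mul1r.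
set a := cutnorm m _; set c := cutnorm m _; set d := cutnorm m _ => h1 h2.
by rewrite ler_norml; apply/andP; split; move: h1 h2; lra.
Qed.

(** * Constancy in sg of the solution operator applied at time sg *)

Section duhamel_constancy.
Variables (R : realType) (n : nat).
Local Notation mu := (leb R n).
Variables (tau delta s : R).
Hypotheses (tau0 : 0 < tau) (delta0 : 0 < delta) (s0 : 0 <= s).
Variables (psi0 psi1 psi2 : Rn R n -> R[i]) (psi : nat -> R -> Rn R n -> R[i]).
Hypothesis sol : MGT_solution tau delta s psi0 psi1 psi2 psi.

Local Notation b := (delta + tau).
Local Notation u j t := (fourier (psi j t)).
Local Notation v := (hat_rate tau delta psi).
Local Notation err := (hat_error tau delta psi).

Variables (m l : nat) (t : R).
Hypotheses (l2 : (l <= 2)%N) (t0 : 0 < t).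

Let P i j x (xi : Rn R n) : R := propagator tau delta j (enorm xi ^+ 2) (l + i) x.

(* F sg = S(t - sg) u(sg), where S is the solution operator of the ODE and u
   the triple of Fourier transforms; it does not depend on sg. *)
Let F sg xi : R[i] := (P 0 0 (t - sg) xi)%:C * u 0%N sg xi +
  (P 0 1 (t - sg) xi)%:C * u 1%N sg xi + (P 0 2 (t - sg) xi)%:C * u 2%N sg xi.

Let Pm i j x : measurable_fun [set: Rn R n] (P i j x).
Proof. exact: measurable_propagator. Qed.

Let Pd i j xi : derivf (fun x => P i j x xi) (fun x => P i.+1 j x xi).
Proof.
have := @derivf_propagator R tau delta tau0 delta0 j (enorm xi ^+ 2) (l + i) (sqr_ge0 _).
by rewrite /P addnS.
Qed.

Let Pb i : exists2 B, 0 <= B & forall j x xi, enorm xi <= m%:R -> `|x| <= t + 1 ->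
  `|P i j x xi| <= B.
Proof.
have [B B0 H] := @propagator_le R tau delta tau0 delta0 (m%:R ^+ 2) (t + 1) (l + i)
  (sqr_ge0 _) (ltW (addr_gt0 t0 ltr01)).
exists B => // j x xi xm xt; apply: H => //; first exact: sqr_ge0.
by rewrite ler_pXn2r ?nnegrE ?enorm_ge0.
Qed.

Let Lu j sg : (j <= 2)%N -> 0 <= sg -> inLcut m (u j sg).
Proof.
move=> j2 sg0; apply: inLcut_inL.
by have [[_ ? _] _] := MGT_inH sol j2 sg0.
Qed.

Let cut3 (f g h : Rn R n -> R[i]) (A B C : R) :
  inLcut m f /\ cutnorm m f <= A -> inLcut m g /\ cutnorm m g <= B ->
  inLcut m h /\ cutnorm m h <= C ->
  inLcut m (fun xi => f xi + g xi + h xi) /\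
  cutnorm m (fun xi => f xi + g xi + h xi) <= A + B + C.
Proof.
move=> [Lf fA] [Lg gB] [Lh hC]; have Lfg := inLcutD Lf Lg.
split; first exact: inLcutD.
apply: le_trans (cutnormD Lfg Lh) _; apply: lerD => //.
by apply: le_trans (cutnormD Lf Lg) _; exact: lerD.
Qed.

Let inLcut_F sg : 0 <= sg -> sg <= t -> inLcut m (F sg).
Proof.
move=> sg0 sgt; have [B B0 PB] := Pb 0.
have H j : (j <= 2)%N -> inLcut m (fun xi => (P 0 j (t - sg) xi)%:C * u j sg xi).
  move=> j2; apply: (inLcutM (Pm 0 j _) B0 _ (Lu j2 sg0)).1 => xi xm.
  by apply: PB => //; rewrite ger0_norm; [have := t0; lra|rewrite subr_ge0].
by apply: inLcutD; [apply: inLcutD|]; exact: H.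
Qed.

Let inLcut_dF sg sg' : 0 <= sg <= t -> 0 <= sg' <= t ->
  inLcut m (fun xi => F sg' xi - F sg xi).
Proof.
move=> /andP[a1 a2] /andP[b1 b2].
have L1 := inLcut_F a1 a2; have L2 := inLcut_F b1 b2.
have [L3 _] := inLcutZ (-1) L1.
have := inLcutD L2 L3; congr inLcut; apply/funext => xi.
by rewrite rmorphN rmorph1 mulN1r.
Qed.

(** Covers the endpoints, where [flat_cst] asks for continuity only. The propagators are Lipschitz
    in time on the ball, which gives the term in |h|. *)
Let diff_continuity sg : 0 <= sg <= t -> exists2 K, 0 <= K & exists2 B, 0 <= B &
  forall h, 0 <= sg + h <= t -> cutnorm m (fun xi => F (sg + h) xi - F sg xi) <=
   B * (cutnorm m (fun xi => u 0%N (sg + h) xi - u 0%N sg xi) +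
        cutnorm m (fun xi => u 1%N (sg + h) xi - u 1%N sg xi) +
        cutnorm m (fun xi => u 2%N (sg + h) xi - u 2%N sg xi)) + K * `|h|.
Proof.
move=> /andP[sg0 sgt].
have [B0 B00 PB0] := Pb 0; have [B1 B10 PB1] := Pb 1.
exists (B1 * cutnorm m (u 0%N sg) + B1 * cutnorm m (u 1%N sg) + B1 * cutnorm m (u 2%N sg)).
  by rewrite !addr_ge0 ?mulr_ge0 ?cutnorm_ge0.
exists B0 => // h /andP[sh0 sht].
have x1 : `|t - sg| <= t + 1.
  by rewrite ger0_norm; [have := t0; lra|rewrite subr_ge0].
have x2 : `|t - (sg + h)| <= t + 1.
  by rewrite ger0_norm; [have := t0; lra|rewrite subr_ge0].
pose T j xi : R[i] := (P 0 j (t - (sg + h)) xi)%:C * (u j (sg + h) xi - u j sg xi) +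
  (P 0 j (t - (sg + h)) xi - P 0 j (t - sg) xi)%:C * u j sg xi.
have HT j : (j <= 2)%N -> inLcut m (T j) /\
    cutnorm m (T j) <= B0 * cutnorm m (fun xi => u j (sg + h) xi - u j sg xi) +
       `|h| * B1 * cutnorm m (u j sg).
  move=> j2.
  have [L1 n1] := inLcutM (Pm 0 j (t - (sg + h))) B00
    (fun xi xm => PB0 j _ xi xm x2) (inLcut_hat_diff sol m j2 sg0 sh0).
  have mp : measurable_fun [set: Rn R n] (fun xi => P 0 j (t - (sg + h)) xi - P 0 j (t - sg) xi).
    by apply: measurable_funB; exact: Pm.
  have hB : 0 <= `|h| * B1 by rewrite mulr_ge0.
  have bd xi : enorm xi <= m%:R -> `|P 0 j (t - (sg + h)) xi - P 0 j (t - sg) xi| <= `|h| * B1.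
    move=> xm; apply: le_trans (derivf_lipschitz (Pd 0 j xi)
      (fun z zT => PB1 j z xi xm zT) x2 x1) _.
    rewrite mulrC; have -> : t - (sg + h) - (t - sg) = - h by ring.
    by rewrite normrN.
  have [L2 n2] := inLcutM mp hB bd (Lu j2 sg0).
  split; first exact: inLcutD.
  by apply: le_trans (cutnormD L1 L2) _; exact: lerD.
have [_] := cut3 (HT 0%N isT) (HT 1%N isT) (HT 2%N isT).
have -> : (fun xi => T 0%N xi + T 1%N xi + T 2%N xi) = (fun xi => F (sg + h) xi - F sg xi).
  by apply/funext => xi; rewrite /T !rmorphB increment_split.
by rewrite collect_terms.
Qed.

Let diff_derivative sg : 0 < sg < t -> exists2 K, 0 <= K & exists2 B, 0 <= B &
  forall h, `|h| <= 1 -> 0 <= sg + h <= t ->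
  cutnorm m (fun xi => F (sg + h) xi - F sg xi) <=
   B * (cutnorm m (err 0%N sg h) + cutnorm m (err 1%N sg h) + cutnorm m (err 2%N sg h))
   + K * `|h| ^+ 2.
Proof.
move=> /andP[sg0' sgt']; have sg0 := ltW sg0'; have sgt := ltW sgt'.
have [B0 B00 PB0] := Pb 0; have [B1 B10 PB1] := Pb 1; have [B2 B20 PB2] := Pb 2.
pose k j := B1 * cutnorm m (v j sg) + B2 * cutnorm m (u j sg).
have k0 j : 0 <= k j by rewrite addr_ge0// mulr_ge0// cutnorm_ge0.
exists (k 0%N + k 1%N + k 2%N).
  by apply: addr_ge0; [apply: addr_ge0|]; exact: k0.
exists B0 => // h h1 /andP[sh0 sht].
have x1 : `|t - sg| <= t + 1.
  by rewrite ger0_norm; [have := t0; lra|rewrite subr_ge0].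
have x2 : `|t - sg - h| <= t + 1.
  by rewrite ger0_norm; [have := t0; lra|rewrite -addrA -opprD subr_ge0].
have h20 : 0 <= `|h| ^+ 2 by exact: sqr_ge0.
(* Three parts of the increment of the j-th product: the differentiation error of the transform, a
   product of two first-order increments, and the Taylor remainder of the propagator. The last two
   are of order h^2. *)
pose T j xi : R[i] := (P 0 j (t - sg - h) xi)%:C * err j sg h xi +
  (h * (P 0 j (t - sg - h) xi - P 0 j (t - sg) xi))%:C * v j sg xi +
  (P 0 j (t - sg - h) xi - P 0 j (t - sg) xi + h * P 1 j (t - sg) xi)%:C * u j sg xi.
have HT j : (j <= 2)%N -> inLcut m (T j) /\
    cutnorm m (T j) <= B0 * cutnorm m (err j sg h) +
       `|h| ^+ 2 * B1 * cutnorm m (v j sg) + `|h| ^+ 2 * B2 * cutnorm m (u j sg).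
  move=> j2.
  have A1 := inLcutM (Pm 0 j (t - sg - h)) B00
    (fun xi xm => PB0 j _ xi xm x2) (inLcut_hat_error tau0 delta0 sol m j2 sg0 sh0).
  have md : measurable_fun [set: Rn R n] (fun xi => P 0 j (t - sg - h) xi - P 0 j (t - sg) xi).
    by apply: measurable_funB; exact: Pm.
  have mp : measurable_fun [set: Rn R n]
      (fun xi => h * (P 0 j (t - sg - h) xi - P 0 j (t - sg) xi)).
    by apply: measurable_funM => //; exact: measurable_cst.
  have mp2 : measurable_fun [set: Rn R n]
      (fun xi => P 0 j (t - sg - h) xi - P 0 j (t - sg) xi + h * P 1 j (t - sg) xi).
    apply: measurable_funD => //; apply: measurable_funM => //; exact: measurable_cst.
  have hB1 : 0 <= `|h| ^+ 2 * B1 by rewrite mulr_ge0.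
  have hB2 : 0 <= `|h| ^+ 2 * B2 by rewrite mulr_ge0.
  have bd1 xi : enorm xi <= m%:R ->
      `|h * (P 0 j (t - sg - h) xi - P 0 j (t - sg) xi)| <= `|h| ^+ 2 * B1.
    move=> xm; rewrite normrM expr2 -mulrA ler_wpM2l//.
    apply: le_trans (derivf_lipschitz (Pd 0 j xi) (fun z zT => PB1 j z xi xm zT) x2 x1) _.
    rewrite mulrC; have -> : t - sg - h - (t - sg) = - h by ring.
    by rewrite normrN.
  have bd2 xi : enorm xi <= m%:R ->
      `|P 0 j (t - sg - h) xi - P 0 j (t - sg) xi + h * P 1 j (t - sg) xi| <= `|h| ^+ 2 * B2.
    move=> xm; rewrite [leRHS]mulrC.
    exact: (derivf_taylor (Pd 0 j xi) (Pd 1 j xi) (fun z zT => PB2 j z xi xm zT) x1 x2).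
  have A2 := inLcutM mp hB1 bd1 (inLcut_hat_rate tau0 delta0 sol m j sg0).
  have A3 := inLcutM mp2 hB2 bd2 (Lu j2 sg0).
  exact: cut3 A1 A2 A3.
have [_] := cut3 (HT 0%N isT) (HT 1%N isT) (HT 2%N isT).
have -> : (fun xi => T 0%N xi + T 1%N xi + T 2%N xi) = (fun xi => F (sg + h) xi - F sg xi).
  apply/funext => xi.
  have [e0 e1 e2] := propagatorS tau0 delta0 (t - sg) (sqr_ge0 (enorm xi)) l2.
  have Q0 : P 1 0 (t - sg) xi = - (enorm xi ^+ 2 / tau) * P 0 2 (t - sg) xi.
    by rewrite /P addn1 addn0 e0.
  have Q1 : P 1 1 (t - sg) xi = P 0 0 (t - sg) xi - b * enorm xi ^+ 2 / tau * P 0 2 (t - sg) xi.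
    by rewrite /P addn1 addn0 e1.
  have Q2 : P 1 2 (t - sg) xi = P 0 1 (t - sg) xi - tau^-1 * P 0 2 (t - sg) xi.
    by rewrite /P addn1 addn0 e2.
  have xE : t - (sg + h) = t - sg - h by ring.
  rewrite /T /F Q0 Q1 Q2 xE /hat_error /hat_rate.
  exact: increment_taylor_complex.
by rewrite collect_terms2.
Qed.

Lemma duhamel_cut : {ae mu, forall xi, enorm xi <= m%:R -> u l t xi =
  (propagator tau delta 0 (enorm xi ^+ 2) l t)%:C * u 0%N 0 xi +
  (propagator tau delta 1 (enorm xi ^+ 2) l t)%:C * u 1%N 0 xi +
  (propagator tau delta 2 (enorm xi ^+ 2) l t)%:C * u 2%N 0 xi}.
Proof.
(* Distance from F sg to F 0. The reverse triangle inequality turns the bounds on increments of F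
   into flatness of this real function, so the real mean value theorem replaces one for functions
   with values in L^2. *)
pose g sg := cutnorm m (fun xi => F sg xi - F 0 xi).
have zt : 0 <= (0 : R) <= t by rewrite lexx ltW.
have gd x y : 0 <= x <= t -> 0 <= y <= t ->
    `|g y - g x| <= cutnorm m (fun xi => F y xi - F x xi).
  move=> xt yt.
  exact: (cutnorm_reverse_triangle (inLcut_dF zt xt) (inLcut_dF zt yt) (inLcut_dF xt yt)).
have gt0 : g t = g 0.
  apply: (flat_cst t0) => [x e xt e0|x e xt e0].
    have [K K0 [B B0 H]] := diff_continuity xt.
    have x0 : 0 <= x by case/andP: xt.
    have e1 : 0 < e / (6 * (B + 1)) by rewrite divr_gt0// mulr_gt0// ltr_wpDl.
    have [d0 d00 D0] := hat_continuous s0 sol m (isT : (0 <= 2)%N) x0 e1.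
    have [d1 d10 D1] := hat_continuous s0 sol m (isT : (1 <= 2)%N) x0 e1.
    have [d2 d20 D2] := hat_continuous s0 sol m (isT : (2 <= 2)%N) x0 e1.
    have e2 : 0 < e / (2 * (K + 1)) by rewrite divr_gt0// mulr_gt0// ltr_wpDl.
    exists (Num.min d0 (Num.min d1 (Num.min d2 (e / (2 * (K + 1)))))).
      by rewrite !lt_min d00 d10 d20 e2.
    move=> y yt; rewrite !lt_min => /and4P[h0 h1 h2 h3].
    apply: le_trans (gd x y xt yt) _.
    have yE : y = x + (y - x) by ring.
    have yt' : 0 <= x + (y - x) <= t by rewrite -yE.
    have y0' : 0 <= x + (y - x) by case/andP: yt'.
    rewrite yE; apply: le_trans (H _ yt') _.
    exact: (eps_sum e0 B0 K0 (D0 _ h0 y0') (D1 _ h1 y0') (D2 _ h2 y0') (ltW h3)).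
  have [K K0 [B B0 H]] := diff_derivative xt.
  have /andP[x0 xt'] := xt.
  have e1 : 0 < e / (6 * (B + 1)) by rewrite divr_gt0// mulr_gt0// ltr_wpDl.
  have [d0 d00 D0] := hat_derive tau0 delta0 s0 sol m (isT : (0 <= 2)%N) x0 e1.
  have [d1 d10 D1] := hat_derive tau0 delta0 s0 sol m (isT : (1 <= 2)%N) x0 e1.
  have [d2 d20 D2] := hat_derive tau0 delta0 s0 sol m (isT : (2 <= 2)%N) x0 e1.
  have e2 : 0 < e / (2 * (K + 1)) by rewrite divr_gt0// mulr_gt0// ltr_wpDl.
  pose r := Num.min 1 (Num.min x (t - x)).
  have r0 : 0 < r by rewrite !lt_min ltr01 x0 subr_gt0.
  exists (Num.min r (Num.min d0 (Num.min d1 (Num.min d2 (e / (2 * (K + 1))))))).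
    by rewrite lt_min r0 !lt_min d00 d10 d20 e2.
  move=> h hn; rewrite lt_min => /andP[]; rewrite /r !lt_min => /and3P[hr1 hrx hrt].
  move=> /and4P[h0 h1 h2 h3].
  have yt : 0 <= x + h <= t.
    move: hrx hrt; rewrite !ltr_norml => /andP[g1 _] /andP[_ g2].
    apply/andP; split; rewrite addrC; last by rewrite -lerBrDr ltW.
    by rewrite -lerBlDr sub0r ltW.
  have y0 : 0 <= x + h by case/andP: yt.
  have xt2 : 0 <= x <= t by rewrite !ltW.
  apply: le_trans (gd x (x + h) xt2 yt) _.
  apply: le_trans (H h (ltW hr1) yt) _.
  have hp : 0 < `|h| by rewrite normr_gt0.
  exact: (eps_sum_scaled e0 B0 K0 hp (D0 _ hn h0 y0) (D1 _ hn h1 y0) (D2 _ hn h2 y0) (ltW h3)).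
have g00 : g 0 = 0.
  have [_] := inLcutZ 0 (inLcut_dF zt zt); rewrite normr0 mul0r => {2}<-.
  by rewrite /g; congr cutnorm; apply/funext => xi; rewrite subrr mulr0.
have tt : 0 <= t <= t by rewrite lexx ltW.
have := cutnorm_eq0 (inLcut_dF zt tt); rewrite -/(g t) gt0 g00 => /(_ erefl).
apply: filterS => xi H xm; have := H xm => /eqP; rewrite subr_eq0 => /eqP.
(* At sg = t the solution operator is S(0), the identity, and F t reduces to the l-th transform at
   time t. *)
rewrite /F subr0 subrr /P !addn0 => E; rewrite -{}E.
have pE j : (j <= 2)%N -> propagator tau delta j (enorm xi ^+ 2) l 0 = (j == l)%:R.
  by move=> j2; exact: (@propagator_init R tau delta tau0 j (enorm xi ^+ 2) l (sqr_ge0 _) j2 l2).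
rewrite (pE 0%N isT) (pE 1%N isT) (pE 2%N isT).
exact: (delta_sum (fun j => u j t xi) l2).
Qed.

End duhamel_constancy.

(** * Decay estimates *)

Section decay.
Variable R : realType.

(** For y >= 1, a single term of the exponential series, of order N + 1 > p, dominates y^p; the 1 in
    the constant takes care of y <= 1. *)
Lemma powR_le_expR (c p : R) : 0 < c -> 0 <= p ->
  exists2 C, 0 < C & forall y, 0 <= y -> y `^ p <= C * expR (c * y).
Proof.
move=> c0 p0; pose N := Num.bound p.
have pN : p < N.+1%:R.
  have := archi_boundP p0; rewrite -/N => h; apply: lt_trans h _.
  by rewrite ltr_nat.
have F0 : 0 < N.+1`!%:R :> R by rewrite ltr0n fact_gt0.
have cN0 : 0 < c ^+ N.+1 by rewrite exprn_gt0.
pose K := N.+1`!%:R / c ^+ N.+1.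
have K0 : 0 < K by rewrite divr_gt0.
exists (1 + K); first by rewrite addr_gt0.
move=> y y0.
have e1 : 1 <= expR (c * y) by rewrite -[leLHS]expR0 ler_expR mulr_ge0// ltW.
have yN : y `^ p <= 1 + y ^+ N.+1.
  have [y1|y1] := leP y 1.
    apply: (@le_trans _ _ 1); last by rewrite lerDl exprn_ge0.
    have := ge0_ler_powR p0; move=> /(_ y 1); rewrite !nnegrE y0 ler01 powR1.
    by apply.
  apply: (@le_trans _ _ (y ^+ N.+1)); last by rewrite lerDr.
  by rewrite -powR_mulrn// ler_powR ?ltW.
apply: le_trans yN _; rewrite mulrDl mul1r; apply: lerD => //.
have cy0 : 0 <= c * y by rewrite mulr_ge0// ltW.
have h2 : (c * y) ^+ N.+1 / N.+1`!%:R <= expR (c * y).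
  by apply: le_trans (expR_ge1Dxn N cy0); rewrite lerDr.
apply: le_trans (ler_wpM2l (ltW K0) h2).
rewrite /K exprMn; le_of_eq.
by move: (c ^+ _) (y ^+ _) (_%:R) cN0 F0 => A B D A0 D0; field; rewrite !gt_eqF.
Qed.

Lemma expR_powR_decay (c p : R) : 0 < c -> 0 <= p ->
  exists2 C, 0 < C & forall t, 0 <= t -> expR (- c * t) <= C * (1 + t) `^ (- p).
Proof.
move=> c0 p0; have [C C0 H] := powR_le_expR c0 p0.
exists (C * expR c); first by rewrite mulr_gt0// expR_gt0.
move=> t t0; have t1 : 0 < 1 + t by rewrite ltr_wpDr.
rewrite powRN ler_pdivlMr ?powR_gt0//.
have -> : C * expR c = expR (- c * t) * (C * expR (c * (1 + t))).
  by rewrite mulrCA -expRD; congr (_ * expR _); ring.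
by rewrite ler_wpM2l ?expR_ge0// H// ltW.
Qed.

Lemma powRN_shift (t p : R) : 1 <= t -> 0 <= p ->
  t `^ (- p) <= 2 `^ p * (1 + t) `^ (- p).
Proof.
move=> t1 p0; have t0 : 0 < t by apply: lt_le_trans t1.
rewrite !powRN ler_pdivlMr ?powR_gt0 ?ltr_wpDl ?ler01// mulrC ler_pdivrMr ?powR_gt0//.
rewrite -powRM ?(ltW t0)//; apply: ge0_ler_powR => //; rewrite ?nnegrE; lra.
Qed.

(** Half of the exponent is spent on (t r^2)^(p/2) <= C exp (b t r^2 / 2); the other half remains as
    a Gaussian. *)
Lemma powR_gaussian_le (b p : R) : 0 < b -> 0 <= p ->
  exists2 C, 0 < C & forall t r, 0 < t -> 0 <= r ->
  r `^ p * expR (- b * r ^+ 2 * t) <=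
  C * t `^ (- (p / 2)) * expR (- (b * t / 2 * r ^+ 2)).
Proof.
move=> b0 p0; have b2 : 0 < b / 2 by rewrite divr_gt0.
have p2 : 0 <= p / 2 by rewrite divr_ge0.
have [C C0 H] := powR_le_expR b2 p2.
exists C => // t r t0 r0.
have r2 : 0 <= r ^+ 2 by rewrite sqr_ge0.
have := H (t * r ^+ 2) (mulr_ge0 (ltW t0) r2).
rewrite powRM ?(ltW t0)// -[r ^+ 2]powR_mulrn// -powRrM.
have -> : 2%:R * (p / 2) = p by field.
rewrite powR_mulrn// => h.
have -> : expR (- (b * t / 2 * r ^+ 2)) =
   expR (b / 2 * (t * r ^+ 2)) * expR (- b * r ^+ 2 * t).
  by rewrite -expRD; congr expR; field.
have -> : r `^ p = t `^ (- (p / 2)) * (t `^ (p / 2) * r `^ p).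
  by rewrite powRN mulKf// gt_eqF// powR_gt0.
rewrite (mulrA (C * _)) ler_wpM2r ?expR_ge0// (mulrC C) -[leRHS]mulrA.
by apply: ler_wpM2l; [exact: powR_ge0|exact: h].
Qed.

End decay.

(** * L^2 norms of Gaussian moments *)

Section gaussian_norms.
Variables (R : realType) (n : nat).

Lemma cLnorm2_gaussian (a : R) : 0 < a ->
  cLnorm 2 (fun xi : Rn R n => (expR (- (a / 2 * enorm xi ^+ 2)))%:C) =
  ((pi / a) `^ (n%:R / 4))%:E.
Proof.
move=> a0; rewrite cLnormE// -[RHS]/(_%:E).
have pa : 0 <= pi / a :> R by rewrite divr_ge0 ?pi_ge0// ltW.
under eq_integral => xi _.
  rewrite normc_real ger0_norm ?expR_ge0// powR_mulrn ?expR_ge0// -expRM_natl.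
  have -> : 2 * - (a / 2 * enorm xi ^+ 2) = - (a * dotp xi xi).
    by rewrite -sqr_enorm; field.
  over.
rewrite integral_gaussian_n// poweR_EFin; congr _%:E.
rewrite -powR_mulrn ?sqrtr_ge0// -powR12_sqrt// -!powRrM; congr (_ `^ _).
by field.
Qed.

(** The rate splits into t^(-p/2) from the moment and t^(-n/4) from the L^2 norm of a Gaussian of
    width t^(-1/2). For t >= 1 one passes from t to 1 + t at the cost of the factor 2^P. *)
Lemma gaussian_moment_decay (b p : R) : 0 < b -> 0 <= p ->
  exists2 C, 0 < C & forall t, 1 <= t ->
  (cLnorm 2 (fun xi : Rn R n => (enorm xi `^ p * expR (- b * enorm xi ^+ 2 * t))%:C) <=
   (C * (1 + t) `^ (- (n%:R / 4 + p / 2)))%:E)%E.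
Proof.
move=> b0 p0; have [C C0 H] := powR_gaussian_le b0 p0.
have pb : 0 < pi / b :> R by rewrite divr_gt0// pi_gt0.
pose P := n%:R / 4 + p / 2 : R.
have P0 : 0 <= P by rewrite addr_ge0// divr_ge0.
exists (C * (pi / b) `^ (n%:R / 4) * 2 `^ P).
  by rewrite !mulr_gt0// powR_gt0.
move=> t t1; have t0 : 0 < t by apply: lt_le_trans t1.
have mg : measurable_fun [set: Rn R n] (fun xi => expR (- (b * t / 2 * enorm xi ^+ 2))).
  apply: measurableT_comp => //; apply: measurableT_comp => //.
  by apply: measurable_funM => //; apply: measurable_funX; exact: measurable_enorm.
apply: (@le_trans _ _ (cLnorm 2 (fun xi : Rn R n =>
   (C * t `^ (- (p / 2)))%:C * (expR (- (b * t / 2 * enorm xi ^+ 2)))%:C)%R)).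
  apply: cLnorm_le => //.
  - apply: cmeasurable_real; apply: measurable_funM.
      by apply: (measurableT_comp (measurable_powR p)); exact: measurable_enorm.
    apply: measurableT_comp => //; apply: measurable_funM => //.
    by apply: measurable_funM => //; apply: measurable_funX; exact: measurable_enorm.
  - by apply: cmeasurableZ; exact: cmeasurable_real.
  apply: aeW => xi; rewrite normcZ !normc_real !ger0_norm ?H ?enorm_ge0//;
    by rewrite ?mulr_ge0 ?powR_ge0 ?expR_ge0// ltW.
rewrite (cLnormZ (C * t `^ (- (p / 2))) (ltr0n _ 2) (cmeasurable_real mg)).
rewrite cLnorm2_gaussian ?mulr_gt0// ger0_norm ?mulr_ge0 ?powR_ge0 ?(ltW C0)//.
rewrite -EFinM lee_fin.
have -> : pi / (b * t) = pi / b * t `^ (-1) :> R.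
  by rewrite powR_inv1 ?(ltW t0)// invfM mulrA.
rewrite powRM ?(ltW pb) ?powR_ge0// -powRrM.
have -> : C * t `^ (- (p / 2)) * ((pi / b) `^ (n%:R / 4) * t `^ (-1 * (n%:R / 4))) =
  C * (pi / b) `^ (n%:R / 4) * t `^ (- P).
  have -> : - P = - (p / 2) + -1 * (n%:R / 4) by rewrite /P; ring.
  rewrite (@powRD _ t (- (p / 2)) (-1 * (n%:R / 4))); last by rewrite (gt_eqF t0) implybT.
  by rewrite mulrACA.
rewrite -!mulrA ler_pM2l// ler_pM2l ?powR_gt0//.
exact: powRN_shift.
Qed.

End gaussian_norms.

(** * Error multipliers for the three data *)

Section profile_error.
Variables (R : realType) (tau delta : R).
Hypotheses (tau0 : 0 < tau) (delta0 : 0 < delta).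

(* The error for the j-th unit vector as data: the two factors are then the
   values of psi_1 + tau psi_2 and of psi_0 - tau^2 psi_2. *)
Definition profile_error (j l : nat) (t r : R) : R :=
  propagator tau delta j (r ^+ 2) l t
  - (sin_symbol delta l t r + Nhat tau delta l t r) *
    ((j == 1)%:R + tau * (j == 2)%:R)
  - cos_symbol delta l t r * ((j == 0)%:R - tau ^+ 2 * (j == 2)%:R).

Lemma profile_error_low : exists b C, [/\ 0 < b, 0 < C & forall j l t r,
  (j <= 2)%N -> (l <= 2)%N -> 0 <= t -> 0 < r -> r <= 1 ->
  `|profile_error j l t r| <=
  C * (r ^+ l.+1 * expR (- b * r ^+ 2 * t) + expR (- b * t))].
Proof.
have [b [C [b0 C0 H]]] := low_frequency tau0 delta0.
exists b, C; split=> // j l t r hj hl t0 r0 r1.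
have := H r _ r0 r1 (propagator_mgt_ode tau0 delta0 j r) t l t0 hl.
have i l' : (l' <= 2)%N -> propagator tau delta j (r ^+ 2) l' 0 = (j == l')%:R.
  by move=> hl'; exact: (@propagator_init R tau delta tau0 j _ l' (sqr_ge0 r) hj hl').
rewrite !i// -/(profile_error j l t r).
suff -> : `|(j == 0)%:R| + `|(j == 1)%:R| + `|(j == 2)%:R| = 1 :> R by rewrite mulr1.
by move: j hj {H i} => [|[|[|//]]] _ /=; rewrite normr0 normr1; ring.
Qed.

Lemma profile_error_high : exists b C, [/\ 0 < b, 0 < C & forall j l t r,
  (j <= 2)%N -> (l <= 2)%N -> 1 <= t -> 1 <= r ->
  r ^+ (2 - l) * `|profile_error j l t r| <= C * r ^+ (2 - j) * expR (- b * t)].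
Proof.
have [b [C [b0 C0 H]]] := high_frequency_difference tau0 delta0.
exists b, C; split=> // j l t r hj hl t1 r1.
have := H r _ r1 (propagator_mgt_ode tau0 delta0 j r) t l t1 hl.
have i l' : (l' <= 2)%N -> propagator tau delta j (r ^+ 2) l' 0 = (j == l')%:R.
  by move=> hl'; exact: (@propagator_init R tau delta tau0 j _ l' (sqr_ge0 r) hj hl').
rewrite !i// -/(profile_error j l t r).
suff -> : r ^+ 2 * `|(j == 0)%:R| + r * `|(j == 1)%:R| + `|(j == 2)%:R| = r ^+ (2 - j) by [].
by move: j hj {H i} => [|[|[|//]]] _ /=; rewrite normr0 normr1; ring.
Qed.

(** Puts both regimes in a form that can be integrated over all frequencies. At low frequency exp (-
    b t) is accompanied by a Gaussian in r, written so as to match [gaussian_moment_decay] at time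
    1. At high frequency the j-th datum receives the Sobolev exponent max (k - 2 + l, 0) + 2 - j, as
    in the norm of the theorem. *)
Lemma profile_error_le (k : R) (l : nat) : 0 <= k -> (l <= 2)%N ->
  exists b C, [/\ 0 < b, 0 < C & forall j t r, (j <= 2)%N -> 1 <= t -> 0 < r ->
  (r <= 1 -> r `^ k * `|profile_error j l t r| <=
    C * (r `^ (k + 1 + l%:R) * expR (- b * r ^+ 2 * t) +
         expR (- b * t) * expR (- 1 * r ^+ 2 * 1))) /\
  (1 <= r -> r `^ k * `|profile_error j l t r| <=
    C * expR (- b * t) *
    Num.sqrt (1 + r ^+ 2) `^ (Num.max (k - 2 + l%:R) 0 + (2 - j)%:R))].
Proof.
move=> k0 hl.
have [b1 [C1 [b10 C10 H1]]] := profile_error_low.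
have [b2 [C2 [b20 C20 H2]]] := profile_error_high.
pose b := Num.min b1 b2; pose C := C1 * expR 1 + C2.
have b0 : 0 < b by rewrite lt_min b10 b20.
have bb1 : b <= b1 by rewrite ge_min lexx.
have bb2 : b <= b2 by rewrite ge_min lexx orbT.
have C1e : 0 < C1 * expR 1 by rewrite mulr_gt0// expR_gt0.
exists b, C; split; [by []|by rewrite addr_gt0|move=> j t r hj t1 r0].
have t0 : 0 <= t by apply: le_trans t1.
have rge := ltW r0.
have emon x c : 0 <= x -> b <= c -> expR (- c * x) <= expR (- b * x).
  by move=> x0 bc; rewrite ler_expR !mulNr lerN2 ler_wpM2r.
split=> r1.
  have rk1 : r `^ k <= 1.
    have := ge0_ler_powR k0; move=> /(_ r 1); rewrite !nnegrE rge ler01 powR1.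
    by apply.
  apply: (@le_trans _ _ (r `^ k * (C1 * (r ^+ l.+1 * expR (- b * r ^+ 2 * t) + expR (- b * t))))).
    rewrite ler_wpM2l ?powR_ge0//; apply: le_trans (H1 _ _ _ _ hj hl t0 r0 r1) _.
    rewrite ler_pM2l// lerD//; last exact: emon.
    rewrite ler_wpM2l ?exprn_ge0// -!(mulrA _ (r ^+ 2)); apply: emon => //.
    by rewrite mulr_ge0 ?exprn_ge0.
  have -> : r `^ (k + 1 + l%:R) = r `^ k * r ^+ l.+1.
    rewrite -addrA powRD; last by rewrite (gt_eqF r0) implybT.
    by rewrite nat1r powR_mulrn.
  (* The factor exp 1 in the constant pays for the Gaussian, which is at least exp (- 1) for r <=
     1. *)
  have e1 : 1 <= expR 1 * expR (- 1 * r ^+ 2 * 1).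
    rewrite -expRD -[leLHS]expR0 ler_expR mulr1 mulN1r subr_ge0.
    by rewrite expr_le1.
  have ec : C1 <= C1 * expR 1 by rewrite ler_peMr ?(ltW C10)// -[leLHS]expR0 ler_expR.
  have E0 : 0 <= expR (- b * t) by exact: expR_ge0.
  have A0 : 0 <= r `^ k * r ^+ l.+1 * expR (- b * r ^+ 2 * t).
    by rewrite !mulr_ge0 ?powR_ge0 ?exprn_ge0 ?expR_ge0.
  rewrite mulrCA mulrDr mulrA !mulrDr.
  apply: lerD.
    by rewrite ler_wpM2r// /C; move: C20 ec; lra.
  apply: (@le_trans _ _ (C1 * expR 1 * (expR (- b * t) * expR (- 1 * r ^+ 2 * 1)))).
    rewrite -mulrA ler_pM2l// mulrCA.
    rewrite -[leLHS]mulrC; apply: ler_wpM2l => //; exact: le_trans rk1 e1.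
  by rewrite ler_wpM2r ?mulr_ge0 ?expR_ge0// /C lerDl ltW.
have q0 : 0 < Num.sqrt (1 + r ^+ 2) by rewrite sqrtr_gt0 ltr_wpDr ?sqr_ge0.
have rq : r <= Num.sqrt (1 + r ^+ 2).
  by rewrite -[leLHS]ger0_norm// -sqrtr_sqr ler_wsqrtr// lerDr.
have l2 : (2 - l)%:R = 2 - l%:R :> R by rewrite natrB.
(* The factor r^(2 - l) is the weight in [profile_error_high]. The other exponent may be negative,
   and as r >= 1 it can be replaced by its positive part. *)
have -> : r `^ k = r `^ (k - 2 + l%:R) * r ^+ (2 - l).
  rewrite -powR_mulrn// l2 -powRD; last by rewrite (gt_eqF r0) implybT.
  by congr (_ `^ _); ring.
rewrite -mulrA (@powRD _ (Num.sqrt _)); last by rewrite (gt_eqF q0) implybT.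
set sg := Num.max _ _.
have h1 : r `^ (k - 2 + l%:R) <= Num.sqrt (1 + r ^+ 2) `^ sg.
  apply: (@le_trans _ _ (r `^ sg)); first by rewrite ler_powR// le_max lexx.
  have sg0 : 0 <= sg by rewrite le_max lexx orbT.
  by apply: (ge0_ler_powR sg0) => //; rewrite nnegrE ltW.
have h2 : r ^+ (2 - j) <= Num.sqrt (1 + r ^+ 2) `^ (2 - j)%:R.
  by rewrite powR_mulrn ?(ltW q0)// lerXn2r ?nnegrE ?(ltW q0).
apply: (@le_trans _ _ (Num.sqrt (1 + r ^+ 2) `^ sg *
   (C2 * Num.sqrt (1 + r ^+ 2) `^ (2 - j)%:R * expR (- b * t)))).
  apply: ler_pM => //; rewrite ?powR_ge0 ?mulr_ge0 ?exprn_ge0//.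
  apply: le_trans (H2 _ _ _ _ hj hl t1 r1) _.
  apply: ler_pM => //; rewrite ?mulr_ge0 ?exprn_ge0 ?expR_ge0 ?(ltW C20)//.
    by rewrite ler_pM2l.
  exact: emon.
rewrite [leRHS](_ : _ = Num.sqrt (1 + r ^+ 2) `^ sg *
   (C * Num.sqrt (1 + r ^+ 2) `^ (2 - j)%:R * expR (- b * t))); last by ring.
rewrite ler_wpM2l ?powR_ge0// ler_wpM2r ?expR_ge0// ler_wpM2r ?powR_ge0//.
by rewrite /C lerDr ltW.
Qed.

End profile_error.

(** * Fourier transform of the error *)

Section error_representation.
Variables (R : realType) (n : nat).
Local Notation mu := (leb R n).
Local Notation normc := Normc.normc.

Lemma collect_profile (p0 p1 p2 S V a c : R) (w0 w1 w2 : R[i]) :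
  p0%:C * w0 + p1%:C * w1 + p2%:C * w2 - S%:C * (w1 + a%:C * w2)
    - V%:C * (w0 - c%:C * w2) =
  (p0 - V)%:C * w0 + (p1 - S)%:C * w1 + (p2 - a * S + c * V)%:C * w2.
Proof. by rewrite !(rmorphD, rmorphB, rmorphM, rmorphN) /=; ring. Qed.

(** The solution and the two approximating terms all act on the three data as multipliers, so the
    error acts on each datum through the error of the corresponding unit vector. *)
Lemma error_representation (tau delta s : R) (psi0 psi1 psi2 : Rn R n -> R[i])
    (psi : nat -> R -> Rn R n -> R[i]) (U V : Rn R n -> R[i]) (l : nat) (t : R) :
  0 < tau -> 0 < delta -> 0 <= s -> (l <= 2)%N -> 0 < t ->
  inL 2 psi0 -> inL 2 psi1 -> inL 2 psi2 ->
  MGT_solution tau delta s psi0 psi1 psi2 psi ->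
  is_multiplier (fun r => sin_symbol delta l t r + Nhat tau delta l t r)
    (fun x => psi1 x + tau%:C * psi2 x) U ->
  is_multiplier (cos_symbol delta l t)
    (fun x => psi0 x - (tau ^+ 2)%:C * psi2 x) V ->
  is_fourier (fun x => psi l t x - U x - V x)
    (fourier (fun x => psi l t x - U x - V x)) /\
  {ae mu, forall xi, fourier (fun x => psi l t x - U x - V x) xi =
    (profile_error tau delta 0 l t (enorm xi))%:C * fourier psi0 xi +
    (profile_error tau delta 1 l t (enorm xi))%:C * fourier psi1 xi +
    (profile_error tau delta 2 l t (enorm xi))%:C * fourier psi2 xi}.
Proof.
move=> tau0 delta0 s0 l2 t0 L0 L1 L2 sol mU mV.
have [i0 i1 i2] := MGT_init sol.
have H j : (j <= 2)%N -> is_fourier (psi j 0) (fourier (psi j 0)).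
  by move=> j2; have [] := MGT_inH sol j2 (lexx 0).
have [F0 W0] := fourierP (is_fourier_ae (H 0%N isT) L0 i0).
have [F1 W1] := fourierP (is_fourier_ae (H 1%N isT) L1 i1).
have [F2 W2] := fourierP (is_fourier_ae (H 2%N isT) L2 i2).
have [_ WU] := fourierP (is_fourier_lin tau F1 F2).
have [_ WV] := fourierP (is_fourierB F0 (is_fourierZ (tau ^+ 2) F2)).
have Ft : is_fourier (psi l t) (fourier (psi l t)).
  by have [] := MGT_inH sol l2 (ltW t0).
have [Fe We] := fourierP (is_fourierB (is_fourierB Ft mU) mV).
split=> //.
(* The null sets of the countably many balls are united, so that almost every frequency can use a
   ball that contains it, with radius [Num.bound (enorm xi)]. *)
have D : {ae mu, forall xi, forall m : nat, enorm xi <= m%:R -> fourier (psi l t) xi =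
  (propagator tau delta 0 (enorm xi ^+ 2) l t)%:C * fourier (psi 0%N 0) xi +
  (propagator tau delta 1 (enorm xi ^+ 2) l t)%:C * fourier (psi 1%N 0) xi +
  (propagator tau delta 2 (enorm xi ^+ 2) l t)%:C * fourier (psi 2%N 0) xi}.
  by apply: ae_foralln => m; exact: (duhamel_cut tau0 delta0 s0 sol m l2 t0).
apply: filterS2 We (filterI (filterI D (filterI WU WV)) (filterI W0 (filterI W1 W2))).
move=> xi -> [[/(_ (Num.bound (enorm xi)) (ltW (archi_boundP (enorm_ge0 xi)))) -> [-> ->]] [-> [-> ->]]].
have -> : profile_error tau delta 0 l t (enorm xi) =
    propagator tau delta 0 (enorm xi ^+ 2) l t - cos_symbol delta l t (enorm xi).
  by rewrite /profile_error /=; ring.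
have -> : profile_error tau delta 1 l t (enorm xi) =
    propagator tau delta 1 (enorm xi ^+ 2) l t -
    (sin_symbol delta l t (enorm xi) + Nhat tau delta l t (enorm xi)).
  by rewrite /profile_error /=; ring.
have -> : profile_error tau delta 2 l t (enorm xi) =
    propagator tau delta 2 (enorm xi ^+ 2) l t -
    tau * (sin_symbol delta l t (enorm xi) + Nhat tau delta l t (enorm xi))
    + tau ^+ 2 * cos_symbol delta l t (enorm xi).
  by rewrite /profile_error /=; ring.
exact: collect_profile.
Qed.

End error_representation.

(** * Assembling the decay estimate *)

Section assembly.
Variables (R : realType) (n : nat).
Local Notation mu := (leb R n).
Local Notation normc := Normc.normc.

Lemma cLnorm_le_sum (p : R) (m : nat) (c : nat -> R) (F : nat -> Rn R n -> R)
    (f : Rn R n -> R[i]) : 1 <= p -> cmeasurable f ->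
  (forall i, 0 <= c i) -> (forall i, measurable_fun [set: Rn R n] (F i)) ->
  {ae mu, forall x, normc (f x) <= \sum_(i < m) c i * F i x} ->
  (cLnorm p f <= \sum_(i < m) (c i)%:E * cLnorm p (fun x => (F i x)%:C)%R)%E.
Proof.
move=> p1 mf c0 mF h; have p0 : 0 < p by apply: lt_le_trans p1.
have mS m' : cmeasurable (fun x => (\sum_(i < m') c i * F i x)%:C).
  apply: cmeasurable_real; apply: measurable_sum => i.
  by apply: measurable_funM => //; exact: measurable_cst.
apply: (@le_trans _ _ (cLnorm p (fun x => (\sum_(i < m) c i * F i x)%:C)%R)).
  apply: cLnorm_le => //; apply: filterS h => x h.
  by rewrite normc_real; apply: le_trans h (ler_norm _).
elim: m {h} => [|m IH].
  (* Empty sum: the zero function is 0 times itself, hence of norm 0. *)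
  have := cLnormZ 0 p0 (mS 0%N); rewrite normr0 mul0e big_ord0 => <-.
  le_of_eq; congr cLnorm.
  by apply/funext => x; rewrite big_ord0 mulr0.
rewrite big_ord_recr /=.
have -> : (fun x => (\sum_(i < m.+1) c i * F i x)%:C) =
  (fun x => (\sum_(i < m) c i * F i x)%:C + (c m)%:C * (F m x)%:C).
  by apply/funext => x; rewrite big_ord_recr rmorphD rmorphM.
have mFm : cmeasurable (fun x => (F m x)%:C) by exact: cmeasurable_real.
apply: le_trans (cLnorm_triangle p1 (mS m) (cmeasurableZ _ mFm)) _.
by apply: leeD => //; rewrite cLnormZ// ger0_norm.
Qed.

Lemma cLnorm_normc (p : R) (f : Rn R n -> R[i]) :
  cLnorm p (fun x => (normc (f x))%:C) = cLnorm p f.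
Proof.
rewrite /cLnorm; congr (Lnorm _ _ _); apply/funext => x.
by rewrite normc_real ger0_norm// normc_ge0.
Qed.

End assembly.

Section final_bounds.
Variable R : realType.

(** If one of the Sobolev norms is infinite, so is the right side, its factor being positive;
    otherwise the inequality is one between reals. *)
Lemma collect_decay (a1 a2 a3 e y0 y1 y2 : R) (x0 x1 x2 : \bar R) :
  0 < a1 -> 0 < a2 -> 0 < a3 -> 0 < e -> 0 <= y0 -> 0 <= y1 -> 0 <= y2 ->
  (0 <= x0)%E -> (0 <= x1)%E -> (0 <= x2)%E ->
  ((a1 * e * (y0 + y1 + y2))%:E + (a2 * e * (y0 + y1 + y2))%:E +
   (a3 * e)%:E * x0 + (a3 * e)%:E * x1 + (a3 * e)%:E * x2 <=
   ((a1 + a2 + a3) * e)%:E *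
   ((x0 + y0%:E) + (x1 + y1%:E) + (x2 + y2%:E)))%E.
Proof.
move=> a10 a20 a30 e0 y00 y10 y20.
have A0 : (0 < ((a1 + a2 + a3) * e)%:E)%E by rewrite lte_fin mulr_gt0// !addr_gt0.
have h (x : \bar R) : x = +oo%E ->
  (((a1 + a2 + a3) * e)%:E * x = +oo)%E by move=> ->; exact: gt0_muley.
case: x0 => [x0||//] X0; case: x1 => [x1||//] X1; case: x2 => [x2||//] X2;
  try by rewrite h ?leey.
rewrite -!(EFinM, EFinD) lee_fin; rewrite !lee_fin in X0 X1 X2.
have : 0 <= a3 * e * (y0 + y1 + y2) by rewrite !(mulr_ge0, addr_ge0)// ltW.
have : 0 <= (a1 + a2) * e * (x0 + x1 + x2).
  by rewrite !(mulr_ge0, addr_ge0)// ltW.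
lra.
Qed.

Lemma split_low (k0 d0 d1 d2 n0 n1 n2 X b0 b1 b2 : R) :
  0 <= k0 -> 0 <= d0 -> 0 <= d1 -> 0 <= d2 -> 0 <= n0 -> 0 <= n1 -> 0 <= n2 ->
  k0 * d0 <= X -> k0 * d1 <= X -> k0 * d2 <= X ->
  n0 <= b0 -> n1 <= b1 -> n2 <= b2 ->
  k0 * (d0 * n0 + d1 * n1 + d2 * n2) <= X * (b0 + b1 + b2).
Proof.
move=> *; rewrite !mulrDr !mulrA.
by rewrite !lerD// ler_pM// mulr_ge0.
Qed.

Lemma split_high (k0 d0 d1 d2 n0 n1 n2 X0 X1 X2 : R) :
  0 <= n0 -> 0 <= n1 -> 0 <= n2 ->
  k0 * d0 <= X0 -> k0 * d1 <= X1 -> k0 * d2 <= X2 ->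
  k0 * (d0 * n0 + d1 * n1 + d2 * n2) <= X0 * n0 + X1 * n1 + X2 * n2.
Proof. by move=> *; rewrite !mulrDr !mulrA !lerD// ler_wpM2r. Qed.

End final_bounds.

Section pointwise.
Variable R : realType.
Local Notation normc := Normc.normc.

(** The low regime is covered by the first two terms and the high regime by the last three. All five
    are nonnegative, so their sum holds for every r and can be integrated without splitting the
    domain. *)
Lemma error_pointwise (D : nat -> R) (k a sg b C t r q b0 b1 b2 : R)
    (w0 w1 w2 : R[i]) : 0 < C -> 0 < r ->
  (forall j, (j <= 2)%N ->
   (r <= 1 -> r `^ k * `|D j| <= C * (r `^ a * expR (- b * r ^+ 2 * t) +
       expR (- b * t) * expR (- 1 * r ^+ 2 * 1))) /\
   (1 <= r -> r `^ k * `|D j| <= C * expR (- b * t) * q `^ (sg + (2 - j)%:R))) ->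
  normc w0 <= b0 -> normc w1 <= b1 -> normc w2 <= b2 ->
  normc ((r `^ k)%:C * ((D 0%N)%:C * w0 + (D 1%N)%:C * w1 + (D 2%N)%:C * w2)) <=
  C * (b0 + b1 + b2) * (r `^ a * expR (- b * r ^+ 2 * t)) +
  C * (b0 + b1 + b2) * expR (- b * t) * (r `^ 0 * expR (- 1 * r ^+ 2 * 1)) +
  C * expR (- b * t) * normc ((q `^ (sg + (2 - 0)%:R))%:C * w0) +
  C * expR (- b * t) * normc ((q `^ (sg + (2 - 1)%:R))%:C * w1) +
  C * expR (- b * t) * normc ((q `^ (sg + (2 - 2)%:R))%:C * w2).
Proof.
move=> C0 r0 H h0 h1 h2.
have [H0 H0'] := H 0%N isT; have [H1 H1'] := H 1%N isT; have [H2 H2'] := H 2%N isT.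
rewrite !normcZ !(ger0_norm (powR_ge0 _ _)) powRr0 mul1r.
have n0 := normc_ge0 w0; have n1 := normc_ge0 w1; have n2 := normc_ge0 w2.
have B0 : 0 <= b0 + b1 + b2.
  by rewrite !addr_ge0//; [exact: le_trans n0 h0|exact: le_trans n1 h1|exact: le_trans n2 h2].
have E0 : 0 <= expR (- b * t) by exact: expR_ge0.
have CE : 0 <= C * expR (- b * t) by rewrite mulr_ge0// ltW.
have P j : 0 <= q `^ (sg + (2 - j)%:R) by exact: powR_ge0.
apply: (@le_trans _ _ (r `^ k * (`|D 0%N| * normc w0 + `|D 1%N| * normc w1 + `|D 2%N| * normc w2))).
  rewrite ler_wpM2l ?powR_ge0//; apply: le_trans (normc_le_add _ _) _.
  apply: lerD; last by rewrite normcZ.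
  by apply: le_trans (normc_le_add _ _) _; rewrite !normcZ.
have T j x : 0 <= x -> 0 <= C * expR (- b * t) * (q `^ (sg + (2 - j)%:R) * x).
  by move=> x0; apply: mulr_ge0 => //; apply: mulr_ge0.
have := T 0%N _ n0; have := T 1%N _ n1; have := T 2%N _ n2.
set x0 := _ * (_ * normc w0); set x1 := _ * (_ * normc w1); set x2 := _ * (_ * normc w2).
move=> x20 x10 x00.
have [r1|r1] := leP r 1.
  apply: le_trans (split_low (powR_ge0 _ _) (normr_ge0 _) (normr_ge0 _) (normr_ge0 _)
    n0 n1 n2 (H0 r1) (H1 r1) (H2 r1) h0 h1 h2) _.
  move: x20 x10 x00; lra.
apply: le_trans (split_high n0 n1 n2 (H0' (ltW r1)) (H1' (ltW r1)) (H2' (ltW r1))) _.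
rewrite -!(mulrA (C * expR _)) -/x0 -/x1 -/x2.
have y0 : 0 <= C * (b0 + b1 + b2) * (r `^ a * expR (- b * r ^+ 2 * t)).
  by rewrite !mulr_ge0 ?powR_ge0 ?expR_ge0// ltW.
have y1 : 0 <= C * (b0 + b1 + b2) * expR (- b * t) * expR (-1 * r ^+ 2 * 1).
  by rewrite !mulr_ge0 ?expR_ge0// ltW.
move: y0 y1; lra.
Qed.

End pointwise.

Theorem theorem2p2 (R : realType) (n : nat) (tau delta s k : R) (l : nat)
    (hn : (1 <= n)%N) (htau : 0 < tau) (hdelta : 0 < delta) (hs : 0 <= s)
    (hl : (l <= 2)%N) (hk : 0 <= k <= s + 2 - l%:R) :
  exists C T : R, [/\ 0 < C, 1 <= T &
    forall psi0 psi1 psi2 : Rn R n -> R[i], inA s psi0 psi1 psi2 ->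
    forall psi : nat -> R -> Rn R n -> R[i],
      MGT_solution tau delta s psi0 psi1 psi2 psi ->
    forall t : R, T <= t ->
    forall U V : Rn R n -> R[i],
      is_multiplier (fun r => sin_symbol delta l t r + Nhat tau delta l t r)
        (fun x => psi1 x + tau%:C * psi2 x) U ->
      is_multiplier (cos_symbol delta l t)
        (fun x => psi0 x - (tau ^+ 2)%:C * psi2 x) V ->
      (Hdotnorm k (fun x => psi l t x - U x - V x)%R <=
        (C * (1 + t) `^ (- (n%:R / 4) - (k + 1 + l%:R) / 2))%R%:E *
        Anorm (Num.max (k - 2 + l%:R) 0)%R psi0 psi1 psi2)%E].
Proof.
have k0 : 0 <= k by case/andP: hk.
have [b [C [b0 C0 HP]]] := profile_error_le htau hdelta k0 hl.
pose a := k + 1 + l%:R; have a0 : 0 <= a by rewrite !addr_ge0.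
have [M1 M10 H1] := gaussian_moment_decay n b0 a0.
have [M2 M20 H2] := gaussian_moment_decay n (@ltr01 R) (lexx 0).
pose P := n%:R / 4 + a / 2 : R.
have P0 : 0 <= P by rewrite addr_ge0// divr_ge0.
have [M3 M30 H3] := expR_powR_decay b0 P0.
(* Introduced with a defining equation, so that the constant stays an atom for the algebraic
   tactics; likewise for [K]. *)
have [N2 N2E N20] : exists2 N2 : R, N2 = M2 * (1 + 1) `^ (- (n%:R / 4 + 0 / 2)) & 0 < N2.
  by eexists; [reflexivity|rewrite mulr_gt0// powR_gt0].
have [K KE K0] : exists2 K : R, K = (2 * pi) `^ (- (n%:R / 2)) * 2 & 0 < K.
  by eexists; [reflexivity|rewrite mulr_gt0// powR_gt0// mulr_gt0// pi_gt0].
have p1 : 0 < C * K * M1 by rewrite !mulr_gt0.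
have p2 : 0 < C * K * M3 * N2 by rewrite !mulr_gt0.
have p3 : 0 < C * M3 by rewrite mulr_gt0.
(* T = 1 is the time from which the high-frequency bound on the profile holds. *)
exists (C * K * M1 + C * K * M3 * N2 + C * M3), 1; split=> //.
  by rewrite !addr_gt0.
move=> psi0 psi1 psi2 [[[F0 _] I0] [[F1 _] I1] [[F2 _] I2]] psi sol t t1 U V mU mV.
have t0 : 0 < t by apply: lt_le_trans t1.
have [Lp0 [mw0 _] _] := F0; have [Lp1 [mw1 _] _] := F1; have [Lp2 [mw2 _] _] := F2.
have [[_ [mf _] _] rep] := error_representation htau hdelta hs hl t0 Lp0 Lp1 Lp2 sol mU mV.
have yE (g : Rn R n -> R[i]) : inL 1 g -> (cLnorm 1 g = (fine (cLnorm 1 g))%:E)%E.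
  by move=> [_ g1]; rewrite fineK// ge0_fin_numE// cLnorm_ge0.
have y0 (g : Rn R n -> R[i]) : 0 <= fine (cLnorm 1 g) by rewrite fine_ge0// cLnorm_ge0.
pose B := K * fine (cLnorm 1 psi0) + K * fine (cLnorm 1 psi1) + K * fine (cLnorm 1 psi2).
have BE : B = K * (fine (cLnorm 1 psi0) + fine (cLnorm 1 psi1) + fine (cLnorm 1 psi2)).
  by rewrite /B; ring.
have B0 : 0 <= B.
  by rewrite BE mulr_ge0 ?addr_ge0// ltW.
have bd (g : Rn R n -> R[i]) : is_fourier g (fourier g) -> inL 1 g ->
    {ae leb R n, forall xi, Normc.normc (fourier g xi) <= K * fine (cLnorm 1 g)}.
  move=> Fg Ig; apply: filterS (fourier_L1_bound Fg Ig) => xi.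
  by rewrite mulrA -KE.
pose sg := Num.max (k - 2 + l%:R) 0.
pose e := expR (- b * t).
have e0 : 0 <= e by exact: expR_ge0.
(* The five terms of [error_pointwise]: a Gaussian moment that carries the polynomial rate, a fixed
   Gaussian with an exponentially small coefficient, and the three data with their Sobolev
   weights. *)
pose c i : R := match i with 0 => C * B | 1 => C * B * e | _ => C * e end.
pose ph j := match j with 0 => psi0 | 1 => psi1 | _ => psi2 end.
pose F i (xi : Rn R n) : R := match i with
  | 0 => enorm xi `^ a * expR (- b * enorm xi ^+ 2 * t)
  | 1 => enorm xi `^ 0 * expR (- 1 * enorm xi ^+ 2 * 1)
  | j.+2 => Normc.normc ((japanese xi `^ (sg + (2 - j)%:R))%:C * fourier (ph j) xi)
  end.
have mgs p c' t' : measurable_fun [set: Rn R n]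
    (fun xi => enorm xi `^ p * expR (- c' * enorm xi ^+ 2 * t') : R).
  apply: measurable_funM.
    by apply: (measurableT_comp (measurable_powR p)); exact: measurable_enorm.
  apply: measurableT_comp => //; apply: measurable_funM => //.
  by apply: measurable_funM => //; apply: measurable_funX; exact: measurable_enorm.
have mfk : cmeasurable (fun xi => (enorm xi `^ k)%:C *
    fourier (fun x => psi l t x - U x - V x) xi).
  apply: cmeasurableM => //.
  by apply: (measurableT_comp (measurable_powR k)); exact: measurable_enorm.
have c0 i : 0 <= c i by case: i => [|[|i]] /=; rewrite ?mulr_ge0// ltW.
have mF i : measurable_fun [set: Rn R n] (F i).
  case: i => [|[|j]]; [exact: mgs|exact: mgs|].
  apply: measurable_normc; apply: cmeasurable_weight.
  by case: j => [|[|j]]; [exact: mw0|exact: mw1|exact: mw2].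
have n12 : 1 <= 2 :> R by rewrite ler1n.
apply: le_trans (@cLnorm_le_sum R n 2 5 c F _ n12 mfk c0 mF _) _.
  (* The zero frequency, where the symbols contain 0^-1 = 0, is discarded as a null set. *)
  have sph : {ae leb R n, forall xi, enorm xi <> 0 :> R}.
    exists [set xi | enorm xi = 0]; split; last 2 first.
    - exact: leb_sphere0.
    - by move=> xi /= /contrapT.
    rewrite -[X in measurable X]setTI.
    exact: (measurable_enorm measurableT (measurable_set1 0)).
  apply: filterS2 rep (filterI sph (filterI (bd _ F0 I0) (filterI (bd _ F1 I1) (bd _ F2 I2)))).
  move=> xi -> [/eqP x0 [h0 [h1 h2]]].
  have r0 : 0 < enorm xi by rewrite lt_neqAle eq_sym x0 enorm_ge0.
  rewrite !big_ord_recr big_ord0 /= add0r.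
  exact: (error_pointwise (D := fun j => profile_error tau delta j l t (enorm xi))
    C0 r0 (fun j hj => HP j t (enorm xi) hj t1 r0) h0 h1 h2).
rewrite !big_ord_recr big_ord0 /= add0e.
have AE : Anorm sg psi0 psi1 psi2 =
    ((Hnorm (sg + 2) psi0 + (fine (cLnorm 1 psi0))%:E) +
     (Hnorm (sg + 1) psi1 + (fine (cLnorm 1 psi1))%:E) +
     (Hnorm sg psi2 + (fine (cLnorm 1 psi2))%:E))%E.
  by rewrite -(yE _ I0) -(yE _ I1) -(yE _ I2).
rewrite -/sg AE.
have -> : - (n%:R / 4) - (k + 1 + l%:R) / 2 = - P by rewrite /P /a; ring.
have e1 : 0 < (1 + t) `^ (- P) by rewrite powR_gt0// ltr_wpDr// ltW.
have h3 : e <= M3 * (1 + t) `^ (- P) by apply: H3; exact: ltW.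
apply: le_trans (collect_decay p1 p2 p3 e1 (y0 _) (y0 _) (y0 _)
  (Hnorm_ge0 (sg + 2) psi0) (Hnorm_ge0 (sg + 1) psi1) (Hnorm_ge0 sg psi2)).
have h4 : C * e <= C * M3 * (1 + t) `^ (- P) by rewrite -mulrA ler_pM2l.
have hH r r' g : r = r' -> ((C * e)%:E *
    cLnorm 2 (fun xi => (Normc.normc ((japanese xi `^ r)%:C * fourier g xi))%:C)%R
    <= (C * M3 * (1 + t) `^ (- P))%:E * Hnorm r' g :> \bar R)%E.
  move=> <-; rewrite cLnorm_normc.
  by apply: lee_wpmul2r; [exact: Hnorm_ge0|rewrite lee_fin].
have r2 : sg + (2 - 2)%:R = sg by rewrite subnn addr0.
have r1 : sg + (2 - 1)%:R = sg + 1 by [].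
have r0 : sg + (2 - 0)%:R = sg + 2 by [].
apply: leeD; last exact: hH r2.
apply: leeD; last exact: hH r1.
apply: leeD; last exact: hH r0.
apply: leeD.
  apply: le_trans (lee_wpmul2l _ (H1 t t1)) _; first by rewrite lee_fin mulr_ge0// ltW.
  by rewrite -EFinM lee_fin; le_of_eq; rewrite BE -/P; ring.
(* The fixed Gaussian is the moment of order p = 0 at time 1; the factor exp (- b t) is then traded
   for the polynomial rate. *)
apply: le_trans (lee_wpmul2l _ (H2 1 (lexx 1))) _; first by rewrite lee_fin !mulr_ge0// ltW.
rewrite -EFinM lee_fin -N2E.
apply: (@le_trans _ _ (C * B * (M3 * (1 + t) `^ (- P)) * N2)).
  by rewrite ler_pM2r// ler_wpM2l// mulr_ge0// ltW.
by rewrite BE; le_of_eq; ring.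
Qed.
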